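(* Let $\boldsymbol{\alpha}=\{r_1,\dots,r_n\}$, $\boldsymbol{\beta}=\{q_1,\dots,q_n\}$ with all $r_i,q_i\in\mathbb{Q}\cap(0,1]$ satisfying $0<r_1\le r_2\le\cdots\le r_n<1$, $0<q_1\le\cdots\le q_{n-2}\le q_{n-1}=q_n=1$, and $q_i>r_{i+2}$ for $1\le i\le n-2$. Let $\mathit{HD}=\{\boldsymbol{\alpha},\boldsymbol{\beta}\}$, $M=M(\mathit{HD})$, and suppose $\gamma(\mathit{HD})\le1$. Then for each prime $p\equiv1\pmod M$ with $p>n+1$ which is ordinary, i.e. $F(\boldsymbol{\alpha},\boldsymbol{\beta};1)_{p-1}\not\equiv0\pmod p$, we have $$H_p(\boldsymbol{\alpha},\boldsymbol{\beta};1;\bar\omega_p)-\delta_{\gamma(\mathit{HD})=1}\,\Gamma_p\Big(\frac{\boldsymbol{\beta}}{\boldsymbol{\alpha}}\Big)p\equiv F(\boldsymbol{\alpha},\boldsymbol{\beta};1)_{p-1}\equiv\mu_{\boldsymbol{\alpha},\boldsymbol{\beta},1,p}\pmod{p^2}.$$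
   Context: $(a)_k=a(a+1)\cdots(a+k-1)$, $(a)_0=1$. $F(\boldsymbol{\alpha},\boldsymbol{\beta};z)=\sum_{k\ge0}\prod_{i=1}^n\frac{(r_i)_k}{(q_i)_k}z^k$ (the $q_i$ equal to $1$ include the factor $k!$); $F(\boldsymbol{\alpha},\boldsymbol{\beta};z)_{m-1}$ is the truncation $\sum_{k=0}^{m-1}$, and $F_s(\boldsymbol{\alpha},\boldsymbol{\beta};z)$ denotes the truncation after $p^s$ terms ($k\le p^s-1$). $M(\mathit{HD})$ is the least positive common denominator of all $r_i,q_j$; $\gamma(\mathit{HD})=-1+\sum_{i=1}^n(q_i-r_i)$; $\delta_{\gamma(\mathit{HD})=1}$ is $1$ if $\gamma(\mathit{HD})=1$ and $0$ otherwise. $\Gamma_p$ is Morita's $p$-adic gamma function ($\Gamma_p(n)=(-1)^n\prod_{1\le i\le n-1,p\nmid i}i$ on positive integers, extended continuously to $\mathbb{Z}_p$), and $\Gamma_p(\boldsymbol{\beta}/\boldsymbol{\alpha})=\prod_{i=1}^n\Gamma_p(q_i)/\Gamma_p(r_i)$. $\omega_p$ is the Teichmüller character of $\mathbb{F}_p^\times$ (values in $\mathbb{Z}_p$), extended by $0$ at $0$; for a character $A$ of $\mathbb{F}_p^\times$, $\mathfrak g(A)=\sum_{x\in\mathbb{F}_p^\times}A(x)\zeta_p^x$ with $\zeta_p$ a fixed primitive $p$-th root of unity in $\mathbb{C}_p$. With $A_j=\bar\omega_p^{(p-1)r_j}$, $B_j=\bar\omega_p^{(p-1)q_j}$ and $\lambda\in\mathbb{Z}_p^\times$,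 $$H_p(\boldsymbol{\alpha},\boldsymbol{\beta};\lambda;\bar\omega_p)=\frac1{1-p}\sum_{\chi}\chi\big((-1)^n\lambda\big)\prod_{j=1}^n\frac{\mathfrak g(A_j\chi)\,\mathfrak g(\overline{B_j}\,\overline\chi)}{\mathfrak g(A_j)\,\mathfrak g(\overline{B_j})},$$ summing over all characters $\chi$ of $\mathbb{F}_p^\times$. The Dwork unit root $\mu_{\boldsymbol{\alpha},\boldsymbol{\beta},1,p}$ is the $p$-adic unit satisfying $F_{s+1}(\boldsymbol{\alpha},\boldsymbol{\beta};1)/F_s(\boldsymbol{\alpha},\boldsymbol{\beta};1)\equiv\mu_{\boldsymbol{\alpha},\boldsymbol{\beta},1,p}\pmod{p^{s+1}}$ for all $s\ge0$. *)

(* Defs.v *)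
From HB Require Import structures.
From mathcomp Require Import all_boot all_order all_algebra.
From mathcomp Require Import all_classical all_reals.

Set Implicit Arguments.
Unset Strict Implicit.
Unset Printing Implicit Defensive.

Import Order.TTheory GRing.Theory Num.Theory.

Local Open Scope classical_set_scope.
Local Open Scope ring_scope.

Definition abs_closure (R : realType) (K : closedFieldType) (abs : K -> R)
    (S : set K) : set K :=
  [set x | forall e : R, 0 < e -> exists2 y, S y & abs (x - y) < e].

(* The field C_p of p-adic complex numbers with its absolute value, given by
   the properties that determine it up to isometric isomorphism: an
   algebraically closed field, complete for a non-archimedean absolute value
   with |p| = 1/p, in which the elements algebraic over Q_p are dense, where
   Q_p is the closure of the image of rat.  Multiplicativity, the ultrametric
   inequality and |p| = 1/p force the absolute value to be the p-adic one on
   rat and the characteristic to be 0.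
   MathComp's normed structures cannot be used here: they require
   `|x *+ n| = `|x| *+ n, which fails for a non-archimedean absolute value. *)
HB.mixin Record isPadicComplex (R : realType) (p : nat) K
    of GRing.ClosedField K := {
  pabs : K -> R ;
  pabs_ge0 : forall x, 0 <= pabs x ;
  pabs_eq0 : forall x, (pabs x == 0) = (x == 0) ;
  pabsM : forall x y, pabs (x * y) = pabs x * pabs y ;
  pabs_ultra : forall x y, pabs (x + y) <= Num.max (pabs x) (pabs y) ;
  pabs_p : pabs p%:R = p%:R^-1 ;
  pabs_complete : forall u : nat -> K,
    (forall e : R, 0 < e -> exists N, forall m n : nat,
       (N <= m)%N -> (N <= n)%N -> pabs (u m - u n) < e) ->
    exists l, forall e : R, 0 < e -> exists N, forall n : nat,
       (N <= n)%N -> pabs (u n - l) < e ;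
  pabs_alg_dense :
    abs_closure pabs [set y : K | exists P : {poly K},
      [/\ P != 0,
          forall i, abs_closure pabs (range (fun a : rat => ratr a)) P`_i
        & root P y]] = setT
}.

#[short(type="padicComplexType")]
HB.structure Definition PadicComplex (R : realType) (p : nat) :=
  {K of isPadicComplex R p K & GRing.ClosedField K}.

Section PadicNumbers.
Context {R : realType} {p : nat} {K : padicComplexType R p}.

Definition Qp : set K := abs_closure pabs (range (fun a : rat => ratr a)).

Definition Zp : set K := [set x | Qp x /\ pabs x <= 1].

Definition padic_eqmod (k : nat) (x y : K) : Prop :=
  exists2 z, Zp z & x - y = p%:R ^+ k * z.

Definition residue (x : K) : 'F_p :=
  xget 0 [set a : 'F_p | padic_eqmod 1 x (a : nat)%:R].

Definition teichmuller (a : 'F_p) : K :=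
  if a == 0 then 0
  else xget 0 [set w | [/\ Zp w, w ^+ p.-1 = 1 & padic_eqmod 1 w (a : nat)%:R]].

Definition morita_gamma_nat (n : nat) : K :=
  (-1) ^+ n * \prod_(1 <= i < n | ~~ (p %| i)%N) i%:R.

(* The extension by continuity: the limit of morita_gamma_nat n as n runs over
   the positive integers converging p-adically to x. *)
Definition morita_gamma (x : K) : K :=
  xget 0 [set y | forall e : R, 0 < e -> exists2 d : R, 0 < d &
    forall n : nat, (0 < n)%N -> pabs (n%:R - x) < d ->
      pabs (morita_gamma_nat n - y) < e].

End PadicNumbers.

Section HypergeometricDatum.
Variable n : nat.
Implicit Types (r q : 'I_n -> rat).

Definition hd_lcd r q : nat :=
  lcmn (\big[lcmn/1%N]_(i < n) `|denq (r i)|%N)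
       (\big[lcmn/1%N]_(i < n) `|denq (q i)|%N).

Definition hd_gamma r q : rat := -1 + \sum_(i < n) (q i - r i).

End HypergeometricDatum.

Definition pochhammer (a : rat) (k : nat) : rat := \prod_(i < k) (a + i%:R).

(* F(alpha, beta; z)_{m-1}: the m terms k = 0, ..., m - 1. *)
Definition hg_trunc (n : nat) (r q : 'I_n -> rat) (z : rat) (m : nat) : rat :=
  \sum_(k < m)
    (\prod_(i < n) (pochhammer (r i) k / pochhammer (q i) k)) * z ^+ k.

Section HypergeometricSum.
Context {R : realType} {p : nat} {K : padicComplexType R p}.

(* Characters of F_p^*, extended by 0 at 0 (including the trivial one). *)
Definition mul_character : set ('F_p -> K) :=
  [set chi | [/\ chi 0 = 0, chi 1 = 1
                & forall x y, chi (x * y) = chi x * chi y]].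

Definition gauss_sum (zeta : K) (A : 'F_p -> K) : K :=
  \sum_(x : 'F_p | x != 0) A x * zeta ^+ (x : nat).

(* The inverse (= complex conjugate) of a character; 0 at 0, as 0^-1 = 0. *)
Definition conj_character (A : 'F_p -> K) : 'F_p -> K := fun x => (A x)^-1.

Definition mulc (A B : 'F_p -> K) : 'F_p -> K := fun x => A x * B x.

(* \bar\omega_p^{(p-1) a}, for a > 0 such that (p-1) a is an integer. *)
Definition omega_bar_pow (a : rat) : 'F_p -> K :=
  fun x => conj_character teichmuller x ^+ Num.truncn (p.-1%:R * a).

Definition Hp (zeta : K) (n : nat) (r q : 'I_n -> rat) (lambda : K) : K :=
  (1 - p%:R)^-1 *
  \sum_(chi \in mul_character)
    (chi (residue ((-1) ^+ n * lambda)) *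
     \prod_(j < n)
       (let A := omega_bar_pow (r j) in
        let B' := conj_character (omega_bar_pow (q j)) in
        (gauss_sum zeta (mulc A chi) *
         gauss_sum zeta (mulc B' (conj_character chi))) /
        (gauss_sum zeta A * gauss_sum zeta B'))).

Definition gamma_quotient (n : nat) (r q : 'I_n -> rat) : K :=
  \prod_(i < n) (morita_gamma (ratr (q i)) / morita_gamma (ratr (r i))).

Definition dwork_unit_root (n : nat) (r q : 'I_n -> rat) (mu : K) : Prop :=
  [/\ Zp mu, pabs mu = 1
    & forall s : nat, padic_eqmod s.+1
        (ratr (hg_trunc r q 1 (p ^ s.+1) / hg_trunc r q 1 (p ^ s))) mu].

End HypergeometricSum.

(* Main.v *)
(** Put a_i = (p-1) r_i and b_i = (p-1) q_i. The identity
    g(A) g(B) = J(A, B) g(AB) turns the summand of H_p at the character om^k into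
    a product over i of quotients of Jacobi sums with values in Z_p. Since
    om(1 - x) = (1 - om x)^p modulo p^2, these are computed modulo p^2 by
    elementary sums over roots of unity. With c_k the k-th coefficient of F, and P
    the polynomial of degree sum_i (b_i - a_i) = (p-1)(gamma+1) <= 2(p-1) such that
    c_k = P(k) modulo p, the summand is c_k + p k P'(k) modulo p^2. Hence H_p - F
    is p times the sum of (X P)'(k) over k < p, which modulo p is the coefficient
    of P in degree 2(p-1): it vanishes unless gamma = 1, when it is
    prod_i a_i!/b_i! = Gamma_p(beta/alpha).

    In the same way c_(pk+l) = c_k (c_l + p k P'(l)) modulo p^2 for k, l < p, and
    the sum of P'(l) over l < p vanishes modulo p. So the truncation after p^2
    terms is the square of the truncation after p terms, modulo p^2, and the unit
    root is congruent to their quotient. The interlacing condition makes c_k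
    vanish modulo p^2 beyond the second smallest a_i, so that only k below all
    b_i matter. *)
Require Import Defs.
From HB Require Import structures.
From mathcomp Require Import all_boot all_order all_algebra.
From mathcomp Require Import cyclic.
From mathcomp Require Import all_classical all_reals.
From mathcomp Require Import ring lra zify.

Set Implicit Arguments.
Unset Strict Implicit.
Unset Printing Implicit Defensive.

Import Order.TTheory GRing.Theory Num.Theory.

Local Open Scope classical_set_scope.
Local Open Scope ring_scope.

(** * Congruences modulo powers of p in the valuation ring *)

Section AbsoluteValue.
Context {R : realType} {p : nat} {K : padicComplexType R p}.
Implicit Types (x y z : K).

(** The condition p = 1 modulo M makes every r_i equal to a_i/(p-1) with a_i a positive integer
    below p, so p r_i - r_i = a_i and Dwork's prime operation fixes the datum. The factors of
    (r_i)_k are then integers plus multiples of p, and in each block of p consecutive factors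
    exactly one is divisible by p.

    The Gross-Koblitz formula would express H_p through Gamma_p, whose expansion modulo p^2 needs
    p-adic analysis. Jacobi sums avoid this, and Gamma_p is then needed only modulo p, for the
    correction term. They also remove an obstacle: the Gauss sum of a nontrivial character is
    neither a unit nor in Q_p, but in the quotients all Gauss sums cancel.

    Congruences are carried out in the valuation ring of K, where only absolute values have to be
    bounded; that both sides lie in Q_p is a separate, algebraic matter. A factor p in front lowers
    the required precision from p^2 to p, which is why harmonic numbers and values of P' modulo p
    suffice. *)

Definition pint : {pred K} := [pred x | pabs x <= 1].

Lemma pabs0 : pabs (0 : K) = 0.
Proof. by apply/eqP; rewrite pabs_eq0. Qed.

Lemma pabs1 : pabs (1 : K) = 1.
Proof.
have h : pabs (1 : K) != 0 by rewrite pabs_eq0 oner_eq0.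
by apply: (mulfI h); rewrite -pabsM !mulr1.
Qed.

Lemma pabsX x m : pabs (x ^+ m) = pabs x ^+ m.
Proof. by elim: m => [|m IH]; rewrite ?expr0 ?pabs1 // !exprS pabsM IH. Qed.

Lemma pabsN x : pabs (- x) = pabs x.
Proof.
suff h : pabs (- 1 : K) = 1 by rewrite -mulN1r pabsM h mul1r.
apply/eqP; rewrite -(eqrXn2 (n := 2)) ?pabs_ge0 //.
by rewrite -pabsX sqrrN !expr1n pabs1.
Qed.

Lemma pabs_distC x y : pabs (x - y) = pabs (y - x).
Proof. by rewrite -opprB pabsN. Qed.

Lemma pabsV x : pabs x^-1 = (pabs x)^-1.
Proof.
have [->|x0] := eqVneq x 0; first by rewrite invr0 pabs0 invr0.
have h : pabs x != 0 by rewrite pabs_eq0.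
by apply: (mulfI h); rewrite -pabsM !mulfV // pabs1.
Qed.

Lemma pabs_ler_add (e : R) x y : pabs x <= e -> pabs y <= e -> pabs (x + y) <= e.
Proof. by move=> hx hy; apply: le_trans (pabs_ultra x y) _; rewrite ge_max hx hy. Qed.

Lemma pabs_ltr_add (e : R) x y : pabs x < e -> pabs y < e -> pabs (x + y) < e.
Proof. by move=> hx hy; apply: le_lt_trans (pabs_ultra x y) _; rewrite gt_max hx hy. Qed.

Lemma pabs_ltr_dist (e : R) x y z :
  pabs (x - y) < e -> pabs (y - z) < e -> pabs (x - z) < e.
Proof. by move=> h1 h2; rewrite -(subrKA y) pabs_ltr_add. Qed.

Lemma pint_zmod_closed : zmod_closed pint.
Proof.
split=> [|x y]; rewrite !inE ?pabs0 // => hx hy.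
by apply: pabs_ler_add; rewrite ?pabsN.
Qed.

Lemma pint_mulr_closed : mulr_closed pint.
Proof.
split=> [|x y]; rewrite !inE ?pabs1 // pabsM => hx hy.
by rewrite -[1]mulr1 ler_pM ?pabs_ge0.
Qed.

Lemma pint_subring_closed : subring_closed pint.
Proof.
have [h1 hM] := pint_mulr_closed; have [h0 hB] := pint_zmod_closed.
by split.
Qed.

HB.instance Definition _ := GRing.isSubringClosed.Build K pint pint_subring_closed.

Lemma pint_unitV x : pabs x = 1 -> x^-1 \in pint.
Proof. by move=> h; rewrite inE pabsV h invr1. Qed.

Lemma pabs_unit_pint x : pabs x = 1 -> x \in pint.
Proof. by move=> h; rewrite inE h. Qed.

Lemma pabs_unit_neq0 x : pabs x = 1 -> x != 0.
Proof. by move=> h; rewrite -pabs_eq0 h oner_eq0. Qed.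

(** The cofactor is only integral in K, whereas [padic_eqmod] also wants it in Q_p. The two aspects
    are treated apart, and [padic_eqmodE] recombines them. *)
Definition cong (k : nat) x y : Prop := exists2 z, z \in pint & x = y + p%:R ^+ k * z.

Lemma cong_refl k x : cong k x x.
Proof. by exists 0; rewrite ?rpred0 // mulr0 addr0. Qed.

Lemma cong_eq k x y : x = y -> cong k x y.
Proof. by move->; exact: cong_refl. Qed.

Lemma cong_sym k x y : cong k x y -> cong k y x.
Proof. by case=> z hz ->; exists (- z); rewrite ?rpredN // mulrN addrK. Qed.

Lemma cong_trans k y x z : cong k x y -> cong k y z -> cong k x z.
Proof.
case=> u hu -> [v hv ->]; exists (u + v); first by rewrite rpredD.
by rewrite -addrA -mulrDr [v + u]addrC.
Qed.

Lemma congD k x x' y y' : cong k x x' -> cong k y y' -> cong k (x + y) (x' + y').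
Proof.
case=> u hu -> [v hv ->]; exists (u + v); first by rewrite rpredD.
by rewrite mulrDr addrACA.
Qed.

Lemma congN k x x' : cong k x x' -> cong k (- x) (- x').
Proof.
by case=> u hu ->; exists (- u); rewrite ?rpredN // opprD mulrN.
Qed.

Lemma congB k x x' y y' : cong k x x' -> cong k y y' -> cong k (x - y) (x' - y').
Proof. by move=> h1 h2; apply: congD => //; apply: congN. Qed.

Lemma congM k x x' y y' : x' \in pint -> y' \in pint ->
  cong k x x' -> cong k y y' -> cong k (x * y) (x' * y').
Proof.
move=> hx hy [u hu ->] [v hv ->].
exists (x' * v + u * y' + p%:R ^+ k * (u * v)); last by ring.
by rewrite !(rpredD, rpredM, rpredX, rpred_nat).
Qed.

Lemma congMl k x y y' : x \in pint -> cong k y y' -> cong k (x * y) (x * y').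
Proof.
by move=> hx [v hv ->]; exists (x * v); rewrite ?rpredM // mulrDr mulrCA.
Qed.

Lemma congMr k x y y' : x \in pint -> cong k y y' -> cong k (y * x) (y' * x).
Proof. by rewrite ![_ * x]mulrC; apply: congMl. Qed.

Lemma cong_sum k (I : Type) (r : seq I) (P : pred I) (F G : I -> K) :
  (forall i, P i -> cong k (F i) (G i)) ->
  cong k (\sum_(i <- r | P i) F i) (\sum_(i <- r | P i) G i).
Proof.
move=> h; apply: (big_ind2 (cong k)) => //; first exact: cong_refl.
by move=> *; apply: congD.
Qed.

Lemma cong_sum0 k (I : Type) (r : seq I) (P : pred I) (F : I -> K) :
  (forall i, P i -> cong k (F i) 0) -> cong k (\sum_(i <- r | P i) F i) 0.
Proof.
move=> h; elim/big_ind: _ => //; first exact: cong_refl.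
by move=> x y hx hy; rewrite -[X in cong _ _ X]addr0; apply: congD.
Qed.

Lemma cong_pint k x y : cong k x y -> y \in pint -> x \in pint.
Proof. by case=> z hz -> hy; rewrite !(rpredD, rpredM, rpredX, rpred_nat). Qed.

Lemma cong_prod k (I : Type) (r : seq I) (P : pred I) (F G : I -> K) :
  (forall i, P i -> G i \in pint) ->
  (forall i, P i -> cong k (F i) (G i)) ->
  cong k (\prod_(i <- r | P i) F i) (\prod_(i <- r | P i) G i).
Proof.
move=> hG h.
suff []: \prod_(i <- r | P i) G i \in pint /\
  cong k (\prod_(i <- r | P i) F i) (\prod_(i <- r | P i) G i) by [].
apply: (big_ind2 (fun u v => v \in pint /\ cong k u v)).
- by split; [exact: rpred1 | exact: cong_refl].
- by move=> u v u' v' [h1 h2] [h3 h4]; split; [rewrite rpredM|apply: congM].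
- by move=> i Pi; split; [apply: hG|apply: h].
Qed.

Lemma congX k m x y : y \in pint -> cong k x y -> cong k (x ^+ m) (y ^+ m).
Proof.
move=> hy h; elim: m => [|m IH]; rewrite ?exprS; first exact: cong_refl.
by apply: congM; rewrite ?rpredX.
Qed.

Lemma cong_le k m x y : (m <= k)%N -> cong k x y -> cong m x y.
Proof.
move=> hmk [z hz ->]; exists (p%:R ^+ (k - m) * z).
  by rewrite !(rpredM, rpredX, rpred_nat).
by rewrite mulrA -exprD subnKC.
Qed.

Lemma cong_pM k m x y : cong k x y -> cong (m + k) (p%:R ^+ m * x) (p%:R ^+ m * y).
Proof. by case=> z hz ->; exists z => //; rewrite mulrDr exprD mulrA. Qed.

(** Behind a factor p, a congruence modulo p gives one modulo p^2; most first-order terms are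
    treated this way. *)
Lemma cong1_pM x y : cong 1 x y -> cong 2 (p%:R * x) (p%:R * y).
Proof. by move/(cong_pM 1); rewrite expr1. Qed.

Lemma cong0_pM x : x \in pint -> cong 1 (p%:R * x) 0.
Proof. by move=> hx; exists x => //; rewrite add0r expr1. Qed.

End AbsoluteValue.

(** Inversion does not preserve integrality, so there is no rule for it: the integrality of an
    inverse must be in the context. *)
Ltac inpint := repeat match goal with
  | H : is_true (?x \in mem pint) |- is_true (?x \in mem pint) => exact: H
  | |- is_true (0 \in _) => exact: rpred0
  | |- is_true (1 \in _) => exact: rpred1
  | |- is_true (_%:R \in _) => exact: rpred_nat
  | |- is_true (_ * _ \in _) => apply: rpredM
  | |- is_true (- _ \in _) => rewrite rpredN
  | |- is_true (_ + _ \in _) => apply: rpredD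
  | |- is_true (_ *+ _ \in _) => apply: rpredMn
  | |- is_true (_ ^+ _ \in _) => apply: rpredX
  | |- is_true (\sum_(_ <- _ | _) _ \in _) => apply: rpred_sum => ? ?
  | |- is_true (\prod_(_ <- _ | _) _ \in _) => apply: rpred_prod => ? ?
  end.

#[local] Hint Resolve cong_refl : core.

(** * Units, integers and p-th powers *)

Section PrimeAbs.
Context {R : realType} {p : nat} {K : padicComplexType R p}.
Hypothesis p_pr : prime p.
Implicit Types (x y z : K).

Local Notation pK := (p%:R : K).

Lemma pR_gt1 : 1 < p%:R :> R.
Proof. by rewrite ltr1n prime_gt1. Qed.

Lemma pR_gt0 : 0 < p%:R :> R.
Proof. by apply: lt_trans pR_gt1. Qed.

Lemma pK_neq0 : pK != 0.
Proof. by rewrite -pabs_eq0 pabs_p invr_eq0 gt_eqF ?pR_gt0. Qed.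

Lemma cong_pabs k x y : cong k x y <-> pabs (x - y) <= p%:R ^- k.
Proof.
split=> [[z hz ->]|h].
  rewrite addrC addKr pabsM pabsX pabs_p exprVn ler_piMr //.
  by rewrite invr_ge0 exprn_ge0 ?ler0n.
exists ((x - y) / pK ^+ k); last by rewrite mulrC divfK ?subrKC // expf_neq0 ?pK_neq0.
rewrite inE pabsM pabsV pabsX pabs_p exprVn invrK.
by rewrite -ler_pdivlMr ?exprn_gt0 ?pR_gt0 // mul1r.
Qed.

(** Bezout writes 1 as u p - v m; if m had absolute value below 1, the ultrametric inequality would
    give |1| < 1. *)
Lemma pabs_nat_unit (m : nat) : coprime p m -> pabs (m%:R : K) = 1.
Proof.
move=> cop; apply/eqP; rewrite eq_le; apply/andP; split.
  by have := rpred_nat (@pint R p K) m; rewrite inE.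
have [u v huv _] := egcdnP m (prime_gt0 p_pr).
rewrite (eqP cop) in huv.
rewrite leNgt; apply/negP => hlt.
have h1 : (1 : K) = u%:R * pK - v%:R * m%:R.
  by rewrite -!natrM huv natrD addrAC subrr add0r.
suff : pabs (1 : K) < 1 by rewrite pabs1 ltxx.
rewrite {1}h1; apply: pabs_ltr_add; rewrite ?pabsN pabsM.
  have hu : pabs (u%:R : K) <= 1 by have := rpred_nat (@pint R p K) u; rewrite inE.
  apply: le_lt_trans (_ : pabs pK < 1); last by rewrite pabs_p invf_lt1 ?pR_gt0 ?pR_gt1.
  by rewrite -[leRHS]mul1r ler_wpM2r ?pabs_ge0.
have hv : pabs (v%:R : K) <= 1 by have := rpred_nat (@pint R p K) v; rewrite inE.
apply: le_lt_trans hlt.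
by rewrite -[leRHS]mul1r ler_wpM2r ?pabs_ge0.
Qed.

Lemma coprime_lt m : (0 < m < p)%N -> coprime p m.
Proof. by case/andP=> m0 mp; rewrite prime_coprime // gtnNdvd. Qed.

Lemma pabs_small m : (0 < m < p)%N -> pabs (m%:R : K) = 1.
Proof. by move=> h; rewrite pabs_nat_unit ?coprime_lt. Qed.

Lemma pabs_fact m : (m < p)%N -> pabs (m`!%:R : K) = 1.
Proof.
elim: m => [|m IH] hm; first by rewrite fact0 pabs1.
by rewrite factS natrM pabsM IH ?pabs_small ?mulr1 ?hm // ltnW.
Qed.

Lemma natK_neq0 m : (0 < m)%N -> (m%:R : K) != 0.
Proof.
move=> m0; have [k cop ->] := pfactor_coprime p_pr m0.
rewrite natrM natrX mulf_neq0 ?expf_neq0 ?pK_neq0 //.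
by apply: pabs_unit_neq0; apply: pabs_nat_unit.
Qed.

Lemma pint_small m : (0 < m < p)%N -> (m%:R : K)^-1 \in pint.
Proof. by move=> h; apply: pint_unitV; apply: pabs_small. Qed.

Lemma pint_factV m : (m < p)%N -> (m`!%:R : K)^-1 \in pint.
Proof. by move=> h; apply: pint_unitV; apply: pabs_fact. Qed.

Lemma factK_neq0 m : (m`!%:R : K) != 0.
Proof. by rewrite natK_neq0 ?fact_gt0. Qed.

Lemma cong_abs_unit x y : cong 1 x y -> pabs y = 1 -> pabs x = 1.
Proof.
move=> /cong_pabs h hy.
have lt1 : pabs (x - y) < 1.
  by apply: le_lt_trans h _; rewrite expr1 invf_lt1 ?pR_gt0 ?pR_gt1.
apply/eqP; rewrite eq_le; apply/andP; split.
  rewrite -(subrK y x); apply: pabs_ler_add; [exact: ltW|by rewrite hy].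
rewrite leNgt; apply/negP => hx.
suff : pabs y < 1 by rewrite hy ltxx.
by rewrite -(subKr x y); apply: pabs_ltr_add; rewrite ?pabsN.
Qed.

Lemma congV k x y : (0 < k)%N -> pabs y = 1 -> cong k x y -> cong k x^-1 y^-1.
Proof.
move=> k0 hy h; have hx := cong_abs_unit (cong_le k0 h) hy.
case: h => z hz e; exists (- z / x / y).
  by rewrite !rpredM ?rpredN ?pint_unitV.
have x0 := pabs_unit_neq0 hx; have y0 := pabs_unit_neq0 hy.
have hz' : p%:R ^+ k * z = x - y by rewrite e addrC addKr.
by rewrite !mulrA mulrN hz'; field; rewrite x0 y0.
Qed.

Lemma cong_div k x x' y y' : (0 < k)%N -> x' \in pint -> pabs y' = 1 ->
  cong k x x' -> cong k y y' -> cong k (x / y) (x' / y').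
Proof.
move=> k0 hx hy h1 h2; apply: congM => //; first exact: pint_unitV.
exact: congV.
Qed.

Lemma cong_p x y : x \in pint -> cong 1 (y + p%:R * x) y.
Proof. by move=> hx; exists x; rewrite ?expr1. Qed.

Lemma cong_nat (m1 m2 : nat) k : (m1 = m2 %[mod p ^ k])%N -> cong k (m1%:R : K) m2%:R.
Proof.
wlog le : m1 m2 / (m2 <= m1)%N => [hw e|/eqP].
  case/orP: (leq_total m2 m1) => h; first exact: hw.
  by apply: cong_sym; apply: hw.
rewrite eqn_mod_dvd // => /dvdnP[d hd].
exists d%:R; first exact: rpred_nat.
by rewrite -natrX -natrM -natrD mulnC -hd subnKC.
Qed.

Lemma ltR_expn (e : R) : 0 < e -> exists N : nat, p%:R ^- N < e.
Proof.
move=> e0; exists (Num.trunc e^-1).+1.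
have h : e^-1 < (p ^ (Num.trunc e^-1).+1)%N%:R.
  apply: lt_trans (truncnS_gt _) _; rewrite ltr_nat.
  by rewrite ltn_expl // prime_gt1.
rewrite -natrX -[ltRHS]invrK ltf_pV2 ?posrE ?invr_gt0 //.
by rewrite ltr0n expn_gt0 prime_gt0.
Qed.

(** In the binomial expansion the linear term gains a factor p from ['C(p, 1)], and the later ones
    carry at least p^(2k). A p-th power thus gains a digit. *)
Lemma cong_expp k x y : (0 < k)%N -> y \in pint -> cong k x y ->
  cong k.+1 (x ^+ p) (y ^+ p).
Proof.
move=> k0 hy [z hz ->]; rewrite exprDn big_ord_recl bin0 subn0 expr0 mulr1 mulr1n.
set S := \sum_(i < p) _; suff : cong k.+1 S 0.
  by move=> h; rewrite -[X in cong _ _ X]addr0; apply: congD.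
apply: cong_sum0 => i _.
rewrite lift0; have [->|i0] := posnP i.
  exists (y ^+ p.-1 * z); first by rewrite !(rpredM, rpredX).
  rewrite bin1 expr1 add0r exprS -mulr_natr subn1; ring.
exists (y ^+ (p - i.+1) * z ^+ i.+1 * p%:R ^+ (k * i.+1 - k.+1) *+ 'C(p, i.+1)).
  by inpint.
rewrite add0r exprMn -exprM.
have -> : p%:R ^+ (k * i.+1) = p%:R ^+ k.+1 * p%:R ^+ (k * i.+1 - k.+1) :> K.
  by rewrite -exprD subnKC // mulnS -addn1 leq_add2l muln_gt0 k0.
move: (y ^+ _) (z ^+ _) (p%:R ^+ (_ - _)) (p%:R ^+ k.+1) => A B C D.
by rewrite mulrnAr; congr (_ *+ _); ring.
Qed.

End PrimeAbs.

(** * Pochhammer symbols modulo p^2 *)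

Section PairFactors.
Context {R : realType} {p : nat} {K : padicComplexType R p}.
Hypothesis p_pr : prime p.
Implicit Types (x y z : K) (a b k : nat).

Local Notation pK := (p%:R : K).

Definition harm m : K := \sum_(1 <= j < m.+1) j%:R^-1.

Lemma harm0 : harm 0 = 0.
Proof. by rewrite /harm big_geq. Qed.

Lemma harmS m : harm m.+1 = harm m + m.+1%:R^-1.
Proof. by rewrite /harm big_nat_recr. Qed.

Lemma pint_harm m : (m < p)%N -> harm m \in pint.
Proof.
elim: m => [|m IH] mp; first by rewrite harm0 rpred0.
by rewrite harmS rpredD ?IH ?pint_small // ltnW.
Qed.

(** The base case pairs j with p - j: 1/j + 1/(p - j) = p/(j(p - j)), so 2 H_{p-1} is divisible by
    p. Each step removes 1/(p - 1 - a), which is -1/(a + 1) modulo p. *)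
Lemma harm_refl a : (2 < p)%N -> (a < p)%N -> cong 1 (harm (p.-1 - a)) (harm a).
Proof.
have p0 := prime_gt0 p_pr; move=> p_odd.
elim: a => [_|a IH ap].
  rewrite subn0 harm0.
  have h2 : 2%:R * harm p.-1 = pK * \sum_(1 <= j < p) (j%:R^-1 * (p - j)%:R^-1).
    rewrite mulr_natl mulr2n {1 2}/harm prednK // {2}big_nat_rev /= -big_split mulr_sumr /=.
    apply: eq_big_nat => j /andP[j0 jp]; rewrite add1n subSS.
    have h1 := natK_neq0 (K := K) p_pr j0.
    have h3 : (p - j)%:R != 0 :> K by rewrite (natK_neq0 p_pr) // subn_gt0.
    have {1}-> : pK = j%:R + (p - j)%:R by rewrite -natrD subnKC // ltnW.
    by field; rewrite h1 h3.
  have n2 : pabs (2%:R : K) = 1 by rewrite (pabs_small p_pr).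
  have -> : harm p.-1 = 2%:R^-1 * (2%:R * harm p.-1).
    by rewrite mulKf // (natK_neq0 p_pr).
  rewrite h2 mulrCA; apply: cong0_pM; apply: rpredM; first exact: pint_unitV.
  rewrite big_nat; apply: rpred_sum => j /andP[j0 jp].
  by apply: rpredM; apply: (pint_small p_pr); lia.
have hap := ltnW ap; have := IH hap.
have -> : (p.-1 - a = (p.-1 - a.+1).+1)%N by lia.
rewrite !harmS => h.
have e : cong 1 (- ((p.-1 - a.+1).+1%:R^-1 : K)) a.+1%:R^-1.
  rewrite -invrN; apply: congV => //; first by apply: pabs_small.
  have -> : - ((p.-1 - a.+1).+1%:R : K) = a.+1%:R + pK * - 1.
    have -> : pK = (p.-1 - a.+1).+1%:R + a.+1%:R.
      by rewrite -natrD; congr _%:R; lia.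
    by ring.
  by apply: cong_p; rewrite rpredN rpred1.
by have := congD h e; rewrite addrK.
Qed.

(* For y = rho a = a / (p-1) this is the Pochhammer symbol (rho a)_k, because
   rho a = p * rho a - a (lemma rhoE). *)
Definition spoch a k y : K := \prod_(m < k) (m%:R - a%:R + pK * y).

Definition upoch c y : K := \prod_(1 <= j < c) (j%:R + pK * y).

Lemma spoch0 a y : spoch a 0 y = 1.
Proof. by rewrite /spoch big_ord0. Qed.

Lemma spochS a k y : spoch a k.+1 y = spoch a k y * (k%:R - a%:R + pK * y).
Proof. by rewrite /spoch big_ord_recr. Qed.

Lemma upochS c y : (0 < c)%N -> upoch c.+1 y = upoch c y * (c%:R + pK * y).
Proof. by move=> c0; rewrite /upoch big_nat_recr. Qed.

Lemma upoch1 y : upoch 1 y = 1.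
Proof. by rewrite /upoch big_geq. Qed.

(** An index shift by p k moves into y. This is why y stays free: the same estimates serve [rho a]
    and [rho a + k%:R]. *)
Lemma spochD a k c y : spoch a (p * k + c) y = spoch a (p * k) y * spoch a c (y + k%:R).
Proof.
rewrite /spoch big_split_ord /=; congr (_ * _).
by apply: eq_bigr => i _ /=; rewrite natrD natrM; ring.
Qed.

Lemma spoch_above a c y :
  spoch a (a + c.+1) y = pK * y * spoch a a y * upoch c.+1 y.
Proof.
elim: c => [|c IH]; first by rewrite addn1 spochS upoch1 subrr add0r mulr1 mulrC.
by rewrite addnS spochS IH (upochS _ (ltn0Sn c)) natrD; ring.
Qed.

Lemma pint_spoch a k y : y \in pint -> spoch a k y \in pint.
Proof. by move=> hy; rewrite /spoch; inpint. Qed.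

Lemma pint_upoch c y : y \in pint -> upoch c y \in pint.
Proof. by move=> hy; rewrite /upoch; inpint. Qed.

(** All factors are units, since m < k <= a < p, and differ from m - a by p y. The difference of
    harmonic numbers is the sum of 1/(a - m) over m < k. *)
Lemma spoch_low a k y : (k <= a)%N -> (a < p)%N -> y \in pint ->
  cong 2 (spoch a k y)
    ((-1) ^+ k * (a`!%:R / (a - k)`!%:R) * (1 - pK * (y * (harm a - harm (a - k))))).
Proof.
move=> ka ap hy; elim: k ka => [_|k IH ka].
  rewrite spoch0 subn0 expr0 divff ?(factK_neq0 p_pr) // subrr !mulr0 subr0 !mul1r.
  exact: cong_refl.
have ha := pint_harm ap.
have := IH (ltnW ka); rewrite spochS.
have -> : (a - k = (a - k.+1).+1)%N by lia.
set j := (a - k.+1)%N => IHk.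
have jp : (j.+1 < p)%N by rewrite /j; lia.
have hj : harm j \in pint by apply: pint_harm; lia.
have hj1 := @pint_small _ _ K p_pr j.+1 jp.
have hf := @pint_factV _ _ K p_pr _ (ltnW jp).
have hf1 := @pint_factV _ _ K p_pr _ jp.
have e : k%:R - a%:R = - j.+1%:R :> K.
  by rewrite /j -opprB -natrB ?(ltnW ka) // (_ : a - k = (a - k.+1).+1)%N //; lia.
apply: cong_trans (congMr _ IHk) _; first by inpint.
rewrite e harmS factS natrM exprS.
exists ((-1) ^+ k * (a`!%:R / j`!%:R) * (y ^+ 2 * j.+1%:R^-1 * (j.+1%:R^-1 - harm a + harm j))).
  by inpint.
have n1 := natK_neq0 (K := K) p_pr (ltn0Sn j); have n2 := factK_neq0 (K := K) p_pr j.
move: (harm a) (harm j) (a`!%:R) (j`!%:R) (j.+1%:R) ((-1) ^+ k) n1 n2 => A B C D E F n1 n2.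
by field; rewrite n1 n2.
Qed.

Lemma upoch_cong c y : (c < p)%N -> y \in pint ->
  cong 2 (upoch c.+1 y) (c`!%:R * (1 + pK * (y * harm c))).
Proof.
move=> cp hy; elim: c cp => [_|c IH cp].
  rewrite upoch1 harm0 !mulr0 addr0 mulr1; exact: cong_refl.
have hc := pint_harm (ltnW cp).
have hc1 := @pint_small _ _ K p_pr c.+1 cp.
rewrite upochS //; apply: cong_trans (congMr _ (IH (ltnW cp))) _; first by inpint.
rewrite harmS factS natrM.
exists (c`!%:R * (y ^+ 2 * harm c)); first by inpint.
have n1 := natK_neq0 (K := K) p_pr (ltn0Sn c).
move: (harm c) (c`!%:R) (c.+1%:R) n1 => A C E n1.
by field; rewrite n1.
Qed.

Lemma pabs_sign k : pabs ((-1) ^+ k : K) = 1.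
Proof. by rewrite pabsX pabsN pabs1 expr1n. Qed.

Lemma spoch_low1 a k y : (k <= a)%N -> (a < p)%N -> y \in pint ->
  cong 1 (spoch a k y) ((-1) ^+ k * (a`!%:R / (a - k)`!%:R)).
Proof.
move=> ka ap hy; apply: cong_trans (cong_le (m := 1) _ (spoch_low ka ap hy)) _ => //.
have ha := pint_harm ap.
have hj : harm (a - k) \in pint by apply: pint_harm; apply: leq_ltn_trans ap; exact: leq_subr.
have hf : ((a - k)`!%:R : K)^-1 \in pint.
  by apply: (pint_factV p_pr); apply: leq_ltn_trans ap; exact: leq_subr.
rewrite mulrBr mulr1; set X := _ * (_ / _).
have -> : X * (pK * (y * (harm a - harm (a - k)))) = pK * (X * (y * (harm a - harm (a - k)))) by ring.
by rewrite -mulrN; apply: cong_p; rewrite /X; inpint.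
Qed.

Lemma pabs_spoch_low a k y : (k <= a)%N -> (a < p)%N -> y \in pint ->
  pabs (spoch a k y) = 1.
Proof.
move=> ka ap hy; apply: (cong_abs_unit p_pr (spoch_low1 ka ap hy)).
rewrite !pabsM pabsV pabs_sign !(pabs_fact p_pr) // ?invr1 ?mulr1 //.
by apply: leq_ltn_trans ap; exact: leq_subr.
Qed.

Lemma upoch_cong1 c y : (c < p)%N -> y \in pint -> cong 1 (upoch c.+1 y) c`!%:R.
Proof.
move=> cp hy; apply: cong_trans (cong_le (m := 1) _ (upoch_cong cp hy)) _ => //.
have hc := pint_harm cp.
by rewrite mulrDr mulr1 mulrCA; apply: cong_p; inpint.
Qed.

Lemma pabs_upoch c y : (c < p)%N -> y \in pint -> pabs (upoch c.+1 y) = 1.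
Proof.
by move=> cp hy; apply: (cong_abs_unit p_pr (upoch_cong1 cp hy)); rewrite pabs_fact.
Qed.

(** The factor with m = a is exactly p y, so the remaining ones matter only modulo p. *)
Lemma spoch_high a c y : (a + c < p)%N -> y \in pint ->
  cong 2 (spoch a (a + c.+1) y) (pK * (y * ((-1) ^+ a * a`!%:R * c`!%:R))).
Proof.
move=> ap hy; rewrite spoch_above -!mulrA; apply: cong1_pM; apply: congMl => //.
rewrite [X in cong _ _ X]mulrA.
apply: congM; [by inpint|by inpint| |by apply: upoch_cong1 => //; lia].
apply: cong_trans (spoch_low1 _ _ hy) _ => //; first by lia.
by rewrite subnn fact0 divr1; apply: cong_refl.
Qed.

(* spoch a p y without its only factor p y divisible by p. *)
Definition wpoch a y : K := spoch a a y * upoch (p - a) y.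

Lemma spoch_full a y : (a < p)%N -> spoch a p y = pK * y * wpoch a y.
Proof.
move=> ap; have e : p = (a + (p - a).-1.+1)%N by lia.
transitivity (spoch a (a + (p - a).-1.+1) y); first by congr (spoch _ _ _).
by rewrite spoch_above /wpoch prednK ?subn_gt0 // !mulrA.
Qed.

Lemma pabs_wpoch a y : (a < p)%N -> y \in pint -> pabs (wpoch a y) = 1.
Proof.
move=> ap hy; rewrite /wpoch pabsM pabs_spoch_low //.
have -> : (p - a = (p.-1 - a).+1)%N by lia.
by rewrite pabs_upoch ?mulr1 //; lia.
Qed.

(** One step trades the factor p - (a + 1) for -(a + 1)(1 - p/(a + 1)); these corrections add up to
    the harmonic number. *)
Lemma fact_refl_cong a : (a < p)%N ->
  cong 2 ((-1) ^+ a * (a`!%:R * (p.-1 - a)`!%:R)) (p.-1`!%:R * (1 + pK * harm a)).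
Proof.
elim: a => [_|a IH ap].
  rewrite harm0 mulr0 addr0 mulr1 subn0 fact0 expr0 !mul1r; exact: cong_refl.
have ha := pint_harm (ltnW ap).
have ha1 := @pint_small _ _ K p_pr a.+1 ap.
have := IH (ltnW ap).
have -> : (p.-1 - a = (p.-1 - a.+1).+1)%N by lia.
set j := (p.-1 - a.+1)%N; set Z : K := p.-1`!%:R.
have hZ : Z \in pint by rewrite /Z; inpint.
have -> : (-1) ^+ a * (a`!%:R * j.+1`!%:R) =
   (1 - pK * a.+1%:R^-1) * ((-1) ^+ a.+1 * (a.+1`!%:R * j`!%:R)) :> K.
  rewrite !factS !natrM exprS.
  have -> : pK = j.+1%:R + a.+1%:R by rewrite -natrD /j; congr _%:R; lia.
  have n1 := natK_neq0 (K := K) p_pr (ltn0Sn a).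
  move: (j.+1%:R) (a.+1%:R) n1 => A B n1; by field.
set X := (-1) ^+ a.+1 * _ => h.
have hX : X \in pint by rewrite /X; inpint.
have h1 : cong 2 X ((1 + pK * a.+1%:R^-1) * ((1 - pK * a.+1%:R^-1) * X)).
  exists (a.+1%:R^-2 * X); first by rewrite -exprVn; inpint.
  by rewrite -exprVn; ring.
apply: cong_trans h1 _; apply: cong_trans (congMl _ h) _; first by inpint.
rewrite harmS; exists (Z * (a.+1%:R^-1 * harm a)); first by inpint.
ring.
Qed.

(** The lower factors contribute -p y H_a to first order and the upper ones p y H_{p-1-a}; these
    cancel by [harm_refl]. Modulo p^2 a complete block therefore does not depend on y. *)
Lemma wpoch_cong a y : (2 < p)%N -> (a < p)%N -> y \in pint ->
  cong 2 (wpoch a y) (p.-1`!%:R * (1 + pK * harm a)).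
Proof.
move=> p_odd ap hy; apply: cong_trans (fact_refl_cong ap).
have ha := pint_harm ap.
have hr : harm (p.-1 - a) \in pint by apply: pint_harm; lia.
apply: (@cong_trans _ _ _ _ (((-1) ^+ a * a`!%:R * (1 - pK * (y * harm a))) *
   ((p.-1 - a)`!%:R * (1 + pK * (y * harm (p.-1 - a)))))).
  rewrite /wpoch; apply: congM; [by inpint|by inpint| |].
    by have := spoch_low (leqnn a) ap hy; rewrite subnn fact0 divr1 harm0 subr0.
  have -> : (p - a = (p.-1 - a).+1)%N by lia.
  by apply: upoch_cong => //; lia.
have [z hz ->] := harm_refl p_odd ap; rewrite expr1.
exists (((-1) ^+ a * (a`!%:R * (p.-1 - a)`!%:R)) *
  (y * z - y * harm a * (y * (harm a + pK * z)))).
  by inpint.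
move: (harm a) (a`!%:R) ((p.-1 - a)`!%:R) ((-1) ^+ a) => A B C D; ring.
Qed.

Definition rho a : K := a%:R / p.-1%:R.

Lemma pint_rho a : rho a \in pint.
Proof.
apply: rpredM; first exact: rpred_nat.
by apply: (pint_small p_pr); have := prime_gt1 p_pr; lia.
Qed.

(** In Dwork's terms p r - r = a: for a < p, r is its own image under the prime operation, and r =
    -a modulo p. *)
Lemma rhoE a : rho a = pK * rho a - a%:R.
Proof.
have n1 : p.-1%:R != 0 :> K by rewrite (natK_neq0 p_pr) //; have := prime_gt1 p_pr; lia.
rewrite /rho; have -> : pK = p.-1%:R + 1 by rewrite natr1 prednK ?prime_gt0.
by field.
Qed.

Lemma pabs_rho a : (0 < a < p)%N -> pabs (rho a) = 1.
Proof.
by move=> ap; rewrite /rho pabsM pabsV !(pabs_small p_pr) ?invr1 ?mulr1 //; have := prime_gt1 p_pr; lia.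
Qed.

Lemma spoch_rho a k : spoch a k (rho a) = \prod_(m < k) (rho a + m%:R).
Proof. by apply: eq_bigr => i _; rewrite {2}rhoE; ring. Qed.

(** Each of the k blocks has one factor divisible by p, namely p (rho a + m). These multiply to p^k
    (rho a)_k, which is again a symbol for the same a. *)
Lemma spoch_rho_dwork a k : (a < p)%N ->
  spoch a (p * k) (rho a) =
  pK ^+ k * spoch a k (rho a) * \prod_(m < k) wpoch a (rho a + m%:R).
Proof.
move=> ap; elim: k => [|k IH]; first by rewrite muln0 !spoch0 big_ord0 expr0 !mulr1.
rewrite mulnS addnC spochD IH spoch_full // exprS spochS big_ord_recr /=.
have -> : k%:R - a%:R + pK * rho a = rho a + k%:R by rewrite {2}rhoE; ring.
ring.
Qed.

End PairFactors.

(** * The polynomial interpolating a coefficient modulo p *)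

Section PairPolynomials.
Context {R : realType} {p : nat} {K : padicComplexType R p}.
Hypothesis p_pr : prime p.
Implicit Types (x y z : K) (a b k : nat).

Local Notation pK := (p%:R : K).
Local Notation harm := (@harm R p K).
Local Notation rho := (@rho R p K).

Lemma cong_divl k x y z : (0 < k)%N -> pabs y = 1 -> z \in pint -> cong k x (y * z) ->
  cong k (x / y) z.
Proof.
move=> k0 hy hz h; have := congMr (pint_unitV hy) h.
by rewrite mulrAC divff ?mul1r // pabs_unit_neq0.
Qed.

Lemma cong_one_ratio x y : x \in pint -> y \in pint ->
  cong 2 ((1 - pK * x) / (1 - pK * y)) (1 - pK * x + pK * y).
Proof.
move=> hx hy; apply: cong_divl => //; last 2 first.
- by inpint.
- exists (- (y * x) + y ^+ 2); [by inpint|ring].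
apply: (cong_abs_unit p_pr (y := 1)); rewrite ?pabs1 // -mulrN.
by apply: cong_p; inpint.
Qed.

Definition pair_const a b : K := a`!%:R / b`!%:R.

(* Modulo p, (r)_k / (q)_k is the value at k of this polynomial, where
   a = (p-1) r = - r and b = (p-1) q = - q. *)
Definition pair_poly a b : {poly K} :=
  pair_const a b *: \prod_(a.+1 <= m < b.+1) (m%:R%:P - 'X).

(** For k <= a this is (-a)_k / (-b)_k. *)
Definition pair_low a b k : K := (a`!%:R / (a - k)`!%:R) * ((b - k)`!%:R / b`!%:R).

(** The derivative of [pair_poly] at its simple root k, for a < k <= b. *)
Definition pair_high a b k : K :=
  (-1) ^+ (k - a) * ((k - a).-1`!%:R * (b - k)`!%:R * pair_const a b).

(** The second formula is a logarithmic derivative: each factor m - X contributes -1/(m - k). *)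
Lemma linear_prod_low a b k : (k <= a)%N -> (a <= b)%N ->
  let Q : {poly K} := \prod_(a.+1 <= m < b.+1) (m%:R%:P - 'X) in
  Q.[k%:R] = (b - k)`!%:R / (a - k)`!%:R /\
  (Q^`()).[k%:R] = - ((b - k)`!%:R / (a - k)`!%:R * (harm (b - k) - harm (a - k))).
Proof.
move=> ka; elim: b => [|b IH].
  rewrite leqn0 => /eqP a0; subst a; move: ka; rewrite leqn0 => /eqP ->.
  rewrite big_geq //= derivC !hornerC subrr mulr0 oppr0 divff //.
  exact: (factK_neq0 p_pr).
rewrite leq_eqVlt => /orP[/eqP ->|].
  rewrite big_geq //= derivC !hornerC subrr mulr0 oppr0 divff //.
  exact: (factK_neq0 p_pr).
rewrite ltnS => ab; have [h1 h2] := IH ab.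
rewrite big_nat_recr ?ltnS //= derivM derivB derivC derivX sub0r.
rewrite !(hornerM, hornerD, hornerN, hornerX, hornerC) h1 h2.
have -> : (b.+1 - k = (b - k).+1)%N by lia.
have -> : b.+1%:R - k%:R = (b - k).+1%:R :> K by rewrite -natrB ?subSn //; lia.
rewrite factS natrM harmS.
have n1 := natK_neq0 (K := K) p_pr (ltn0Sn (b - k)).
have n2 := factK_neq0 (K := K) p_pr (a - k).
move: ((b - k).+1%:R) ((b-k)`!%:R) ((a-k)`!%:R) n1 n2 => A B C n1 n2.
by split; field; rewrite ?n1 ?n2.
Qed.

Lemma linear_prod_high a c :
  (\prod_(a.+1 <= m < (a + c).+1) (m%:R%:P - 'X : {poly K})).[(a + c).+1%:R] =
  (-1) ^+ c * c`!%:R.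
Proof.
rewrite -addSn -{1}[a.+1]add0n big_addn addnC addnK big_mkord horner_prod.
under eq_bigr => i _.
  rewrite hornerD hornerN hornerX hornerC !natrD opprD addrACA subrr addr0.
  over.
elim: c => [|c IH]; first by rewrite big_ord0 expr0 mul1r.
rewrite big_ord_recl /= sub0r factS natrM exprS.
under eq_bigr => i _.
  rewrite /bump /= add1n -!natr1 opprD addrACA subrr addr0.
  over.
by rewrite IH; ring.
Qed.

Lemma pair_poly_low a b k : (k <= a)%N -> (a <= b)%N ->
  (pair_poly a b).[k%:R] = pair_low a b k /\
  ((pair_poly a b)^`()).[k%:R] = - (pair_low a b k * (harm (b - k) - harm (a - k))).
Proof.
move=> ka ab; have [h1 h2] := linear_prod_low ka ab.
rewrite /pair_poly derivZ !hornerZ h1 h2 /pair_const /pair_low.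
by split; ring.
Qed.

(** Only the factor with m = k vanishes, so the derivative is -1 times the product of the others,
    split into m < k and m > k. *)
Lemma pair_poly_high a b k : (a < k)%N -> (k <= b)%N ->
  (pair_poly a b).[k%:R] = 0 /\ ((pair_poly a b)^`()).[k%:R] = pair_high a b k.
Proof.
move=> ak kb; case: k ak kb => // k; rewrite ltnS => ak kb.
have e : k = (a + (k - a))%N by rewrite subnKC.
rewrite /pair_poly derivZ !hornerZ.
rewrite (@big_cat_nat _ _ _ k.+1) /= ?ltnS // ?(ltnW kb) //.
rewrite (@big_ltn _ _ _ k.+1) // !derivM derivB derivC derivX sub0r.
rewrite !(hornerM, hornerD, hornerN, hornerX, hornerC) subrr.
have [-> _] := linear_prod_low (leqnn k.+1) kb.
rewrite subnn fact0 {1 3}e.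
have -> : k.+1 = (a + (k - a)).+1 by rewrite -e.
rewrite linear_prod_high /pair_high /pair_const -e subSn //= exprS !divr1.
by split; ring.
Qed.

Lemma pint_pair_const a b : (b < p)%N -> pair_const a b \in pint.
Proof. by move=> bp; have h := @pint_factV _ _ K p_pr b bp; rewrite /pair_const; inpint. Qed.

Lemma pint_pair_low a b k : (a <= b)%N -> (b < p)%N -> pair_low a b k \in pint.
Proof.
move=> ab bp; have h := @pint_factV _ _ K p_pr b bp.
have h2 : ((a - k)`!%:R : K)^-1 \in pint by apply: pint_factV => //; lia.
by rewrite /pair_low; inpint.
Qed.

Lemma pabs_pair_low a b k : (a <= b)%N -> (b < p)%N -> pabs (pair_low a b k) = 1.
Proof.
move=> ab bp; rewrite /pair_low !pabsM !pabsV !(pabs_fact p_pr) ?invr1 ?mulr1 //; lia.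
Qed.

Lemma pint_pair_high a b k : (b < p)%N -> pair_high a b k \in pint.
Proof. by move=> bp; have h := pint_pair_const a bp; rewrite /pair_high; inpint. Qed.

Lemma pair_poly_over a b : (b < p)%N -> pair_poly a b \is a polyOver pint.
Proof.
move=> bp; apply: polyOverZ; first exact: pint_pair_const.
by apply: rpred_prod => i _; rewrite rpredB ?polyOverX ?polyOverC ?rpred_nat.
Qed.

Lemma spoch_ratio_low a b k y z : (k <= a)%N -> (a <= b)%N -> (b < p)%N ->
  y \in pint -> z \in pint ->
  cong 2 (spoch a k y / spoch b k z)
    (pair_low a b k * (1 - pK * (y * (harm a - harm (a - k)))
                         + pK * (z * (harm b - harm (b - k))))).
Proof.
move=> ka ab bp hy hz; have ap := leq_ltn_trans ab bp; have kb := leq_trans ka ab.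
have h1 := spoch_low p_pr ka ap hy; have h2 := spoch_low p_pr kb bp hz.
have hl := pint_pair_low k ab bp.
have ia := pint_harm (K := K) p_pr ap; have ib := pint_harm (K := K) p_pr bp.
have iak : harm (a - k) \in pint by apply: pint_harm => //; lia.
have ibk : harm (b - k) \in pint by apply: pint_harm => //; lia.
have fa : ((a - k)`!%:R : K)^-1 \in pint by apply: pint_factV => //; lia.
have n1 := factK_neq0 (K := K) p_pr b; have n2 := factK_neq0 (K := K) p_pr (b - k).
have n3 := factK_neq0 (K := K) p_pr (a - k).
move: h1 h2; set u := y * _; set v := z * _ => h1 h2.
have hu : u \in pint by rewrite /u; inpint.
have hv : v \in pint by rewrite /v; inpint.
have ub : pabs (1 - pK * v) = 1.
  apply: (cong_abs_unit p_pr (y := 1)); rewrite ?pabs1 // -mulrN.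
  by apply: cong_p; inpint.
apply: cong_trans (congMl hl (cong_one_ratio hu hv)).
have -> : pair_low a b k * ((1 - pK * u) / (1 - pK * v)) =
  ((-1) ^+ k * (a`!%:R / (a - k)`!%:R) * (1 - pK * u)) /
  ((-1) ^+ k * (b`!%:R / (b - k)`!%:R) * (1 - pK * v)).
  rewrite /pair_low; field.
  by rewrite n1 n2 n3 pabs_unit_neq0 // expf_neq0 // oppr_eq0 oner_eq0.
apply: cong_div => //; first by inpint.
rewrite !pabsM pabsV pabs_sign !(pabs_fact p_pr) ?ub ?invr1 ?mulr1 //; lia.
Qed.

Lemma spoch_ratio_high a b k y z : (a < k)%N -> (k <= b)%N -> (b < p)%N ->
  y \in pint -> z \in pint ->
  cong 2 (spoch a k y / spoch b k z) (pK * (y * pair_high a b k)).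
Proof.
move=> ak kb bp hy hz.
have ea : k = (a + (k - a).-1.+1)%N by lia.
have hh := pint_pair_high a k bp.
apply: cong_divl => //; first exact: pabs_spoch_low.
  by inpint.
rewrite {1}ea; apply: cong_trans (spoch_high p_pr _ hy) _; first by lia.
rewrite [X in cong _ _ X]mulrCA; apply: cong1_pM.
rewrite [X in cong _ _ X]mulrCA; apply: congMl => //.
apply: cong_sym; apply: cong_trans (congMr _ (spoch_low1 p_pr kb bp hz)) _; first by inpint.
have n1 := factK_neq0 (K := K) p_pr b; have n2 := factK_neq0 (K := K) p_pr (b - k).
apply: cong_eq; rewrite /pair_high /pair_const.
have -> : (-1) ^+ k = (-1) ^+ a * (-1) ^+ (k - a) :> K by rewrite -exprD subnKC // ltnW.
have := sqrr_sign K (k - a); move: ((-1) ^+ (k - a)) => s hs.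
have -> : (-1) ^+ a * s * (b`!%:R / (b - k)`!%:R) *
   (s * ((k - a).-1`!%:R * (b - k)`!%:R * (a`!%:R / b`!%:R))) =
  s ^+ 2 * ((-1) ^+ a * (b`!%:R / (b - k)`!%:R) *
   (((k - a).-1`!%:R * (b - k)`!%:R * (a`!%:R / b`!%:R)))) :> K by ring.
by rewrite hs; field; rewrite n1 n2.
Qed.

End PairPolynomials.

(** * Coefficients of one pair and their shifts by multiples of p *)

Section PairCoefficients.
Context {R : realType} {p : nat} {K : padicComplexType R p}.
Hypothesis p_pr : prime p.
Variables (a b : nat).
Hypothesis (a_gt0 : (0 < a)%N) (ab : (a < b)%N) (bp : (b < p)%N).
Implicit Types (x y z : K) (k : nat).

Local Notation pK := (p%:R : K).
Local Notation harm := (@harm R p K).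
Local Notation rho := (@rho R p K).
Local Notation pair_low := (@pair_low R p K).
Local Notation pair_high := (@pair_high R p K).
Local Notation pair_poly := (@pair_poly R p K).
Local Notation wpoch := (@wpoch R p K).
Local Notation spoch := (@spoch R p K).
Let ap : (a < p)%N := ltn_trans ab bp.
Let ia : rho a \in pint := pint_rho p_pr a.
Let ib : rho b \in pint := pint_rho p_pr b.

Definition pair_coef k : K := spoch a k (rho a) / spoch b k (rho b).

(** Behind the factor p, [rho a] may be replaced by -a, to which it is congruent modulo p. *)
Lemma pair_coef_low k : (k <= a)%N ->
  cong 2 (pair_coef k) (pair_low a b k *
    (1 + pK * (a%:R * (harm a - harm (a - k)) - b%:R * (harm b - harm (b - k))))).
Proof.
move=> ka; apply: cong_trans (spoch_ratio_low p_pr ka (ltnW ab) bp ia ib) _.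
have hl : pair_low a b k \in pint := pint_pair_low p_pr k (ltnW ab) bp.
have ha := pint_harm (K := K) p_pr ap; have hb := pint_harm (K := K) p_pr bp.
have hak : harm (a - k) \in pint by apply: pint_harm => //; lia.
have hbk : harm (b - k) \in pint by apply: pint_harm => //; lia.
exists (pair_low a b k * (rho b * (harm b - harm (b - k)) - rho a * (harm a - harm (a - k)))).
  by inpint.
rewrite {1}[rho a](rhoE p_pr a) {1}[rho b](rhoE p_pr b); ring.
Qed.

Lemma pair_coef_high k : (a < k)%N -> (k <= b)%N ->
  cong 2 (pair_coef k) (pK * (- a%:R * pair_high a b k)).
Proof.
move=> ak kb; apply: cong_trans (spoch_ratio_high p_pr ak kb bp ia ib) _.
have hh := pint_pair_high (K := K) p_pr a k bp.
apply: cong1_pM; apply: congMr => //.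
by rewrite (rhoE p_pr a) addrC; apply: cong_p.
Qed.

Lemma pair_coef_poly k : (k <= b)%N -> cong 1 (pair_coef k) (pair_poly a b).[k%:R].
Proof.
move=> kb; case: (leqP k a) => ka.
  rewrite (pair_poly_low p_pr ka (ltnW ab)).1.
  apply: cong_trans (cong_le (m := 1) _ (pair_coef_low ka)) _ => //.
  have hl : pair_low a b k \in pint := pint_pair_low p_pr k (ltnW ab) bp.
  have ha := pint_harm (K := K) p_pr ap; have hb := pint_harm (K := K) p_pr bp.
  have hak : harm (a - k) \in pint by apply: pint_harm => //; lia.
  have hbk : harm (b - k) \in pint by apply: pint_harm => //; lia.
  by rewrite mulrDr mulr1 mulrCA; apply: cong_p; inpint.
rewrite (pair_poly_high p_pr ka kb).1.
apply: cong_trans (cong_le (m := 1) _ (pair_coef_high ka kb)) _ => //.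
have hh := pint_pair_high (K := K) p_pr a k bp.
by apply: cong0_pM; inpint.
Qed.

Definition wpoch_ratio k : K :=
  \prod_(m < k) (wpoch a (rho a + m%:R) / wpoch b (rho b + m%:R)).

(** An exact form of Dwork's relation. The powers p^k above and below cancel; there remain the
    coefficient at k, the unit parts of the k complete blocks, and a partial block of length c. *)
Lemma pair_coefD k c : pair_coef (p * k + c) =
  pair_coef k * wpoch_ratio k *
  (spoch a c (rho a + k%:R) / spoch b c (rho b + k%:R)).
Proof.
rewrite /pair_coef !spochD !spoch_rho_dwork // /wpoch_ratio.
rewrite [in RHS]big_split /= prodfV !invfM.
have n1 : pK ^+ k / pK ^+ k = 1 by rewrite divff // expf_neq0 ?pK_neq0.
set A := pK ^+ k in n1 *; set A' := A^-1 in n1 *.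
move: (spoch a k _) (spoch b k _)^-1 (spoch a c _) (spoch b c _)^-1 => B C D E.
move: (\prod_(m < k) wpoch a _) (\prod_(m < k) wpoch b _)^-1 => F G.
transitivity ((A * A') * (B * F * D * (C * G * E))); first by ring.
by rewrite n1; ring.
Qed.

Lemma pint_shift c k : rho c + k%:R \in pint.
Proof. by rewrite rpredD ?rpred_nat ?pint_rho. Qed.

Lemma pint_wpoch_ratio k : wpoch_ratio k \in pint.
Proof.
apply: rpred_prod => m _; apply: pabs_unit_pint.
by rewrite pabsM pabsV !pabs_wpoch ?pint_shift // divr1.
Qed.

Lemma wpoch_ratio_cong k : (2 < p)%N ->
  cong 2 (wpoch_ratio k) (1 + pK * (k%:R * (harm a - harm b))).
Proof.
move=> p_odd.
have ha := pint_harm (K := K) p_pr ap; have hb := pint_harm (K := K) p_pr bp.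
elim: k => [|k IH]; first by rewrite /wpoch_ratio big_ord0 mul0r mulr0 addr0; apply: cong_refl.
rewrite /wpoch_ratio big_ord_recr /= -/(wpoch_ratio k).
set u := wpoch a _; set v := wpoch b _.
have h : cong 2 (u / v) (1 + pK * (harm a - harm b)).
  apply: cong_divl => //; [by rewrite pabs_wpoch ?pint_shift|by inpint|].
  apply: cong_trans (wpoch_cong p_pr p_odd ap (pint_shift a k)) _.
  apply: cong_sym; apply: cong_trans (congMr _ (wpoch_cong p_pr p_odd bp (pint_shift b k))) _.
    by inpint.
  exists (p.-1`!%:R * harm b * (harm a - harm b)); first by inpint.
  ring.
apply: cong_trans (congM _ _ IH h) _; try by inpint.
exists (k%:R * (harm a - harm b) ^+ 2); first by inpint.
by rewrite -natr1; ring.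
Qed.

(** Beyond b, numerator and denominator contain the factors p [rho a] and p [rho b]; the p cancels
    and [rho b] is a unit. *)
Lemma pint_pair_coef k : (k <= p)%N -> pair_coef k \in pint.
Proof.
move=> kp; case: (leqP k b) => kb.
  apply: rpredM; first by apply: pint_spoch.
  by apply: pint_unitV; apply: pabs_spoch_low.
have ea : k = (a + (k - a).-1.+1)%N by lia.
have eb : k = (b + (k - b).-1.+1)%N by lia.
rewrite /pair_coef [X in spoch a X _]ea [X in spoch b X _]eb !spoch_above.
have n1 : rho b != 0 by apply: pabs_unit_neq0; apply: pabs_rho => //; lia.
have n2 : pabs (spoch b b (rho b)) = 1 by apply: pabs_spoch_low.
have n3 : pabs (upoch (k - b).-1.+1 (rho b)) = 1 by apply: pabs_upoch => //; lia.
have -> : pK * rho a * spoch a a (rho a) * upoch (k - a).-1.+1 (rho a) /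
  (pK * rho b * spoch b b (rho b) * upoch (k - b).-1.+1 (rho b)) =
  rho a * (rho b)^-1 * (spoch b b (rho b))^-1 * (upoch (k - b).-1.+1 (rho b))^-1 *
   (spoch a a (rho a) * upoch (k - a).-1.+1 (rho a)).
  field; rewrite n1 (pabs_unit_neq0 n2) (pabs_unit_neq0 n3) ?(pK_neq0 p_pr) //.
have h1 : (rho b)^-1 \in pint.
  by apply: pint_unitV; apply: pabs_rho => //; lia.
have h2 := pint_unitV n2; have h3 := pint_unitV n3.
have h4 : spoch a a (rho a) \in pint by apply: pint_spoch.
have h5 := pint_upoch (K := K) (k - a).-1.+1 ia.
by inpint.
Qed.

Lemma pint_pair_coefD k c : (k < p)%N -> (c < p)%N -> pair_coef (p * k + c) \in pint.
Proof.
move=> kp cp; rewrite pair_coefD; have hw := pint_wpoch_ratio k.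
have hk := pint_pair_coef (ltnW kp); have ya := pint_shift a k; have yb := pint_shift b k.
case: (leqP c b) => cb.
  have h1 : (spoch b c (rho b + k%:R))^-1 \in pint.
    by apply: pint_unitV; apply: pabs_spoch_low.
  have h2 := pint_spoch (K := K) a c ya.
  by inpint.
have ea : c = (a + (c - a).-1.+1)%N by lia.
have eb : c = (b + (c - b).-1.+1)%N by lia.
have n2 : pabs (spoch b b (rho b + k%:R)) = 1 by apply: pabs_spoch_low.
have n3 : pabs (upoch (c - b).-1.+1 (rho b + k%:R)) = 1 by apply: pabs_upoch => //; lia.
rewrite [X in spoch a X _]ea [X in spoch b X _]eb !spoch_above.
(* The quotient (rho a + k)/(rho b + k) alone need not be integral: its denominator is k - b modulo
   p, which vanishes at k = b. Multiplied by the coefficient at k it becomes the coefficient at k +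
   1, which is integral. *)
have e : pair_coef k * ((rho a + k%:R) / (rho b + k%:R)) = pair_coef k.+1.
  rewrite /pair_coef !spochS invfM.
  have -> : k%:R - a%:R + pK * rho a = rho a + k%:R by rewrite {2}(rhoE p_pr a); ring.
  have -> : k%:R - b%:R + pK * rho b = rho b + k%:R by rewrite {2}(rhoE p_pr b); ring.
  ring.
have n0 : pK / pK = 1 by rewrite divff ?pK_neq0.
rewrite !invfM.
have -> : pair_coef k * wpoch_ratio k *
 (pK * (rho a + k%:R) * spoch a a (rho a + k%:R) * upoch (c - a).-1.+1 (rho a + k%:R) *
  (pK^-1 * (rho b + k%:R)^-1 * (spoch b b (rho b + k%:R))^-1 * (upoch (c - b).-1.+1 (rho b + k%:R))^-1)) =
  (pK / pK) * (pair_coef k * ((rho a + k%:R) / (rho b + k%:R))) *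
  (wpoch_ratio k * (spoch a a (rho a + k%:R) * upoch (c - a).-1.+1 (rho a + k%:R) *
    (spoch b b (rho b + k%:R))^-1 * (upoch (c - b).-1.+1 (rho b + k%:R))^-1)) by ring.
rewrite n0 e mul1r.
have h1 := pint_pair_coef kp; have h2 := pint_unitV n2; have h3 := pint_unitV n3.
have h4 := pint_spoch (K := K) a a ya.
have h5 := pint_upoch (K := K) (c - a).-1.+1 ya.
by inpint.
Qed.

(** For c <= a, moving y by k changes the partial block by p k times -(H_a - H_{a-c}) + (H_b -
    H_{b-c}), and the complete blocks add p k (H_a - H_b). The total H_{a-c} - H_{b-c} is the
    logarithmic derivative of the polynomial at c. For c > a the factor p y itself moves by p k. *)
Lemma pair_coefD_cong k c : (2 < p)%N -> (k <= p)%N -> (c <= b)%N ->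
  cong 2 (pair_coef (p * k + c))
    (pair_coef k * (pair_coef c + pK * (k%:R * ((pair_poly a b)^`()).[c%:R]))).
Proof.
move=> p_odd kp cb; rewrite pair_coefD -mulrA; apply: congMl; first exact: pint_pair_coef.
have hw := wpoch_ratio_cong k p_odd.
have ya := pint_shift a k; have yb := pint_shift b k.
have ha := pint_harm (K := K) p_pr ap; have hb := pint_harm (K := K) p_pr bp.
case: (leqP c a) => ca.
  rewrite (pair_poly_low p_pr ca (ltnW ab)).2.
  have hl : pair_low a b c \in pint := pint_pair_low p_pr c (ltnW ab) bp.
  have hac : harm (a - c) \in pint by apply: pint_harm => //; lia.
  have hbc : harm (b - c) \in pint by apply: pint_harm => //; lia.
  have h := spoch_ratio_low p_pr ca (ltnW ab) bp ya yb.
  apply: cong_trans (congM _ _ hw h) _; try by inpint.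
  apply: cong_sym.
  apply: cong_trans (congD (spoch_ratio_low p_pr ca (ltnW ab) bp ia ib) (cong_refl 2 _)) _.
  exists (- (k%:R * (harm a - harm b) *
    (pair_low a b c * ((rho b + k%:R) * (harm b - harm (b - c)) -
      (rho a + k%:R) * (harm a - harm (a - c)))))); first by inpint.
  ring.
rewrite (pair_poly_high p_pr ca cb).2.
have hh := pint_pair_high (K := K) p_pr a c bp.
have h := spoch_ratio_high p_pr ca cb bp ya yb.
apply: cong_trans (congM _ _ hw h) _; try by inpint.
apply: cong_sym.
apply: cong_trans (congD (spoch_ratio_high p_pr ca cb bp ia ib) (cong_refl 2 _)) _.
exists (- (k%:R * (harm a - harm b) * ((rho a + k%:R) * pair_high a b c))); first by inpint.
ring.
Qed.

Lemma pair_coefD_cong0 k c : (k <= p)%N -> (a < c)%N -> (c <= b)%N ->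
  cong 1 (pair_coef (p * k + c)) 0.
Proof.
move=> kp ac cb; rewrite pair_coefD.
have ya := pint_shift a k; have yb := pint_shift b k.
have h1 := pint_pair_coef kp; have h2 := pint_wpoch_ratio k.
have hh := pint_pair_high (K := K) p_pr a c bp.
apply: cong_trans (congMl _ (cong_le (m := 1) _ (spoch_ratio_high p_pr ac cb bp ya yb))) _ => //.
  by inpint.
by rewrite mulrCA; apply: cong0_pM; inpint.
Qed.

(** The added term collects the harmonic numbers into the form m H_m, the one in which
    [jac_pair_low] produces them. *)
Lemma pair_coef_deriv_low k : (k <= a)%N ->
  cong 2 (pair_coef k + pK * (k%:R * ((pair_poly a b)^`()).[k%:R]))
    (pair_low a b k * (1 + pK * (a%:R * harm a - b%:R * harm b
       + (b - k)%:R * harm (b - k) - (a - k)%:R * harm (a - k)))).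
Proof.
move=> ka; rewrite (pair_poly_low p_pr ka (ltnW ab)).2.
apply: cong_trans (congD (pair_coef_low ka) (cong_refl 2 _)) _.
apply: cong_eq; rewrite !natrB ?(leq_trans ka (ltnW ab)) //; ring.
Qed.

Lemma pair_coef_deriv_high k : (a < k)%N -> (k <= b)%N ->
  cong 2 (pair_coef k + pK * (k%:R * ((pair_poly a b)^`()).[k%:R]))
    (pK * ((k - a)%:R * pair_high a b k)).
Proof.
move=> ak kb; rewrite (pair_poly_high p_pr ak kb).2.
apply: cong_trans (congD (pair_coef_high ak kb) (cong_refl 2 _)) _.
apply: cong_eq; rewrite natrB ?(ltnW ak) //; ring.
Qed.

End PairCoefficients.

(** * Rational numbers and their closure Q_p inside K *)

Section PadicRationals.
Context {R : realType} {p : nat} {K : padicComplexType R p}.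
Hypothesis p_pr : prime p.
Implicit Types (x y z : K).

Local Notation pK := (p%:R : K).

Lemma intK_neq0 (m : int) : m != 0 -> (m%:~R : K) != 0.
Proof.
case: m => n m0; last by rewrite NegzE mulrNz oppr_eq0 -pmulrn (natK_neq0 p_pr).
by rewrite -pmulrn (natK_neq0 p_pr) // lt0n.
Qed.

(** [ratr] is defined by the reduced fraction. Nonzero integers stay nonzero in K, so any fraction
    gives the same value, and compatibility with the field operations follows. *)
Lemma ratr_frac (m d : int) : d != 0 -> ratr (m%:~R / d%:~R) = m%:~R / d%:~R :> K.
Proof.
move=> d0; set x : rat := _ / _; rewrite /ratr.
have e : numq x * d = m * denq x.
  have dq : (denq x)%:~R != 0 :> rat by rewrite intr_eq0 denq_eq0.
  have dd : d%:~R != 0 :> rat by rewrite intr_eq0.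
  have h1 : x * (denq x)%:~R = (numq x)%:~R by rewrite -{1}(divq_num_den x) divfK.
  have h2 : x * d%:~R = m%:~R by rewrite /x divfK.
  by apply/eqP; rewrite -(eqr_int rat) !intrM -h1 -h2 mulrAC.
have n1 := intK_neq0 (denq_neq0 x); have n2 := intK_neq0 d0.
apply: (mulIf n1); rewrite divfK //; apply: (mulIf n2).
by rewrite -mulrA [X in _ = _ * X]mulrC mulrA divfK // -!intrM e.
Qed.

Lemma rat_fracE (x : rat) : x = (numq x)%:~R / (denq x)%:~R.
Proof. by rewrite divq_num_den. Qed.

Lemma ratrD (x y : rat) : ratr (x + y) = ratr x + ratr y :> K.
Proof.
have dx := intK_neq0 (denq_neq0 x); have dy := intK_neq0 (denq_neq0 y).
have dx' : (denq x)%:~R != 0 :> rat by rewrite intr_eq0 denq_eq0.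
have dy' : (denq y)%:~R != 0 :> rat by rewrite intr_eq0 denq_eq0.
have -> : x + y = (numq x * denq y + numq y * denq x)%:~R / (denq x * denq y)%:~R.
  rewrite {1}[x]rat_fracE {1}[y]rat_fracE intrD !intrM; field.
  by rewrite dx' dy'.
rewrite ratr_frac ?mulf_neq0 ?denq_neq0 // /ratr intrD !intrM; field.
by rewrite dx dy.
Qed.

Lemma ratrM (x y : rat) : ratr (x * y) = ratr x * ratr y :> K.
Proof.
have dx := intK_neq0 (denq_neq0 x); have dy := intK_neq0 (denq_neq0 y).
have dx' : (denq x)%:~R != 0 :> rat by rewrite intr_eq0 denq_eq0.
have dy' : (denq y)%:~R != 0 :> rat by rewrite intr_eq0 denq_eq0.
have -> : x * y = (numq x * numq y)%:~R / (denq x * denq y)%:~R.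
  rewrite {1}[x]rat_fracE {1}[y]rat_fracE !intrM; field.
  by rewrite dx' dy'.
rewrite ratr_frac ?mulf_neq0 ?denq_neq0 // /ratr !intrM; field.
by rewrite dx dy.
Qed.

Lemma ratr1 : ratr 1 = 1 :> K.
Proof. by rewrite (ratr_nat K 1). Qed.

Lemma ratr0 : ratr 0 = 0 :> K.
Proof. by rewrite (ratr_nat K 0). Qed.

Lemma ratrV (x : rat) : ratr x^-1 = (ratr x)^-1 :> K.
Proof.
have [->|x0] := eqVneq x 0; first by rewrite invr0 ratr0 invr0.
have e : ratr x * ratr x^-1 = 1 :> K by rewrite -ratrM mulfV // ratr1.
have n0 : ratr x != 0 :> K.
  by apply/eqP => h; move/eqP: e; rewrite h mul0r eq_sym oner_eq0.
by apply: (mulfI n0); rewrite e mulfV.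
Qed.

Lemma ratrN (x : rat) : ratr (- x) = - ratr x :> K.
Proof. by apply/eqP; rewrite -addr_eq0 -ratrD addNr ratr0. Qed.

Lemma ratr_sum (I : Type) (r : seq I) (P : pred I) (F : I -> rat) :
  ratr (\sum_(i <- r | P i) F i) = \sum_(i <- r | P i) ratr (F i) :> K.
Proof. exact: (big_morph _ ratrD ratr0). Qed.

Lemma ratr_prod (I : Type) (r : seq I) (P : pred I) (F : I -> rat) :
  ratr (\prod_(i <- r | P i) F i) = \prod_(i <- r | P i) ratr (F i) :> K.
Proof. exact: (big_morph _ ratrM ratr1). Qed.

Lemma Qp_ratr (x : rat) : Qp (ratr x : K).
Proof. by move=> e e0; exists (ratr x); [exists x|rewrite subrr pabs0]. Qed.

Lemma Qp_nat (m : nat) : Qp (m%:R : K).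
Proof. by rewrite -(ratr_nat K); exact: Qp_ratr. Qed.

Lemma QpD x y : Qp x -> Qp y -> Qp (x + y).
Proof.
move=> hx hy e e0; have [_ [u _ <-] hu] := hx _ e0; have [_ [v _ <-] hv] := hy _ e0.
exists (ratr (u + v)); first by exists (u + v).
by rewrite ratrD opprD addrACA; apply: pabs_ltr_add.
Qed.

Lemma QpN x : Qp x -> Qp (- x).
Proof.
move=> hx e e0; have [_ [u _ <-] hu] := hx _ e0.
by exists (ratr (- u)); [exists (- u)|rewrite ratrN -opprD pabsN].
Qed.

Lemma QpB x y : Qp x -> Qp y -> Qp (x - y).
Proof. by move=> hx hy; apply: QpD => //; apply: QpN. Qed.

Lemma pabs_approx x y : pabs (x - y) < pabs x -> pabs y = pabs x.
Proof.
move=> h; apply/eqP; rewrite eq_le; apply/andP; split.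
  rewrite -[y](subKr x) pabs_ler_add // pabsN; exact: ltW.
rewrite leNgt; apply/negP => h2; suff : pabs x < pabs x by rewrite ltxx.
by rewrite -{1}(subrK y x); apply: pabs_ltr_add.
Qed.

Lemma QpM x y : Qp x -> Qp y -> Qp (x * y).
Proof.
move=> hx hy e e0.
have [->|x0] := eqVneq x 0.
  by exists (ratr 0); [exists 0|rewrite mul0r ratr0 subrr pabs0].
have [->|y0] := eqVneq y 0.
  by exists (ratr 0); [exists 0|rewrite mulr0 ratr0 subrr pabs0].
have px : 0 < pabs x by rewrite lt_def pabs_ge0 pabs_eq0 x0.
have py : 0 < pabs y by rewrite lt_def pabs_ge0 pabs_eq0 y0.
have ex : 0 < e / pabs x by rewrite divr_gt0.
have [_ [v _ <-] hv] := hy _ (ex : 0 < e / pabs x).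
(* The tolerance for u depends on v, so v is fixed first; the [+ 1] keeps it positive even for v =
   0. *)
have ev : 0 < Num.min (pabs x) (e / (pabs (ratr v : K) + 1)).
  by rewrite lt_min px divr_gt0 // ltr_wpDl ?pabs_ge0.
have [_ [u _ <-] hu] := hx _ ev.
move: hu; rewrite lt_min => /andP[hu1 hu2].
exists (ratr (u * v)); first by exists (u * v).
have -> : x * y - ratr (u * v) = x * (y - ratr v) + (x - ratr u) * ratr v.
  by rewrite ratrM; ring.
apply: pabs_ltr_add; rewrite pabsM; first by rewrite mulrC -ltr_pdivlMr.
have pv : 0 < pabs (ratr v : K) + 1 by rewrite ltr_wpDl ?pabs_ge0.
move: hu2; rewrite ltr_pdivlMr //; apply: le_lt_trans.
by rewrite ler_wpM2l ?pabs_ge0 // lerDl.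
Qed.

Lemma QpV x : Qp x -> Qp x^-1.
Proof.
move=> hx e e0; have [->|x0] := eqVneq x 0.
  by exists (ratr 0); [exists 0|rewrite invr0 ratr0 subrr pabs0].
have px : 0 < pabs x by rewrite lt_def pabs_ge0 pabs_eq0 x0.
have ev : 0 < Num.min (pabs x) (e * pabs x ^+ 2) by rewrite lt_min px mulr_gt0 ?exprn_gt0.
have [_ [u _ <-] ] := hx _ ev; rewrite lt_min => /andP[hu1 hu2].
exists (ratr u^-1); first by exists u^-1.
have eu := pabs_approx hu1.
have u0 : ratr u != 0 :> K by rewrite -pabs_eq0 eu pabs_eq0.
have -> : x^-1 - ratr u^-1 = (ratr u - x) / (x * ratr u).
  by rewrite ratrV; field; rewrite x0 u0.
by rewrite pabsM pabsV pabsM eu -expr2 pabs_distC ltr_pdivrMr ?exprn_gt0.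
Qed.

Lemma QpX x m : Qp x -> Qp (x ^+ m).
Proof. by move=> hx; elim: m => [|m IH]; rewrite ?expr0 ?exprS; [exact: (Qp_nat 1)|exact: QpM]. Qed.

Lemma Qp_sum (I : Type) (r : seq I) (P : pred I) (F : I -> K) :
  (forall i, P i -> Qp (F i)) -> Qp (\sum_(i <- r | P i) F i).
Proof. by move=> h; apply: big_ind => //; [exact: (Qp_nat 0)|exact: QpD]. Qed.

Lemma Qp_prod (I : Type) (r : seq I) (P : pred I) (F : I -> K) :
  (forall i, P i -> Qp (F i)) -> Qp (\prod_(i <- r | P i) F i).
Proof. by move=> h; apply: big_ind => //; [exact: (Qp_nat 1)|exact: QpM]. Qed.

Lemma padic_eqmodE k x y : padic_eqmod k x y <-> Qp (x - y) /\ cong k x y.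
Proof.
split=> [[z [hz iz] e]|[hQ [z iz e] ]].
  split; last by exists z => //; rewrite -e subrKC.
  by rewrite e; apply: QpM => //; apply: QpX; apply: Qp_nat.
exists z; last by rewrite e addrC addKr.
split=> //; have -> : z = (x - y) / p%:R ^+ k.
  by rewrite e addrC addKr mulrC mulKf // expf_neq0 ?pK_neq0.
by apply: QpM => //; apply: QpV; apply: QpX; apply: Qp_nat.
Qed.

Lemma cong_eq_all x y : (forall k, cong k.+1 x y) -> x = y.
Proof.
move=> h; apply/eqP; rewrite -subr_eq0 -pabs_eq0; apply/negPn/negP => n0.
have e0 : 0 < pabs (x - y) by rewrite lt_def pabs_ge0 n0.
have [N hN] := ltR_expn p_pr e0.
have := (cong_pabs p_pr _ _ _).1 (cong_le (leqnSn N) (h N)).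
by rewrite leNgt hN.
Qed.

Lemma cong_lt (e : R) : 0 < e -> exists N, forall x y, cong N x y -> pabs (x - y) < e.
Proof.
move=> e0; have [N hN] := ltR_expn p_pr e0; exists N => x y h.
exact: le_lt_trans ((cong_pabs p_pr _ _ _).1 h) hN.
Qed.

(** By the ultrametric inequality, congruences between consecutive terms make the sequence Cauchy,
    and the limit inherits them. *)
Lemma cong_limit (u : nat -> K) : (forall m, cong m (u m.+1) (u m)) ->
  exists l, forall m, cong m l (u m).
Proof.
move=> h.
have h2 m d : cong m (u (m + d)%N) (u m).
  elim: d => [|d IH]; first by rewrite addn0; apply: cong_refl.
  rewrite addnS; apply: cong_trans IH.
  by apply: cong_le (h _); rewrite leq_addr.
have [|l hl] := pabs_complete u.
  move=> e e0; have [N hN] := cong_lt e0; exists N => m n Nm Nn; apply: hN.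
  apply: (@cong_trans _ _ _ _ (u N)); last apply: cong_sym.
    by rewrite -(subnKC Nm).
  by rewrite -(subnKC Nn).
exists l => m; apply/(cong_pabs p_pr).
have e0 : 0 < p%:R ^- m :> R by rewrite invr_gt0 exprn_gt0 ?pR_gt0.
have [N hN] := hl _ e0.
rewrite -(subrKA (u (m + N)%N)) pabs_ler_add //.
  by rewrite pabs_distC ltW // hN // leq_addl.
exact/(cong_pabs p_pr).
Qed.

Lemma Qp_limit x (u : nat -> K) : (forall m, Qp (u m)) -> (forall m, cong m x (u m)) -> Qp x.
Proof.
move=> hu h e e0; have [N hN] := cong_lt e0.
have [y [v _ <-] hy] := hu N e e0.
exists (ratr v); first by exists v.
exact: pabs_ltr_dist (hN _ _ (h N)) hy.
Qed.

End PadicRationals.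

(** * The Teichmueller character and its powers *)

Section Teichmuller.
Context {R : realType} {p : nat} {K : padicComplexType R p}.
Hypothesis p_pr : prime p.
Implicit Types (x y : 'F_p) (w : K).

Local Notation pK := (p%:R : K).
Local Notation om := (teichmuller : 'F_p -> K).

Lemma Fp_ltn x : (x < p)%N.
Proof. by have := ltn_ord x; rewrite [X in (_ < X)%N -> _](Fp_cast p_pr). Qed.

Lemma Fp_gt0 x : x != 0 -> (0 < x < p)%N.
Proof. by move=> x0; rewrite Fp_ltn andbT lt0n. Qed.

(** Since w^p = w, raising a congruence to the power p keeps both sides and gains a digit; iteration
    gives equality. *)
Lemma root_unity_uniq w w' : w \in pint -> w' \in pint -> w ^+ p.-1 = 1 -> w' ^+ p.-1 = 1 ->
  cong 1 w w' -> w = w'.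
Proof.
move=> hw hw' e e' h; have ep v : v ^+ p.-1 = 1 -> v ^+ p = v :> K.
  move=> ev; transitivity (v ^+ p.-1.+1); first by rewrite prednK ?prime_gt0.
  by rewrite exprS ev mulr1.
apply: (cong_eq_all p_pr); elim=> [//|k IH].
by rewrite -(ep w) // -(ep w') //; apply: cong_expp.
Qed.

(** The lift is the limit of x^(p^m): Fermat's little theorem gives the first congruence, and p-th
    powers the following ones. *)
Lemma teichmuller_ex x : x != 0 -> exists w : K,
  [/\ Defs.Zp w, w ^+ p.-1 = 1 & padic_eqmod 1 w (x : nat)%:R].
Proof.
move=> x0; pose u m : K := (x : nat)%:R ^+ (p ^ m).
have uS m : u m.+1 = u m ^+ p by rewrite /u -exprM expnSr.
have iu m : u m \in pint by rewrite /u; inpint.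
have h m : cong m.+1 (u m.+1) (u m).
  elim: m => [|m IH]; last by rewrite !uS; apply: cong_expp => //; rewrite -uS.
  rewrite /u expn1 expn0 expr1 -natrX; apply: cong_nat.
  by rewrite expn1; apply: fermat_little.
have [m|w hw] := @cong_limit _ _ _ p_pr u; first by apply: cong_le (h m).
have hw1 m : cong m.+1 w (u m) by apply: cong_trans (hw m.+1) (h m).
have w1 : cong 1 w (x : nat)%:R by have := hw1 0%N; rewrite /u expn0 expr1.
have aw : pabs w = 1 by apply: (cong_abs_unit p_pr w1); apply: pabs_small => //; exact: Fp_gt0.
have Qw : Qp w.
  apply: (Qp_limit p_pr _ hw) => m; apply: QpX => //; exact: Qp_nat.
exists w; split.
- by split=> //; rewrite aw.
- have e : w ^+ p = w.
    apply: (cong_eq_all p_pr) => k.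
    apply: (@cong_trans _ _ _ _ (u k.+1)); last exact: cong_sym.
    by apply: (cong_le (leqnSn _)); rewrite uS; apply: cong_expp.
  apply: (mulfI (pabs_unit_neq0 aw)).
  by rewrite -exprS prednK ?prime_gt0 // e mulr1.
- by apply/(padic_eqmodE p_pr); split=> //; apply: QpB => //; apply: Qp_nat.
Qed.

Lemma om0 : om 0 = 0.
Proof. by rewrite /teichmuller eqxx. Qed.

Lemma om_spec x : x != 0 -> [/\ Defs.Zp (om x), om x ^+ p.-1 = 1 & cong 1 (om x) (x : nat)%:R].
Proof.
move=> x0; rewrite /teichmuller (negbTE x0).
case: xgetP => [w _ /= [h1 h2 /(padic_eqmodE p_pr)[_ h3] ] //|h].
by have [w hw] := teichmuller_ex x0; case: (h w).
Qed.

Lemma om_cong x : cong 1 (om x) (x : nat)%:R.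
Proof.
have [->|x0] := eqVneq x 0; first by rewrite om0; apply: cong_refl.
by have [] := om_spec x0.
Qed.

Lemma om_exp x : x != 0 -> om x ^+ p.-1 = 1.
Proof. by move=> x0; have [] := om_spec x0. Qed.

Lemma Qp_om x : Qp (om x).
Proof.
have [->|x0] := eqVneq x 0; first by rewrite om0; exact: (Qp_nat 0%N).
by have [[]] := om_spec x0.
Qed.

Lemma pabs_om x : x != 0 -> pabs (om x) = 1.
Proof.
move=> x0; apply: (cong_abs_unit p_pr (om_cong x)).
by apply: pabs_small => //; exact: Fp_gt0.
Qed.

Lemma om_neq0 x : (om x != 0) = (x != 0).
Proof.
have [->|x0] := eqVneq x 0; first by rewrite om0 eqxx.
by rewrite (pabs_unit_neq0 (pabs_om x0)).
Qed.

Lemma pint_om x : om x \in pint.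
Proof.
have [->|x0] := eqVneq x 0; first by rewrite om0 rpred0.
by rewrite (pabs_unit_pint (pabs_om x0)).
Qed.

Lemma om_uniq x w : x != 0 -> w \in pint -> w ^+ p.-1 = 1 -> cong 1 w (x : nat)%:R -> w = om x.
Proof.
move=> x0 hw ew h; apply: root_unity_uniq; rewrite ?om_exp ?pint_om //.
exact: cong_trans h (cong_sym (om_cong x)).
Qed.

Lemma Fp_natD x y : cong 1 (nat_of_ord (x + y)%R)%:R ((x : nat)%:R + (y : nat)%:R : K).
Proof.
rewrite -natrD; apply: cong_nat; rewrite expn1.
by rewrite -{1}[x]natr_Zp -{1}[y]natr_Zp -natrD val_Fp_nat // modn_mod.
Qed.

Lemma Fp_natM x y : cong 1 (nat_of_ord (x * y)%R)%:R ((x : nat)%:R * (y : nat)%:R : K).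
Proof.
rewrite -natrM; apply: cong_nat; rewrite expn1.
by rewrite -{1}[x]natr_Zp -{1}[y]natr_Zp -natrM val_Fp_nat // modn_mod.
Qed.

Lemma omM x y : om (x * y) = om x * om y.
Proof.
have [->|x0] := eqVneq x 0; first by rewrite mul0r om0 mul0r.
have [->|y0] := eqVneq y 0; first by rewrite mulr0 om0 mulr0.
apply/esym/om_uniq; rewrite ?mulf_neq0 ?exprMn ?om_exp ?mulr1 //.
  by rewrite rpredM ?pint_om.
apply: cong_trans (cong_sym (Fp_natM x y)).
by apply: congM; rewrite ?rpred_nat //; apply: om_cong.
Qed.

Lemma om1 : om 1 = 1.
Proof. by apply/esym/om_uniq; rewrite ?oner_eq0 ?expr1n ?rpred1. Qed.

Lemma omX x m : om (x ^+ m) = om x ^+ m.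
Proof. by elim: m => [|m IH]; rewrite ?expr0 ?om1 // !exprS omM IH. Qed.

Lemma om_inj : injective om.
Proof.
move=> x y e.
have [x0|x0] := eqVneq x 0.
  by move/eqP: e; rewrite x0 om0 eq_sym; apply: contraTeq; rewrite om_neq0 eq_sym.
have y0 : y != 0 by rewrite -om_neq0 -e om_neq0.
have ex : x / y != 1 -> False.
  move=> h; have : om (x / y) = 1.
    by apply: (mulIf (x := om y)); rewrite ?om_neq0 // -omM divfK // mul1r.
  move=> h1; have := om_cong (x / y - 1).
  have z0 : x / y - 1 != 0 by rewrite subr_eq0.
  move=> h2; have : cong 1 ((nat_of_ord (x / y - 1)%R)%:R : K) 0.
    have h3 : cong 1 ((nat_of_ord (x / y)%R)%:R : K) ((nat_of_ord (x / y - 1)%R)%:R + 1).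
      by have := Fp_natD (x / y - 1) 1; rewrite subrK.
    have h4 := om_cong (x / y); rewrite h1 in h4.
    have h5 := cong_trans h4 h3.
    by have := congB (cong_sym h5) (cong_refl 1 1); rewrite addrK subrr.
  move/(cong_pabs p_pr); rewrite subr0 (pabs_small p_pr) ?Fp_gt0 //.
  by rewrite expr1 leNgt invf_lt1 ?pR_gt0 ?pR_gt1.
by have [/divr1_eq//|/ex] := eqVneq (x / y) 1.
Qed.

Lemma omD x y : cong 1 (om (x + y)) (om x + om y).
Proof.
apply: cong_trans (om_cong _) _; apply: cong_trans (Fp_natD x y) _.
by apply: cong_sym; apply: congD; apply: om_cong.
Qed.

Lemma omN1 : (2 < p)%N -> om (-1) = -1.
Proof.
move=> p_odd; have h : om (-1) ^+ 2 = 1 by rewrite expr2 -omM mulrNN mulr1 om1.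
have : (om (-1) == 1) || (om (-1) == -1) by rewrite -eqf_sqr h expr1n.
case/orP => /eqP // e.
have h2 := omD 1 (-1); rewrite subrr om0 om1 e in h2.
have := (cong_pabs p_pr _ _ _).1 (cong_sym h2).
rewrite subr0 -[1 + 1]/(2%:R) (pabs_small p_pr) //.
by rewrite expr1 leNgt invf_lt1 ?pR_gt0 ?pR_gt1.
Qed.

(** The lifts are p - 1 distinct (p-1)-th roots of unity in a field, and such a set contains a
    primitive one. *)
Lemma Fp_prim_ex : exists2 g : 'F_p, g != 0 & p.-1.-primitive_root (om g).
Proof.
pose s := [seq om x | x <- enum [pred x : 'F_p | x != 0]].
have : has p.-1.-primitive_root s.
  apply: has_prim_root.
  - by have := prime_gt1 p_pr; case: (p) => [|[]].
  - apply/allP => w /mapP[x]; rewrite mem_enum inE => x0 ->.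
    by rewrite unity_rootE om_exp.
  - by rewrite map_inj_uniq ?enum_uniq //; exact: om_inj.
  - rewrite size_map -cardE.
    have := cardC1 (0 : 'F_p); rewrite card_Fp // => <-.
    by rewrite (eq_card (B := predC1 0)).
by case/hasP => w /mapP[g]; rewrite mem_enum inE => g0 -> h; exists g.
Qed.

Lemma om_sum m : \sum_(x : 'F_p | x != 0) om x ^+ m = if (p.-1 %| m)%N then p.-1%:R else 0.
Proof.
case: ifPn => [/dvdnP[d ->]|hm].
  under eq_bigr => x x0 do rewrite mulnC exprM om_exp // expr1n.
  rewrite sumr_const; congr (_ *+ _).
  by rewrite -[in RHS](card_Fp p_pr) -(cardC1 (0 : 'F_p)).
have [g g0 hg] := Fp_prim_ex.
set S := \sum_(x | _) _.
have e : om g ^+ m * S = S.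
  rewrite {2}/S (reindex_inj (mulfI g0)) /= mulr_sumr.
  apply: eq_big => [x|x x0]; first by rewrite mulf_eq0 negb_or g0.
  by rewrite omM exprMn.
apply/eqP; have : (om g ^+ m - 1) * S = 0 by rewrite mulrBl e mul1r subrr.
by move/eqP; rewrite mulf_eq0 subr_eq0 -(prim_order_dvd hg) (negbTE hm).
Qed.

(** The value at 0 is imposed because [om 0 ^+ 0] is 1, while the trivial character must vanish at
    0. *)
Definition ch (m : nat) : 'F_p -> K := fun x => if x == 0 then 0 else om x ^+ m.

Lemma chE m x : ch m x = if x == 0 then 0 else om x ^+ m.
Proof. by []. Qed.

Lemma ch_mul_character m : mul_character (ch m).
Proof.
rewrite /ch; split; first by rewrite eqxx.
  by rewrite oner_eq0 om1 expr1n.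
move=> x y; have [->|x0] := eqVneq x 0; first by rewrite mul0r eqxx mul0r.
have [->|y0] := eqVneq y 0; first by rewrite mulr0 eqxx mulr0.
by rewrite (negbTE (mulf_neq0 x0 y0)) omM exprMn.
Qed.

(** A character is determined by its value at a generator, which is a (p-1)-th root of unity and so
    a power of [om g]. *)
Lemma mul_character_ch chi : mul_character chi -> exists2 k : 'I_p.-1, True & chi = ch k.
Proof.
case=> c0 c1 cM; have [g g0 hg] := Fp_prim_ex.
have cX x m : chi (x ^+ m) = chi x ^+ m.
  by elim: m => [|m IH]; rewrite ?expr0 // !exprS cM IH.
have gp : g ^+ p.-1 = 1.
  by apply: om_inj; rewrite om1 -(om_exp g0) omX.
have [|k ek] := prim_rootP hg (x := chi g); first by rewrite -cX gp.
exists k => //; apply/funext => x; rewrite /ch; case: eqP => [->//|/eqP x0].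
have [i ei] := prim_rootP hg (om_exp x0).
have -> : x = g ^+ i.
  by apply: om_inj; rewrite ei omX.
by rewrite cX ek omX -!exprM mulnC.
Qed.

Lemma ch_inj : injective (fun k : 'I_p.-1 => ch k).
Proof.
move=> i j e; have [g g0 hg] := Fp_prim_ex.
have := congr1 (fun f => f g) e; rewrite /ch (negbTE g0) => /eqP.
by rewrite (eq_prim_root_expr hg) !modn_small // => /eqP /val_inj.
Qed.

Lemma sum_mul_character (F : ('F_p -> K) -> K) :
  \sum_(chi \in mul_character) F chi = \sum_(k < p.-1) F (ch k).
Proof.
have -> : mul_character = [set ch k | k in [set: 'I_p.-1]] :> set ('F_p -> K).
  apply/seteqP; split => chi /=.
    by case/mul_character_ch => k _ ->; exists k.
  by case=> k _ <-; apply: ch_mul_character.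
rewrite fsbig_image /=; last by move=> i j _ _; apply: ch_inj.
have -> : [set: 'I_p.-1] = [set` index_enum 'I_p.-1].
  by apply/seteqP; split => k //= _; exact: mem_index_enum.
by rewrite -fsbig_seq ?index_enum_uniq.
Qed.

End Teichmuller.

(** * Jacobi sums modulo p^2 *)

Section JacobiSums.
Context {R : realType} {p : nat} {K : padicComplexType R p}.
Hypothesis p_pr : prime p.
Implicit Types (x y : 'F_p) (i j k N : nat).

Local Notation pK := (p%:R : K).
Local Notation om := (teichmuller : 'F_p -> K).
Local Notation ch := (@ch R p K).
Local Notation harm := (@harm R p K).

Lemma factSr m : m.+1`!%:R = m.+1%:R * m`!%:R :> K.
Proof. by rewrite factS natrM. Qed.

Definition jac i j : K := \sum_(x : 'F_p) ch i x * ch j (1 - x).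

Lemma ch0 i : ch i 0 = 0.
Proof. by rewrite !chE eqxx. Qed.

Lemma chM i x y : ch i (x * y) = ch i x * ch i y.
Proof. by have [] := ch_mul_character (K := K) p_pr i. Qed.

Lemma ch1 i : ch i 1 = 1.
Proof. by have [] := ch_mul_character (K := K) p_pr i. Qed.

Lemma ch_om i x : (0 < i)%N -> ch i x = om x ^+ i.
Proof.
by rewrite !chE; case: eqP => [->|//]; rewrite om0; case: i => // i _; rewrite exprS mul0r.
Qed.

Lemma ch_neq0 i x : x != 0 -> ch i x = om x ^+ i.
Proof. by rewrite !chE => /negbTE ->. Qed.

Lemma chD i j x : ch (i + j) x = ch i x * ch j x.
Proof. by rewrite !chE; case: ifP => _; rewrite ?mul0r // exprD. Qed.

Lemma ch_period i x : ch (p.-1 + i) x = ch i x.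
Proof.
by rewrite !chE; case: eqP => // /eqP x0; rewrite exprD om_exp // mul1r.
Qed.

Lemma ch_sum i : \sum_(x : 'F_p) ch i x = if (p.-1 %| i)%N then p.-1%:R else 0.
Proof.
rewrite -(om_sum (K := K) p_pr) (bigD1 0) //= ch0 add0r.
by apply: eq_bigr => x x0; rewrite ch_neq0.
Qed.

(** * Gauss sums: product formula and nonvanishing *)

Section GaussSums.
Variable zeta : K.
Hypothesis zeta_prim : p.-primitive_root zeta.

Definition psi x : K := zeta ^+ (x : nat).

Lemma psiD x y : psi (x + y) = psi x * psi y.
Proof.
rewrite /psi -exprD -[in LHS](natr_Zp x) -[in LHS](natr_Zp y) -natrD val_Fp_nat //.
by rewrite (expr_mod _ (prim_expr_order zeta_prim)).
Qed.

Lemma psi0 : psi 0 = 1.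
Proof. by []. Qed.

Lemma psi_sum0 : \sum_(x : 'F_p) psi x = 0.
Proof.
set S := \sum_(x | _) _.
have e : psi 1 * S = S.
  rewrite {2}/S (reindex_inj (addrI (1 : 'F_p))) mulr_sumr.
  by apply: eq_bigr => x _; rewrite psiD.
apply/eqP; have : (psi 1 - 1) * S = 0 by rewrite mulrBl e mul1r subrr.
move/eqP; rewrite mulf_eq0 subr_eq0 /psi expr1.
have -> : zeta == 1 = false; last by [].
apply/negP => /eqP z1; have := prim_order_dvd zeta_prim 1; rewrite z1 expr1n eqxx.
by rewrite dvdn1 => /eqP p1; have := prime_gt1 p_pr; rewrite p1.
Qed.

Lemma psi_sum_mul y : \sum_(x : 'F_p) psi (x * y) = if y == 0 then pK else 0.
Proof.
case: eqP => [->|/eqP y0].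
  under eq_bigr => x _ do rewrite mulr0 psi0.
  by rewrite sumr_const card_Fp.
by rewrite -(reindex_inj (mulIf y0) (P := predT) (F := psi)) psi_sum0.
Qed.

Local Notation G i := (gauss_sum zeta (ch i)).

Lemma gauss_sumE i : G i = \sum_(x : 'F_p) ch i x * psi x.
Proof. by rewrite /gauss_sum [in RHS](bigD1 0) //= ch0 mul0r add0r. Qed.

(** Pairs are grouped by their sum s. For s = 0 there remains the sum of a nontrivial character,
    which vanishes; for s != 0, substituting s x for x splits off the Jacobi sum. *)
Lemma gauss_mul i j : ~~ (p.-1 %| i + j)%N -> G i * G j = jac i j * G (i + j)%N.
Proof.
move=> hij; rewrite !gauss_sumE mulr_suml.
transitivity (\sum_(s : 'F_p) \sum_(x : 'F_p) ch i x * ch j (s - x) * psi s).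
  rewrite exchange_big /=; apply: eq_bigr => x _; rewrite mulr_sumr.
  rewrite (reindex_inj (addIr (- x))) /=; apply: eq_bigr => y _.
  by rewrite mulrACA -psiD subrKC.
rewrite mulr_sumr; apply: eq_bigr => s _; rewrite -mulr_suml mulrA; congr (_ * _).
have [->|s0] := eqVneq s 0.
  rewrite ch0 mulr0; under eq_bigr => x _ do rewrite sub0r -mulN1r chM mulrCA -chD.
  by rewrite -mulr_sumr ch_sum (negbTE hij) mulr0.
rewrite (reindex_inj (mulfI s0)) /= /jac mulr_suml; apply: eq_bigr => x _.
by rewrite -{2}[s]mulr1 -mulrBr !chM chD; ring.
Qed.

(* Fourier inversion: if the Gauss sum vanished, so would the whole transform. *)
Lemma gauss_neq0 i : ~~ (p.-1 %| i)%N -> G i != 0.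
Proof.
move=> hi; apply/eqP => G0.
have F0 t : \sum_(x : 'F_p) ch i x * psi (t * x) = 0.
  have [->|t0] := eqVneq t 0.
    under eq_bigr => x _ do rewrite mul0r psi0 mulr1.
    by rewrite ch_sum (negbTE hi).
  rewrite (reindex_inj (mulfI (invr_neq0 t0))) /=.
  under eq_bigr => x _ do rewrite mulVKf // chM -mulrA.
  by rewrite -mulr_sumr -gauss_sumE G0 mulr0.
have : \sum_(t : 'F_p) psi (t * -1) * \sum_(x : 'F_p) ch i x * psi (t * x) = 0.
  by rewrite big1 // => t _; rewrite F0 mulr0.
under eq_bigr => t _.
  rewrite mulr_sumr; under eq_bigr => x _ do rewrite mulrCA -psiD -mulrDr.
  over.
rewrite exchange_big /=; under eq_bigr => x _ do rewrite -mulr_sumr psi_sum_mul.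
rewrite (bigD1 1) //= addNr eqxx ch1 mul1r big1 ?addr0 => [/eqP|x x1].
  by rewrite (negbTE (pK_neq0 p_pr)).
by rewrite addrC subr_eq0 (negbTE x1) mulr0.
Qed.

End GaussSums.

(* om (1 - x) = (1 - om x)^p = 1 - om x - p logp x modulo p^2. *)
Definition logp x : K := \sum_(1 <= m < p) om x ^+ m / m%:R.

(** Replacing om (1 - x) by 1 - om x - p [logp x] in a Jacobi sum leaves [ysum] as main part, while
    [zsum] gives the coefficient of p. *)
Definition ysum i N : K := \sum_(x : 'F_p | x != 0) om x ^+ i * (1 - om x) ^+ N.

Definition zsum i N : K := \sum_(x : 'F_p | x != 0) om x ^+ i * (1 - om x) ^+ N * logp x.

Lemma pint_logp x : logp x \in pint.
Proof.
rewrite /logp big_nat; apply: rpred_sum => m hm.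
by rewrite rpredM ?rpredX ?pint_om ?pint_small.
Qed.

Lemma bin_pred_cong m : (m < p)%N -> cong 1 ('C(p.-1, m)%:R : K) ((-1) ^+ m).
Proof.
elim: m => [|m IH] mp; first by rewrite bin0; apply: cong_refl.
have e : 'C(p, m.+1)%:R = 'C(p.-1, m.+1)%:R + 'C(p.-1, m)%:R :> K.
  by rewrite -natrD -binS prednK ?prime_gt0.
have h : cong 1 ('C(p, m.+1)%:R : K) 0.
  have /dvdnP[d ->] : (p %| 'C(p, m.+1))%N by apply: prime_dvd_bin.
  by rewrite natrM mulrC; apply: cong0_pM; apply: rpred_nat.
have := congB h (IH (ltnW mp)).
by rewrite e addrK sub0r exprS mulN1r.
Qed.

Lemma sign_p : (2 < p)%N -> (-1) ^+ p = -1 :> K.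
Proof.
move=> p_odd; rewrite -signr_odd; have -> // : odd p.
by case: (even_prime p_pr) => // p2; move: p_odd; rewrite p2.
Qed.

Lemma bin_p_cong m : (0 < m < p)%N ->
  cong 2 ((-1) ^+ m * 'C(p, m)%:R : K) (pK * - m%:R^-1).
Proof.
case: m => // m mp; have n0 := natK_neq0 (K := K) p_pr (ltn0Sn m).
have hm := @pint_small _ _ K p_pr _ mp.
have -> : 'C(p, m.+1)%:R = pK * ('C(p.-1, m)%:R / m.+1%:R) :> K.
  by rewrite mulrA -natrM mul_bin_diag natrM mulrAC divff // mul1r.
rewrite mulrCA; apply: cong1_pM; rewrite mulrA.
have -> : - m.+1%:R^-1 = ((-1) ^+ m.+1 * (-1) ^+ m) / m.+1%:R :> K.
  by rewrite exprS mulN1r mulNr -expr2 sqrr_sign mulN1r.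
apply: congMr => //; apply: congMl; first by inpint.
exact: bin_pred_cong (ltnW mp).
Qed.

Lemma expr1B_cong x : (2 < p)%N -> cong 2 ((1 - om x) ^+ p) (1 - om x + pK * - logp x).
Proof.
move=> p_odd; set t := om x; have p0 := prime_gt0 p_pr.
have tp : t ^+ p = t.
  have [e|x0] := eqVneq x 0; first by rewrite /t e om0 expr0n gtn_eqF.
  transitivity (t ^+ p.-1.+1); first by rewrite prednK.
  by rewrite exprS om_exp // mulr1.
have -> : (1 - t) ^+ p = 1 - t + \sum_(1 <= m < p) (-1) ^+ m * 'C(p, m)%:R * t ^+ m.
  rewrite exprBn -(big_mkord predT (fun i => (-1) ^+ i * 1 ^+ (p - i) * t ^+ i *+ 'C(p, i))).
  rewrite big_nat_recr //= big_ltn // binn bin0 !expr0 expr1n !mulr1 !mulr1n tp expr1n.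
  rewrite sign_p // mulr1 mulN1r addrAC; congr (_ + _).
  by apply: eq_bigr => m _; rewrite expr1n mulr1 -mulr_natr mulrAC.
apply: congD; first exact: cong_refl.
rewrite /logp -sumrN mulr_sumr !big_nat; apply: cong_sum => m hm.
have -> : pK * - (t ^+ m / m%:R) = pK * - m%:R^-1 * t ^+ m by ring.
by apply: congMr; [rewrite rpredX ?pint_om|apply: bin_p_cong].
Qed.

(** A lift equals its own p-th power. So om (1 - x) = 1 - om x modulo p becomes, after p-th powers,
    a congruence modulo p^2 whose right side is expanded by [expr1B_cong]. *)
Lemma om1B_cong x : (2 < p)%N -> cong 2 (om (1 - x)) (1 - om x + pK * - logp x).
Proof.
move=> p_odd; apply: cong_trans (expr1B_cong x p_odd).
have ep y : om y = om y ^+ p.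
  have [->|y0] := eqVneq y 0.
    by rewrite om0 expr0n gtn_eqF ?prime_gt0.
  transitivity (om y ^+ p.-1.+1); first by rewrite exprS om_exp // mulr1.
  by rewrite prednK ?prime_gt0.
rewrite ep; apply: cong_expp => //; first by rewrite rpredB ?rpred1 ?pint_om.
apply: cong_trans (omD p_pr _ _) _; apply: cong_eq.
by rewrite om1 // -mulN1r omM // omN1 // mulN1r.
Qed.

Lemma cong_exprD (u v : K) N : u \in pint -> v \in pint ->
  cong 2 ((u + pK * v) ^+ N.+1) (u ^+ N.+1 + pK * (N.+1%:R * (u ^+ N * v))).
Proof.
move=> hu hv; elim: N => [|N IH]; first by rewrite !expr1 expr0 !mul1r; apply: cong_refl.
rewrite exprS; apply: cong_trans (congMl _ IH) _; first by inpint.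
exists (N.+1%:R * (u ^+ N * v ^+ 2)); first by inpint.
by rewrite -[N.+2%:R]natr1 !exprS; move: (u ^+ N) (N.+1%:R) => A B; ring.
Qed.

(** The second exponent is positive because at x = 1 the character [ch 0] gives 0 whereas [0 ^+ 0]
    is 1. *)
Lemma jac_cong i N : (2 < p)%N ->
  cong 2 (jac i N.+1) (ysum i N.+1 - pK * (N.+1%:R * zsum i N)).
Proof.
move=> p_odd; rewrite /jac (bigD1 0) //= ch0 mul0r add0r /ysum /zsum !mulr_sumr -sumrB.
apply: cong_sum => x x0; rewrite ch_neq0 // ch_om //.
have h1 := pint_om (K := K) p_pr x; have h2 := pint_logp x.
apply: cong_trans (congMl _ (congX N.+1 _ (om1B_cong x p_odd))) _; try by inpint.
apply: cong_trans (congMl _ (cong_exprD N _ _)) _; try by inpint.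
by apply: cong_eq; move: (_ ^+ N.+1) (_ ^+ N) (_ ^+ i) (N.+1%:R) => A B C D; ring.
Qed.

(** Splitting off one factor 1 - om x gives a recurrence of Pascal type, which reduces every
    evaluation to N = 0, where orthogonality applies; [zsumS] is its twin. *)
Lemma ysumS i N : ysum i N.+1 = ysum i N - ysum i.+1 N.
Proof.
rewrite /ysum -sumrB; apply: eq_bigr => x _; rewrite !exprS.
by move: (om x ^+ i) ((1 - om x) ^+ N) => A B; ring.
Qed.

Lemma zsumS i N : zsum i N.+1 = zsum i N - zsum i.+1 N.
Proof.
rewrite /zsum -sumrB; apply: eq_bigr => x _; rewrite !exprS.
by move: (om x ^+ i) ((1 - om x) ^+ N) => A B; ring.
Qed.

Lemma ysum_period i N : ysum (p.-1 + i) N = ysum i N.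
Proof. by apply: eq_bigr => x x0; rewrite exprD om_exp // mul1r. Qed.

Lemma zsum_period i N : zsum (p.-1 + i) N = zsum i N.
Proof. by apply: eq_bigr => x x0; rewrite exprD om_exp // mul1r. Qed.

Lemma ysum0 i : ysum i 0 = if (p.-1 %| i)%N then p.-1%:R else 0.
Proof.
by rewrite -(om_sum (K := K) p_pr); apply: eq_bigr => x _; rewrite expr0 mulr1.
Qed.

Lemma ysum_small i N : (0 < i)%N -> (i + N < p.-1)%N -> ysum i N = 0.
Proof.
elim: N i => [|N IH] i i0 h; last by rewrite ysumS !IH ?subrr //; lia.
by rewrite ysum0 gtnNdvd //; lia.
Qed.

(** Among the exponents p-1-a, ..., p-1-a+N of the expansion, the bounds allow no multiple of p - 1
    other than p - 1 itself; it comes with coefficient (-1)^a 'C(N, a). *)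
Lemma ysum_large a N : (a < p.-1)%N -> (N < p.-1 + a)%N ->
  ysum (p.-1 - a) N = p.-1%:R * ((-1) ^+ a * 'C(N, a)%:R).
Proof.
elim: N a => [|N IH] [|a] ap h.
- by rewrite subn0 ysum0 dvdnn bin0 expr0 !mulr1.
- by rewrite ysum0 bin_small // !mulr0 gtnNdvd //; lia.
- rewrite subn0 -[p.-1]addn0 ysum_period ysumS [ysum 1 N]ysum_small ?subr0 //; last by lia.
  by rewrite -ysum_period addn0 -[p.-1 in LHS]subn0 IH ?bin0 //; lia.
rewrite ysumS; have -> : ((p.-1 - a.+1).+1 = p.-1 - a)%N by lia.
rewrite !IH; try lia.
by rewrite binS natrD exprS; ring.
Qed.

(** Orthogonality keeps only the term m = p - 1 - i of [logp], and (p-1)/(p-1-i) is 1/(i+1) modulo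
    p. *)
Lemma zsum0_cong i : (i < p.-1)%N -> cong 1 (zsum i 0) i.+1%:R^-1.
Proof.
move=> ip; rewrite /zsum.
under eq_bigr => x _ do rewrite expr0 mulr1 /logp mulr_sumr.
rewrite exchange_big /=.
have -> : \sum_(1 <= m < p) \sum_(x : 'F_p | x != 0) om x ^+ i * (om x ^+ m / m%:R) =
   \sum_(1 <= m < p) (if m == (p.-1 - i)%N then p.-1%:R / m%:R else 0) :> K.
  apply: eq_big_nat => m hm.
  under eq_bigr => x _ do rewrite mulrA -exprD.
  rewrite -mulr_suml om_sum //.
  have -> : (p.-1 %| i + m)%N = (m == (p.-1 - i)%N).
    apply/idP/eqP => [/dvdnP[d hd]|->]; last by rewrite subnKC ?dvdnn // ltnW.
    have d1 : d = 1%N by nia.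
    by rewrite d1 mul1n in hd; lia.
  by case: ifP => _; rewrite ?mul0r.
rewrite -big_mkcond /= big_nat1_eq.
have -> : (0 < p.-1 - i < p)%N by lia.
have e : ((p.-1 - i)%N%:R : K) = pK * 1 - i.+1%:R.
  by rewrite mulr1 -natrB; [congr _%:R; lia|lia].
have e1 : (p.-1%:R : K) = - 1 + pK * 1.
  by rewrite mulr1 -subn1 natrB ?prime_gt0 // addrC.
have h1 : i.+1%:R^-1 \in (pint : {pred K}) by apply: pint_small => //; lia.
apply: cong_divl => //; first by apply: pabs_small => //; lia.
exists (1 - i.+1%:R^-1); first by inpint.
have n0 := natK_neq0 (K := K) p_pr (ltn0Sn i).
by rewrite e e1 expr1; move: (i.+1%:R) n0 => A n0; field.
Qed.

(** The right side is the Beta integral B(i+1, N+1), which starts at 1/(i+1) and satisfies the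
    recurrence [zsumS]. *)
Lemma zsum_small i N : (i + N < p.-1)%N ->
  cong 1 (zsum i N) (i`!%:R * N`!%:R / (i + N).+1`!%:R).
Proof.
elim: N i => [|N IH] i h.
  rewrite addn0 in h *; rewrite fact0 mulr1 factSr.
  have n0 := factK_neq0 (K := K) p_pr i; have n1 := natK_neq0 (K := K) p_pr (ltn0Sn i).
  have -> : i`!%:R / (i.+1%:R * i`!%:R) = i.+1%:R^-1 :> K.
    by move: (i.+1%:R) (i`!%:R) n0 n1 => A B n0 n1; field; rewrite ?n0 ?n1.
  exact: zsum0_cong.
rewrite zsumS; apply: cong_trans (congB (IH i _) (IH i.+1 _)) _; try lia.
apply: cong_eq; rewrite addSn addnS [(i + N).+2`!%:R]factSr [i.+1`!%:R]factSr [N.+1`!%:R]factSr.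
have n1 := natK_neq0 (K := K) p_pr (ltn0Sn (i + N).+1).
have n2 := factK_neq0 (K := K) p_pr (i + N).+1.
move: n1 n2; have -> : (i + N).+2%:R = i.+1%:R + N.+1%:R :> K by rewrite -natrD; congr _%:R; lia.
move: (i.+1%:R) (N.+1%:R) ((i + N).+1`!%:R) => A B C n1 n2.
by field; rewrite ?n1 ?n2.
Qed.

(** The same recurrence, from the value -1/a. For N < a the exponents stay below p - 1, where the
    initial value would be 1 instead. *)
Lemma zsum_large a N : (N < a)%N -> (a < p)%N ->
  cong 1 (zsum (p.-1 - a) N) ((-1) ^+ N.+1 * (N`!%:R * (a - N).-1`!%:R / a`!%:R)).
Proof.
elim: N a => [|N IH] [|a] // Na ap.
  have ea : (p.-1 - a.+1).+1%:R = - a.+1%:R + pK * 1.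
    by rewrite mulr1 addrC -natrB; [congr _%:R; lia|lia].
  apply: cong_trans (zsum0_cong _) _; first by lia.
  have h1 := @pint_small _ _ K p_pr a.+1 ap.
  have -> : (-1) ^+ 1 * (0`!%:R * (a.+1 - 0).-1`!%:R / a.+1`!%:R) = (- a.+1%:R)^-1 :> K.
    have n0 := natK_neq0 (K := K) p_pr (ltn0Sn a); have n1 := factK_neq0 (K := K) p_pr a.
    rewrite subn0 fact0 factSr expr1 /=.
    by move: (a.+1%:R) (a`!%:R) n0 n1 => A B n0 n1; field; rewrite oppr_eq0 n0 n1.
  apply: congV => //; first by rewrite pabsN; apply: pabs_small.
  by rewrite ea; apply: cong_p; rewrite rpred1.
rewrite zsumS; have -> : ((p.-1 - a.+1).+1 = p.-1 - a)%N by lia.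
apply: cong_trans (congB (IH a.+1 _ _) (IH a _ _)) _; try lia.
apply: cong_eq; have -> : ((a.+1 - N).-1 = (a - N.+1).+1)%N by lia.
have -> : ((a - N).-1 = a - N.+1)%N by lia.
rewrite [a.+1`!%:R]factSr [N.+1`!%:R]factSr [(a - N.+1).+1`!%:R]factSr ![(-1) ^+ _.+1]exprS.
have n0 := natK_neq0 (K := K) p_pr (ltn0Sn a); have n1 := factK_neq0 (K := K) p_pr a.
have -> : (a - N.+1).+1%:R = a.+1%:R - N.+1%:R :> K by rewrite -natrB; [congr _%:R; lia|lia].
move: (a.+1%:R) (N.+1%:R) (a`!%:R) n0 n1 => A B C n0 n1.
by field; rewrite ?n0 ?n1.
Qed.

(** Up to the [+ 1], this is the relative first-order change of 'C(b, a) when both arguments are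
    scaled by 1 + p. *)
Definition entropy a b : K := b%:R * harm b - a%:R * harm a - (b - a)%:R * harm (b - a) + 1.

(** For a <= N the exponents meet p - 1. The edges a = 0 and a = N + 1 fall under the two previous
    formulas, and the recurrence fills in the triangle between them. *)
Lemma zsum_mid a N : (a <= N.+1)%N -> (N < p.-1)%N ->
  cong 1 (zsum (p.-1 - a) N)
    ((-1) ^+ a * (N`!%:R / (a`!%:R * (N.+1 - a)`!%:R) * entropy a N.+1)).
Proof.
elim: N a => [|N IH] a aN Np.
  have n1 := prime_gt1 p_pr; rewrite fact0; case: a aN => [|[|//]] _.
    rewrite subn0 fact0 -[p.-1]addn0 zsum_period; apply: cong_trans (zsum0_cong Np) _.
    apply: cong_eq; rewrite /entropy subn0 harm0 mulr0 subr0 subrr add0r expr0.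
    by rewrite !mul1r mulr1.
  apply: cong_trans (zsum_large _ _) _ => //.
  apply: cong_eq; rewrite /entropy subnn harm0 mulr0 subr0 subrr add0r expr1.
  by rewrite subn0 /= ?fact0 !mulr1 ?mul1r.
case: (posnP a) => [->|a0].
  rewrite subn0 -[p.-1]addn0 zsum_period; apply: cong_trans (zsum_small _) _; first by lia.
  apply: cong_eq; rewrite /entropy !subn0 harm0 mulr0 subr0 subrr add0r add0n expr0.
  by rewrite [0`!]fact0 !mul1r mulr1.
move: aN; rewrite leq_eqVlt => /orP[/eqP ->|aN].
  apply: cong_trans (zsum_large _ _) _ => //; first by lia.
  apply: cong_eq; rewrite /entropy subSnn subnn harm0 mul0r subrr subr0 add0r.
  by rewrite [0`!]fact0 !mulr1 ?mul1r.
case: a a0 aN => // a _ aN.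
rewrite zsumS; have -> : ((p.-1 - a.+1).+1 = p.-1 - a)%N by lia.
apply: cong_trans (congB (IH a.+1 _ _) (IH a _ _)) _; try lia.
apply: cong_eq; rewrite /entropy !subSS.
have -> : (N.+1 - a = (N - a).+1)%N by lia.
rewrite [a.+1`!%:R]factSr [N.+1`!%:R]factSr [(N - a).+1`!%:R]factSr !harmS exprS.
have n1 := natK_neq0 (K := K) p_pr (ltn0Sn a).
have n2 := natK_neq0 (K := K) p_pr (ltn0Sn (N - a)).
have n3 := natK_neq0 (K := K) p_pr (ltn0Sn N).
have n4 := natK_neq0 (K := K) p_pr (ltn0Sn N.+1).
have n5 := factK_neq0 (K := K) p_pr a; have n6 := factK_neq0 (K := K) p_pr (N - a).
have e1 : a%:R = a.+1%:R - 1 :> K by rewrite -natr1 addrK.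
have e2 : (N - a)%:R = (N - a).+1%:R - 1 :> K by rewrite -natr1 addrK.
have e4 : N.+2%:R = a.+1%:R + (N - a).+1%:R :> K by rewrite -natrD; congr _%:R; lia.
have e3 : N.+1%:R = a.+1%:R + (N - a).+1%:R - 1 :> K by rewrite -e4 -[N.+2%:R]natr1 addrK.
rewrite e4 in n4 *; rewrite e3 in n3 *; rewrite e1 e2.
move: (a.+1%:R) ((N - a).+1%:R) (a`!%:R) ((N - a)`!%:R) n1 n2 n3 n4 n5 n6.
move: (harm N) (harm a) (harm (N - a)) (N`!%:R) ((-1) ^+ a).
move=> hN ha hd F s A D X Y n1 n2 n3 n4 n5 n6.
by field; rewrite n1 n2 n3 n4 n5 n6.
Qed.

(* Exponents only matter modulo p-1: this is the Jacobi sum of om^(k-a) and om^(b-k). *)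
Definition jac_pair a b k : K := jac (p.-1 - a + k) (p.-1 + b - k).

Lemma pint_ch i x : ch i x \in pint.
Proof.
by rewrite !chE; case: ifP => _; rewrite ?rpred0 // rpredX ?pint_om.
Qed.

Lemma pint_jac i j : jac i j \in pint.
Proof. by apply: rpred_sum => x _; rewrite rpredM ?pint_ch. Qed.

Lemma Qp_jac i j : Qp (jac i j).
Proof.
apply: Qp_sum => // x _; apply: QpM => //; rewrite !chE.
  by case: ifP => _; [exact: (Qp_nat 0%N)|apply: QpX => //; exact: Qp_om].
by case: ifP => _; [exact: (Qp_nat 0%N)|apply: QpX => //; exact: Qp_om].
Qed.

Lemma eq_jac i j i' j' : ch i =1 ch i' -> ch j =1 ch j' -> jac i j = jac i' j'.
Proof. by move=> hi hj; apply: eq_bigr => x _; rewrite hi hj. Qed.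

(** * The Jacobi sums attached to one pair *)

Section Pair.
Variables (a b : nat).
Hypothesis (p_odd : (2 < p)%N) (a_gt0 : (0 < a)%N) (ab : (a < b)%N) (bp : (b < p)%N).

Lemma jac_pair_lowE k : (k <= a)%N -> jac_pair a b k = jac (p.-1 - (a - k)) (b - k).
Proof.
move=> ka; apply: eq_jac => x; first by congr (ch _ x); lia.
by rewrite -addnBA ?ch_period //; lia.
Qed.

Lemma jac_pair_highE k : (a < k)%N -> (k < b)%N -> jac_pair a b k = jac (k - a) (b - k).
Proof.
move=> ak kb; apply: eq_jac => x.
  by rewrite -[RHS]ch_period; congr (ch _ x); lia.
by rewrite -addnBA ?ch_period //; lia.
Qed.

Definition jac_lead k : K := - ((-1) ^+ (a - k) * ((b - k)`!%:R / ((a - k)`!%:R * (b - a)`!%:R))).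

Lemma jac_pair_low k : (k <= a)%N ->
  cong 2 (jac_pair a b k) (jac_lead k * (1 + pK * ((b - k)%:R * harm (b - k)
     - (a - k)%:R * harm (a - k) - (b - a)%:R * harm (b - a)))).
Proof.
move=> ka; rewrite jac_pair_lowE //.
have e : (b - k = (b - k).-1.+1)%N by lia.
rewrite {1}e; apply: cong_trans (jac_cong _ _ p_odd) _.
rewrite -e ysum_large; try lia.
have h := zsum_mid (a := a - k) (N := (b - k).-1) _ _.
have {h} h := h ltac:(lia) ltac:(lia); rewrite -e in h.
have hn : (b - k)%:R \in (pint : {pred K}) by apply: rpred_nat.
apply: cong_trans (congB (cong_refl 2 _) (cong1_pM (congMl hn h))) _.
have e1 : (p.-1%:R : K) = - 1 + pK by rewrite -subn1 natrB ?prime_gt0 // addrC.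
have -> : 'C(b - k, a - k)%:R = (b - k)`!%:R / ((a - k)`!%:R * (b - a)`!%:R) :> K.
  apply: canRL (mulfK _) _; first by rewrite mulf_neq0 ?(factK_neq0 p_pr).
  by rewrite -!natrM -(bin_fact (n := b - k) (m := a - k)) ?leq_sub2r ?(ltnW ab) // subnBA // subnK //; lia.
have e2 : (b - k)`!%:R = (b - k)%:R * (b - k).-1`!%:R :> K by rewrite {1}e factSr -e.
have e3 : (b - k - (a - k) = b - a)%N by lia.
(* The p in p - 1 = -1 + p cancels the [+ 1] of [entropy]; the remaining -1 is the sign in
   [jac_lead]. *)
apply: cong_eq; rewrite /entropy /jac_lead e1 e3 e2.
move: ((b - k)%:R) ((b - k).-1`!%:R) ((-1) ^+ (a - k)) (_^-1) => A B C D.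
ring.
Qed.

(** The exponents run from k - a to b - a, strictly between 0 and p - 1, so [ysum] vanishes and the
    Jacobi sum is divisible by p. *)
Lemma jac_pair_high k : (a < k)%N -> (k < b)%N ->
  cong 2 (jac_pair a b k) (pK * - ((k - a)`!%:R * (b - k)`!%:R / (b - a)`!%:R)).
Proof.
move=> ak kb; rewrite jac_pair_highE //.
have e : (b - k = (b - k).-1.+1)%N by lia.
rewrite {1}e; apply: cong_trans (jac_cong _ _ p_odd) _.
rewrite -e ysum_small; try lia.
rewrite sub0r [X in cong _ _ X]mulrN; apply: congN; apply: cong1_pM.
have h := zsum_small (i := k - a) (N := (b - k).-1).
have {h} h := h ltac:(lia); rewrite -addnS -e in h.
have hn : (b - k)%:R \in (pint : {pred K}) by apply: rpred_nat.
apply: cong_trans (congMl hn h) _.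
have -> : (k - a + (b - k) = b - a)%N by lia.
have e2 : (b - k)`!%:R = (b - k)%:R * (b - k).-1`!%:R :> K by rewrite {1}e factSr -e.
by apply: cong_eq; rewrite e2; ring.
Qed.

Lemma pabs_jac_lead k : pabs (jac_lead k) = 1.
Proof.
rewrite /jac_lead pabsN !pabsM pabsV pabsM pabs_sign !(pabs_fact p_pr); try lia.
by rewrite !(mulr1, invr1).
Qed.

Lemma pabs_jac_pair0 : pabs (jac_pair a b 0) = 1.
Proof.
have h := cong_le (isT : (1 <= 2)%N) (jac_pair_low (leq0n a)).
apply: (cong_abs_unit p_pr h); rewrite pabsM pabs_jac_lead mul1r.
apply: (cong_abs_unit p_pr (y := 1)); rewrite ?pabs1 //.
apply: cong_p; rewrite !subn0.
have ha := pint_harm (K := K) p_pr (ltn_trans ab bp); have hb := pint_harm (K := K) p_pr bp.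
have hd : harm (b - a) \in pint by apply: pint_harm => //; lia.
by inpint.
Qed.

(* Plays the role of the Gross-Koblitz formula modulo p^2: the Jacobi quotient at
   the character om^k is the coefficient at k shifted, to first order, to k + p k. *)
Lemma jac_pair_cong k : (k < b)%N ->
  cong 2 ((-1) ^+ k * (jac_pair a b k / jac_pair a b 0))
    (pair_coef a b k + pK * (k%:R * ((pair_poly a b)^`()).[k%:R])).
Proof.
move=> kb; have j0 := jac_pair_low (leq0n a).
have u0 := pabs_jac_pair0; have ul := pabs_jac_lead 0.
have ha := pint_harm (K := K) p_pr (ltn_trans ab bp); have hb := pint_harm (K := K) p_pr bp.
have hd : harm (b - a) \in pint by apply: pint_harm => //; lia.
have f0 := factK_neq0 (K := K) p_pr a; have f1 := factK_neq0 (K := K) p_pr b.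
have f2 := factK_neq0 (K := K) p_pr (b - a); have f3 := factK_neq0 (K := K) p_pr (a - k).
have bi := @pint_factV _ _ K p_pr b bp.
have s2 := sqrr_sign K (a - k).
rewrite !subn0 in j0.
case: (leqP k a) => ka.
  apply: cong_trans _ (cong_sym (pair_coef_deriv_low p_pr a_gt0 ab bp ka)).
  have hak : harm (a - k) \in pint by apply: pint_harm => //; lia.
  have hbk : harm (b - k) \in pint by apply: pint_harm => //; lia.
  have hl := pint_pair_low (K := K) p_pr k (ltnW ab) bp.
  rewrite [X in cong _ X _]mulrA; apply: cong_divl => //; first by inpint.
  apply: cong_trans (congMl _ (jac_pair_low ka)) _; first by inpint.
  apply: cong_sym; apply: cong_trans (congMr _ j0) _; first by inpint.
  have -> : jac_lead 0 = (-1) ^+ k * jac_lead k / pair_low a b k.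
    rewrite /jac_lead /pair_low !subn0.
    have -> : (-1) ^+ a = (-1) ^+ k * (-1) ^+ (a - k) :> K by rewrite -exprD subnKC.
    have f4 := factK_neq0 (K := K) p_pr (b - k).
    move: ((-1) ^+ k) ((-1) ^+ (a - k)) => s t.
    by field; rewrite f0 f1 f2 f3 f4.
  have u1 := pabs_pair_low (K := K) p_pr k (ltnW ab) bp.
  have n1 := pabs_unit_neq0 u1.
  move: n1 hl; set P := pair_low a b k => n1 hl.
  set J := jac_lead k; have hJ : J \in pint by apply/pabs_unit_pint/pabs_jac_lead.
  set w0 := b%:R * harm b - _ - _; set w1 := a%:R * harm a - _ + _ - _.
  have hw0 : w0 \in pint by rewrite /w0; inpint.
  have hw1 : w1 \in pint by rewrite /w1; inpint.
  (* The first-order term at index k is the one at index 0, [w0], plus that of the coefficient,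
     [w1]; and (1 + p w0)(1 + p w1) = 1 + p (w0 + w1) modulo p^2. *)
  have -> : (b - k)%:R * harm (b - k) - (a - k)%:R * harm (a - k) - (b - a)%:R * harm (b - a)
    = w0 + w1 by rewrite /w0 /w1; ring.
  exists ((-1) ^+ k * J * (w0 * w1)); first by inpint.
  by move: ((-1) ^+ k) => s; field; rewrite n1.
apply: cong_trans _ (cong_sym (pair_coef_deriv_high p_pr bp ka (ltnW kb))).
have hh := pint_pair_high (K := K) p_pr a k bp.
rewrite [X in cong _ X _]mulrA; apply: cong_divl => //; first by inpint.
apply: cong_trans (congMl _ (jac_pair_high ka kb)) _; first by inpint.
rewrite mulrCA [X in cong _ _ X]mulrCA; apply: cong1_pM.
have jl := cong_le (isT : (1 <= 2)%N) j0.
have j1 : cong 1 (jac_pair a b 0) (jac_lead 0).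
  apply: cong_trans jl _; rewrite mulrDr mulr1 mulrCA; apply: cong_p.
  by have h5 := pabs_unit_pint ul; inpint.
apply: cong_trans _ (cong_sym (congMr _ j1)); last by inpint.
apply: cong_eq; rewrite /jac_lead /pair_high /pair_const !subn0.
have -> : (-1) ^+ k = (-1) ^+ a * (-1) ^+ (k - a) :> K by rewrite -exprD subnKC // ltnW.
have -> : (k - a)`!%:R = (k - a)%:R * (k - a).-1`!%:R :> K.
  by rewrite -[in LHS](@prednK (k - a)) ?subn_gt0 // factSr prednK ?subn_gt0.
by field; rewrite f0 f1 f2.
Qed.

Lemma jac_pair_cong0 k : (a < k)%N -> (k < b)%N ->
  cong 1 (jac_pair a b k / jac_pair a b 0) 0.
Proof.
move=> ak kb; rewrite -[X in cong _ _ X](mul0r (jac_pair a b 0)^-1).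
apply: congMr; first by apply/pint_unitV/pabs_jac_pair0.
apply: cong_trans (cong_le (isT : (1 <= 2)%N) (jac_pair_high ak kb)) _.
have f : ((b - a)`!%:R : K)^-1 \in pint by apply: pint_factV => //; lia.
by apply: cong0_pM; inpint.
Qed.

Lemma pint_jac_pair k : jac_pair a b k / jac_pair a b 0 \in pint.
Proof. by rewrite rpredM ?pint_jac //; apply/pint_unitV/pabs_jac_pair0. Qed.

End Pair.

End JacobiSums.

(** * Sums of polynomial values over 0, ..., p - 1 *)

Section PowerSums.
Context {R : realType} {p : nat} {K : padicComplexType R p}.
Hypothesis p_pr : prime p.

Local Notation pK := (p%:R : K).

Lemma sum_Fp_nat (F : nat -> K) : \sum_(x : 'F_p) F x = \sum_(k < p) F k.
Proof.
by rewrite -(big_mkord predT F) (Fp_cast p_pr) big_mkord.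
Qed.

(** Replacing k by its lift gives a sum over roots of unity; m > 0 makes the term k = 0 vanish. *)
Lemma power_sum_cong m : (0 < m)%N ->
  cong 1 (\sum_(k < p) (k%:R : K) ^+ m) (- (p.-1 %| m)%N%:R).
Proof.
move=> m0; rewrite -(sum_Fp_nat (fun k => k%:R ^+ m)) (bigD1 0) //= expr0n gtn_eqF // add0r.
apply: (@cong_trans _ _ _ _ (\sum_(x : 'F_p | x != 0) teichmuller x ^+ m)).
  apply: cong_sym; apply: cong_sum => x _; apply: congX; first exact: rpred_nat.
  exact: om_cong.
rewrite om_sum //; case: ifP => _ /=; last by rewrite oppr0; apply: cong_refl.
have -> : (p.-1%:R : K) = - 1 + pK * 1 by rewrite mulr1 -subn1 natrB ?prime_gt0 // addrC.
by apply: cong_p; rewrite rpred1.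
Qed.

(** Up to degree 2(p-1), the only positive multiples of p - 1 are p - 1 and 2(p-1); the constant
    term is added p times and disappears modulo p. *)
Lemma horner_sum_cong (g : {poly K}) : (2 < p)%N -> g \is a polyOver pint ->
  (size g <= (p + p).-1)%N ->
  cong 1 (\sum_(k < p) g.[k%:R]) (- (g`_(p.-1) + g`_(p + p).-2)).
Proof.
move=> p_odd /polyOverP hg sg.
under eq_bigr => k _ do rewrite (horner_coef_wide _ sg).
rewrite exchange_big /=.
have -> : - (g`_p.-1 + g`_(p + p).-2) = \sum_(i < (p + p).-1) g`_i * - ((0 < (i : nat))%N && (p.-1 %| i)%N)%:R.
  have l1 : (p.-1 < (p + p).-1)%N by lia.
  have l2 : ((p + p).-2 < (p + p).-1)%N by lia.
  rewrite (bigD1 (Ordinal l1)) //= (bigD1 (Ordinal l2)) /=; last first.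
    by rewrite -val_eqE /=; lia.
  rewrite big1 => [|i /andP[]]; last first.
    rewrite -!val_eqE /= => h1 h2; have hi := ltn_ord i.
    suff -> : ((0 < (i : nat))%N && (p.-1 %| i)%N) = false by rewrite oppr0 mulr0.
    apply/negP => /andP[i0 /dvdnP[d hd] ].
    have : (d = 1 \/ d = 2)%N by nia.
    by case=> hd'; move: hd h1 h2; rewrite hd' => ->; lia.
  have -> : (p + p).-2 = (2 * p.-1)%N by lia.
  rewrite dvdnn dvdn_mull // !andbT.
  have -> : (0 < p.-1)%N by lia.
  have -> : (0 < 2 * p.-1)%N by lia.
  by rewrite addr0 !mulrN1 opprD.
apply: cong_sum => i _; rewrite -mulr_sumr; apply: congMl => //.
have [->|i0] := posnP (i : nat).
  rewrite oppr0; under eq_bigr => k _ do rewrite expr0.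
  by rewrite sumr_const card_ord -[pK]mulr1; apply: cong0_pM; rewrite rpred1.
exact: power_sum_cong.
Qed.

(** In the derivative, the coefficient of degree p - 1 carries a factor p and that of degree 2(p-1)
    a factor 2p - 1, that is -1, which cancels the sign of the power sums. *)
Lemma deriv_sum_cong (f : {poly K}) : (2 < p)%N -> f \is a polyOver pint ->
  (size f <= p + p)%N -> cong 1 (\sum_(k < p) (f^`()).[k%:R]) f`_(p + p).-1.
Proof.
move=> p_odd hf sf; have hd : f^`() \is a polyOver pint by apply: polyOver_deriv.
apply: cong_trans (horner_sum_cong p_odd hd _) _.
  have [->|f0] := eqVneq f 0; first by rewrite deriv0 size_poly0.
  by rewrite -ltnS; apply: leq_trans (lt_size_deriv f0) _; rewrite prednK //; lia.
rewrite !coef_deriv; have -> : (p + p).-2.+1 = (p + p).-1 by lia.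
rewrite prednK ?prime_gt0 //.
move/polyOverP: hf => hf; have h1 := hf p; have h2 := hf (p + p).-1.
exists (- (f`_p + 2%:R * f`_(p + p).-1)); first by inpint.
rewrite expr1 -(mulr_natr _ p) -(mulr_natr _ (p + p).-1).
have -> : ((p + p).-1%:R : K) = pK + pK - 1 by rewrite -natrD -subn1 natrB //; lia.
ring.
Qed.

End PowerSums.

Lemma big_ord_block (T : Type) (idx : T) (op : Monoid.law idx) (m q : nat) (F : nat -> T) :
  \big[op/idx]_(i < m * q) F i = \big[op/idx]_(j < m) \big[op/idx]_(i < q) F (i + j * q)%N.
Proof.
elim: m => [|m IH]; first by rewrite mul0n !big_ord0.
rewrite mulSnr big_split_ord /= IH [RHS]big_ord_recr /=; congr (op _ _).
by apply: eq_bigr => i _; rewrite addnC.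
Qed.

(** * The p-adic gamma function modulo p *)

Section MoritaGamma.
Context {R : realType} {p : nat} {K : padicComplexType R p}.
Hypothesis (p_pr : prime p) (p_odd : (2 < p)%N).
Implicit Types (x y : K) (k m n : nat).

Local Notation pK := (p%:R : K).
Local Notation Mg := (@morita_gamma_nat R p K).
Local Notation rho := (@rho R p K).

Definition upart n : K := if (p %| n)%N then 1 else n%:R.

Lemma pabs_upart n : pabs (upart n) = 1.
Proof.
rewrite /upart; case: ifPn => h; first by rewrite pabs1.
by rewrite pabs_nat_unit // prime_coprime.
Qed.

Lemma pint_upart n : upart n \in pint.
Proof. exact/pabs_unit_pint/pabs_upart. Qed.

Lemma upart_cong k m n : (0 < k)%N -> m = n %[mod p ^ k] -> cong k (upart m) (upart n).
Proof.
case: k => // k _ e; have e1 : m = n %[mod p].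
  have /modn_dvdm h : (p %| p ^ k.+1)%N by rewrite expnS dvdn_mulr.
  by rewrite -(h m) -(h n) e.
by rewrite /upart /dvdn e1; case: ifP => // _; apply: cong_nat.
Qed.

Lemma MgE n : Mg n = (-1) ^+ n * \prod_(1 <= i < n) upart i.
Proof.
rewrite /morita_gamma_nat big_mkcond /=; congr (_ * _).
by apply: eq_bigr => i _; rewrite /upart if_neg.
Qed.

Lemma wilson_cong : cong 1 (p.-1`!%:R : K) (-1).
Proof.
have := p_pr; rewrite Wilson ?prime_gt1 // => /dvdnP[d hd].
exists d%:R; first exact: rpred_nat.
have : (p.-1`!.+1%:R : K) = d%:R * pK by rewrite hd natrM.
by rewrite -natr1 => /eqP; rewrite eq_sym -subr_eq => /eqP <-; ring.
Qed.

(* The terms i + j q, j < p, multiply to i^p since p divides 0 + 1 + ... + (p-1). *)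
Lemma prod_shift_cong k (u : nat) :
  cong k.+2 (\prod_(j < p) upart (u + j * p ^ k.+1)) (upart u ^+ p).
Proof.
have eup j : upart (u + j * p ^ k.+1) = if (p %| u)%N then 1 else u%:R + pK ^+ k.+1 * j%:R.
  rewrite /upart dvdn_addl; last by rewrite expnS mulnCA dvdn_mulr.
  by case: ifP => // _; rewrite natrD natrM natrX mulrC.
under eq_bigr => j _ do rewrite eup.
case: (boolP (p %| u)%N) => hu.
  by rewrite /upart hu big1 // expr1n; apply: cong_refl.
rewrite /upart (negbTE hu).
have u1 : pabs (u%:R : K) = 1 by rewrite pabs_nat_unit // prime_coprime.
have u0 := pabs_unit_neq0 u1; have hv := pint_unitV u1.
set q := pK ^+ k.+1.
have h m : cong k.+2 (\prod_(j < m) (u%:R + q * j%:R))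
   (u%:R ^+ m * (1 + q * (u%:R^-1 * (\sum_(j < m) j)%N%:R))).
  elim: m => [|m IH].
    by rewrite !big_ord0 expr0 !mulr0 addr0 mulr1; apply: cong_refl.
  rewrite big_ord_recr /=; apply: cong_trans (congMr _ IH) _; first by rewrite /q; inpint.
  rewrite [in X in cong _ _ X]big_ord_recr /= natrD exprSr.
  move: (\sum_(j < m) j)%N => s.
  exists (pK ^+ k * (u%:R ^+ m * (u%:R^-1 * s%:R * m%:R))); first by inpint.
  rewrite mulrA -exprD; have -> : (k.+2 + k = k.+1 + k.+1)%N by lia.
  rewrite exprD -/q; move: (u%:R) u0 => U u0.
  by move: (U ^+ m) (s%:R) (m%:R) => A B C; field.
apply: cong_trans (h p) _; rewrite -(big_mkord predT id) bin2_sum.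
have /dvdnP[d ->] : (p %| 'C(p, 2))%N by rewrite prime_dvd_bin.
exists (u%:R ^+ p * (u%:R^-1 * d%:R)); first by inpint.
rewrite natrM (exprS pK k.+1) -/q; move: (_^-1) (u%:R ^+ p) (d%:R) => A B C; ring.
Qed.

(** Wilson's theorem for prime powers. The residues modulo p^(k+2) are p shifted copies of those
    modulo p^(k+1), so the product is the p-th power of the previous one, and p-th powers gain a
    digit. *)
Lemma wilson_pow k : cong k.+1 (\prod_(i < p ^ k.+1) upart i) (-1).
Proof.
elim: k => [|k IH].
  rewrite expn1; apply: cong_trans _ wilson_cong; apply: cong_eq.
  have e (m : nat) : (0 < m <= p)%N -> \prod_(i < m) upart i = m.-1`!%:R.
    case: m => // m /= mp; elim: m mp => [|m IH] mp.
      by rewrite big_ord_recr big_ord0 /= /upart dvdn0 mulr1.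
    rewrite big_ord_recr /= IH ?(ltnW mp) // /upart gtnNdvd // factS natrM mulrC.
    by [].
  by rewrite e // prime_gt0 //=.
rewrite expnS big_ord_block exchange_big /=.
apply: (@cong_trans _ _ _ _ (\prod_(i < p ^ k.+1) upart i ^+ p)).
  apply: cong_prod => i _; last exact: prod_shift_cong.
  by rewrite rpredX ?pint_upart.
rewrite prodrXl -[X in cong _ _ X](sign_p p_pr p_odd).
by apply: cong_expp => //; inpint.
Qed.

Lemma upart_interval k n : cong k.+1 (\prod_(n <= i < n + p ^ k.+1) upart i) (-1).
Proof.
have q0 : (0 < p ^ k.+1)%N by rewrite expn_gt0 prime_gt0.
elim: n => [|n IH]; first by rewrite add0n big_mkord; apply: wilson_pow.
set B := \prod_(n.+1 <= i < n.+1 + p ^ k.+1) upart i.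
have e : upart n * B = (\prod_(n <= i < n + p ^ k.+1) upart i) * upart (n + p ^ k.+1).
  rewrite /B addSn -[in LHS]big_ltn; last by rewrite ltnS leq_addr.
  by rewrite big_nat_recr //= leq_addr.
have h1 : cong k.+1 (upart (n + p ^ k.+1)) (upart n).
  by apply: upart_cong => //; rewrite modnDr.
have h := congM _ _ IH h1; rewrite -e in h.
have hu := pint_unitV (pabs_upart n).
have := congMl hu (h _ (pint_upart n)).
rewrite mulKf ?(pabs_unit_neq0 (pabs_upart n)) // => h2.
apply: cong_trans (h2 _) _; first by inpint.
by rewrite mulrCA mulVf ?(pabs_unit_neq0 (pabs_upart n)) // mulr1; apply: cong_refl.
Qed.

Lemma Mg_unit n : pabs (Mg n) = 1.
Proof.
rewrite MgE pabsM pabs_sign mul1r; elim/big_ind: _ => //.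
- exact: pabs1.
- by move=> x y hx hy; rewrite pabsM hx hy mulr1.
- by move=> i _; apply: pabs_upart.
Qed.

(** The added factors multiply to -1 by Wilson, which cancels the sign (-1)^(p^(k+1)). This is the
    source of the continuity of Gamma_p. *)
Lemma Mg_shift k n : (0 < n)%N -> cong k.+1 (Mg (n + p ^ k.+1)) (Mg n).
Proof.
move=> n0; rewrite !MgE (@big_cat_nat _ _ _ n) //= ?leq_addr // exprD.
have -> : (-1) ^+ (p ^ k.+1) = -1 :> K.
  elim: k => [|k IH]; first by rewrite expn1 (sign_p p_pr).
  by rewrite expnSr exprM IH (sign_p p_pr).
have hB := upart_interval k n.
have hP : (-1) ^+ n * \prod_(1 <= i < n) upart i * -1 \in (pint : {pred K}).
  by rewrite -MgE rpredM ?rpredN ?rpred1 // pabs_unit_pint // Mg_unit.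
have := congMl hP hB; set A := \prod_(1 <= i < n) _; set B := \prod_(n <= i < _) _.
by move=> h; apply: cong_trans (cong_trans (cong_eq _ _) h) (cong_eq _ _); ring.
Qed.

Lemma Mg_cong k m n : (0 < m)%N -> (0 < n)%N -> m = n %[mod p ^ k] -> cong k (Mg m) (Mg n).
Proof.
case: k => [|k] m0 n0.
  move=> _; exists (Mg m - Mg n); last by rewrite expr0 mul1r subrKC.
  by rewrite rpredB ?pabs_unit_pint ?Mg_unit.
wlog le : m n m0 n0 / (n <= m)%N => [hw e|/eqP].
  case/orP: (leq_total n m) => h; first exact: hw.
  by apply: cong_sym; apply: hw.
rewrite eqn_mod_dvd // => /dvdnP[d hd].
have -> : m = (n + d * p ^ k.+1)%N by rewrite -hd subnKC.
elim: d {hd} => [|d IH]; first by rewrite mul0n addn0; apply: cong_refl.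
rewrite mulSnr addnA; apply: cong_trans IH.
by apply: Mg_shift; rewrite addn_gt0 n0.
Qed.

Lemma cong_nat_dvd k d : cong k (d%:R : K) 0 -> (p ^ k %| d)%N.
Proof.
elim: k => [|k IH] h; first by rewrite dvd1n.
have /dvdnP[m em] := IH (cong_le (leqnSn k) h).
case: h => z hz; rewrite em natrM natrX add0r exprSr => e.
have : m%:R = pK * z.
  apply: (mulIf (expf_neq0 k (pK_neq0 (K := K) p_pr))); rewrite e; ring.
move=> em2; rewrite expnS dvdn_pmul2r ?expn_gt0 ?prime_gt0 //.
apply/negPn/negP => hm; have : pabs (m%:R : K) = 1.
  by rewrite pabs_nat_unit // prime_coprime.
have hz1 : pabs z <= 1 by [].
have : cong 1 (m%:R : K) 0 by rewrite em2; apply: cong0_pM.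
move/(cong_pabs p_pr); rewrite subr0 expr1 => h1 h2.
by move: h1; rewrite h2 leNgt invf_lt1 ?pR_gt0 ?pR_gt1.
Qed.

Lemma cong_nat_mod k m n : cong k (m%:R : K) n%:R -> m = n %[mod p ^ k].
Proof.
wlog le : m n / (n <= m)%N => [hw e|h].
  case/orP: (leq_total n m) => h; first exact: hw.
  by apply/esym/hw => //; apply: cong_sym.
apply/eqP; rewrite eqn_mod_dvd //; apply: cong_nat_dvd.
by rewrite natrB //; have := congB h (cong_refl k n%:R); rewrite subrr.
Qed.

Lemma rho_approx a k : (0 < a)%N ->
  exists2 n, (0 < n)%N & cong k (n%:R : K) (rho a).
Proof.
move=> a0; pose q := (p ^ k.+1)%N.
have p1 := prime_gt1 p_pr.
have q1 : (1 < q)%N by rewrite /q -{1}(expn0 p) ltn_exp2l.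
have /dvdnP[g hg] : (p.-1 %| q.-1)%N by rewrite /q predn_exp dvdn_mulr.
(* Since g = (q-1)/(p-1), this integer is (q-1)^2 a/(p-1), and (q-1)^2 = 1 modulo q. *)
exists (q.-1 * a * g)%N; first by rewrite !muln_gt0 a0 andbT; nia.
apply: (cong_le (leqnSn k)).
have n0 : p.-1%:R != 0 :> K by rewrite (natK_neq0 p_pr) //; lia.
exists ((pK ^+ k.+1 - 2%:R) * rho a).
  by rewrite rpredM ?pint_rho //; inpint.
have eq1 : (q.-1%:R : K) = pK ^+ k.+1 - 1 by rewrite -subn1 natrB ?(ltnW q1) // /q natrX.
have eg : (g%:R : K) = (pK ^+ k.+1 - 1) / p.-1%:R.
  by apply: canRL (mulfK n0) _; rewrite -natrM -hg.
rewrite !natrM eq1 eg /rho; move: (pK ^+ k.+1) (p.-1%:R) n0 => A B n0.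
by field.
Qed.

(** Positive integers tending to x produce a limit, so [xget] selects from a nonempty set; the
    selected value is then compared with [Mg] at a positive integer close to x. *)
Lemma morita_gamma_spec x : (forall k, exists2 n, (0 < n)%N & cong k (n%:R : K) x) ->
  Qp (morita_gamma x) /\
  forall n, (0 < n)%N -> cong 1 (n%:R : K) x -> cong 1 (morita_gamma x) (Mg n).
Proof.
move=> happ.
have [u hu] := choice (fun k => let: ex_intro2 n n0 hn := happ k in ex_intro _ n (conj n0 hn)).
have hmod m n : cong m (n%:R : K) x -> n = u m %[mod p ^ m].
  by move=> h; apply: cong_nat_mod; apply: cong_trans h (cong_sym (hu m).2).
have [m|l hl] := @cong_limit _ _ _ p_pr (fun m => Mg (u m)).
  apply: Mg_cong; rewrite ?(hu _).1 //; apply: hmod.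
  exact: cong_le (leqnSn m) (hu m.+1).2.
have spec_l : [set y : K | forall e : R, 0 < e -> exists2 d : R, 0 < d &
    forall n : nat, (0 < n)%N -> pabs (n%:R - x) < d -> pabs (morita_gamma_nat n - y) < e] l.
  move=> e e0; have [N hN] := cong_lt p_pr (K := K) e0.
  exists (p%:R ^- N) => [|n n0 hn]; first by rewrite invr_gt0 exprn_gt0 ?pR_gt0.
  apply: hN; apply: cong_trans _ (cong_sym (hl N)).
  apply: Mg_cong; rewrite ?(hu _).1 //; apply: hmod.
  by apply/(cong_pabs p_pr); apply: ltW.
rewrite /morita_gamma; case: xgetP => [y _ /= hy|h]; last by case: (h l).
have app (e : R) k : 0 < e -> exists m, [/\ (0 < m)%N, cong k (m%:R : K) x & pabs (Mg m - y) < e].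
  move=> e0; have [d d0 hd] := hy e e0; have [N hN] := cong_lt p_pr (K := K) d0.
  exists (u (maxn N k)); have [h1 h2] := hu (maxn N k).
  split=> //; first by apply: cong_le h2; rewrite leq_maxr.
  by apply: hd => //; apply: hN; apply: cong_le h2; rewrite leq_maxl.
split=> [e e0|n n0 hn].
  have [m [_ _ hm] ] := app e 0%N e0.
  have Qm : Qp (Mg m).
    rewrite MgE; apply: QpM => //.
      by apply: QpX => //; apply: QpN => //; apply: (Qp_nat 1).
    by apply: Qp_prod => // i _; rewrite /upart; case: ifP => _; [apply: (Qp_nat 1)|apply: Qp_nat].
  have [z hz1 hz2] := Qm e e0; exists z => //.
  by apply: pabs_ltr_dist _ hz2; rewrite pabs_distC.
have e0 : 0 < p%:R ^- 1 :> R by rewrite invr_gt0 exprn_gt0 ?pR_gt0.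
have [m [m0 hm1 hm2] ] := app _ 1%N e0.
apply: (@cong_trans _ _ _ _ (Mg m)).
  by apply: cong_sym; apply/(cong_pabs p_pr); apply: ltW.
apply: Mg_cong => //; apply: cong_nat_mod; exact: cong_trans hm1 (cong_sym hn).
Qed.

(** As rho a = p - a modulo p, the value is that of Gamma_p(p - a) = (-1)^(p-a) (p-1-a)! modulo p,
    and Wilson's theorem turns this into 1/a!. *)
Lemma morita_gamma_rho a : (0 < a < p)%N ->
  Qp (morita_gamma (rho a)) /\ cong 1 (morita_gamma (rho a)) (a`!%:R)^-1.
Proof.
move=> /andP[a0 ap].
have [hQ h] := morita_gamma_spec (fun k => rho_approx k a0).
split=> //; have hn : cong 1 ((p - a)%N%:R : K) (rho a).
  exists (1 - rho a); first by rewrite rpredB ?rpred1 ?pint_rho.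
  by rewrite natrB ?(ltnW ap) // expr1 {1}[rho a](rhoE p_pr a); ring.
have pa : (0 < p - a)%N by rewrite subn_gt0.
apply: cong_trans (h _ pa hn) _.
have hf := @pint_factV _ _ K p_pr a ap.
have eM : Mg (p - a) = (-1) ^+ (p - a) * (p.-1 - a)`!%:R.
  rewrite MgE; congr (_ * _).
  have -> : (p.-1 - a = (p - a).-1)%N by lia.
  have : (p - a <= p)%N by rewrite leq_subr.
  elim: (p - a)%N pa => // m IH _ mp; rewrite /=; case: m IH mp => [|m] IH mp; first by rewrite big_geq.
  by rewrite big_nat_recr //= IH ?(ltnW mp) // /upart gtnNdvd // factS natrM mulrC.
have e : Mg (p - a) = (-1) ^+ p * ((-1) ^+ a * (a`!%:R * (p.-1 - a)`!%:R)) / a`!%:R.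
  rewrite eM; have -> : (-1) ^+ p = (-1) ^+ (p - a) * (-1) ^+ a :> K by rewrite -exprD subnK // ltnW.
  have f0 := factK_neq0 (K := K) p_pr a; have := sqrr_sign K a.
  move: ((-1) ^+ a) ((-1) ^+ (p - a)) => s t s2.
  transitivity (s ^+ 2 * t * (p.-1 - a)`!%:R); first by rewrite s2 mul1r.
  by field.
rewrite e -[X in cong _ _ X]mul1r; apply: congMr => //.
have ha := pint_harm (K := K) p_pr ap.
apply: cong_trans (congMl _ (cong_le (isT : (1 <= 2)%N) (fact_refl_cong p_pr ap))) _; first by inpint.
have h1 : cong 1 (1 + pK * @harm R p K a) 1 by apply: cong_p.
rewrite sign_p //; apply: cong_trans (congMl _ (congM _ _ (wilson_cong) h1)) _; try by inpint.
by apply: cong_eq; ring.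
Qed.

End MoritaGamma.

(** * The whole datum: coefficients, polynomial and sums *)

Section Datum.
Context {R : realType} {p : nat} {K : padicComplexType R p}.
Hypothesis (p_pr : prime p) (p_odd : (2 < p)%N).
Variables (n : nat) (a b : 'I_n -> nat).
Hypothesis n_ge2 : (1 < n)%N.
Hypothesis a_gt0 : forall i, (0 < a i)%N.
Hypothesis a_lt : forall i, (a i < p.-1)%N.
Hypothesis a_mono : forall i j : 'I_n, (i <= j)%N -> (a i <= a j)%N.
Hypothesis b_le : forall i, (b i <= p.-1)%N.
Hypothesis b_last : forall i : 'I_n, (n.-2 <= i)%N -> b i = p.-1.
Hypothesis interlace : forall i j : 'I_n, j = i.+2 :> nat -> (a j < b i)%N.
Implicit Types (k c : nat) (y : K).

Local Notation pK := (p%:R : K).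
Local Notation pcoef := (@pair_coef R p K).
Local Notation ppoly := (@pair_poly R p K).

(** Indices start at 0, so [a i1] is the second smallest of the a_i. *)
Let i1 : 'I_n := Ordinal n_ge2.

(** The bound passes through a_{i+2} by interlacing; for the last two indices b_i = p - 1 takes
    over. *)
Lemma lt_b_of_above (i : 'I_n) m : (m < p.-1)%N ->
  (forall j : 'I_n, j = i.+2 :> nat -> (m <= a j)%N) -> (m < b i)%N.
Proof.
move=> mp h; case: (leqP n.-2 i) => hi; first by rewrite b_last.
have hj : (i.+2 < n)%N by lia.
exact: leq_ltn_trans (h (Ordinal hj) erefl) (interlace (j := Ordinal hj) erefl).
Qed.

Lemma a_lt_b i : (a i < b i)%N.
Proof. by apply: lt_b_of_above => // j hj; apply: a_mono; rewrite hj; lia. Qed.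

Lemma b_lt i : (b i < p)%N.
Proof. by have := b_le i; have := prime_gt0 p_pr; lia. Qed.

Lemma lt_b_low k i : (k <= a i1)%N -> (k < b i)%N.
Proof.
move=> hk; apply: lt_b_of_above => [|j hj]; first exact: leq_ltn_trans hk (a_lt i1).
by apply: leq_trans hk (a_mono _); rewrite hj.
Qed.

(* Past the second smallest a_i the coefficients are divisible by p^2, and so is
   the contribution of the derivative of the polynomial: it has a double root there. *)
Lemma two_pairs k : (a i1 < k)%N -> (k < p)%N -> exists i j : 'I_n,
  [/\ i != j, (a i < k)%N, (a j < k)%N & (k <= b i)%N && (k <= b j)%N /\
   ((k < p.-1)%N -> (k < b i)%N && (k < b j)%N)].
Proof.
move=> hk kp.
(* The largest index m with a_m < k and its predecessor will do: a_{m+1} and a_{m+2}, where they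
   exist, are at least k, which bounds b_{m-1} and b_m from below. *)
have [m am hm] := @arg_maxnP 'I_n i1 (fun i => (a i < k)%N) (fun i => i : nat) hk.
have m0 : (0 < m)%N by apply: leq_trans (hm i1 hk).
have hm1 : (m.-1 < n)%N by have := ltn_ord m; lia.
have above (j : 'I_n) : (m < j)%N -> (k <= a j)%N.
  by move=> mj; rewrite leqNgt; apply/negP => /hm /=; rewrite leqNgt mj.
exists m, (Ordinal hm1); split.
- by rewrite -val_eqE /=; lia.
- exact: am.
- by apply: leq_ltn_trans am; apply: a_mono; rewrite /= leq_pred.
- have hlt : (k < p.-1)%N -> (k < b m)%N && (k < b (Ordinal hm1))%N.
    move=> kp1; apply/andP; split; apply: lt_b_of_above => // j /= hj; apply: above; rewrite hj; lia.
  split; last exact: hlt.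
  case: (leqP p.-1 k) => [kp1|/hlt/andP[h1 h2] ]; last by rewrite (ltnW h1) (ltnW h2).
  (* At k = p - 1 every a_j is below k, so m is the last index and both b equal k: only the weak
     inequality remains. *)
  have ek : k = p.-1 by lia.
  have hb (i : 'I_n) : (m.-1 <= i)%N -> (k <= b i)%N.
    move=> mi; case: (leqP n.-2 i) => hi; first by rewrite b_last // ek.
    have hj : (m.+1 < n)%N by lia.
    by have := above (Ordinal hj) (ltnSn _); have := a_lt (Ordinal hj); lia.
  by rewrite !hb //= leq_pred.
Qed.

Definition coef k : K := \prod_i pcoef (a i) (b i) k.

Definition datum_poly : {poly K} := \prod_i ppoly (a i) (b i).

Let P := datum_poly.

Lemma pint_pcoef i k : (k <= p)%N -> pcoef (a i) (b i) k \in pint.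
Proof. by move=> kp; apply: pint_pair_coef; rewrite ?a_lt_b ?b_lt. Qed.

Lemma pint_coef k : (k <= p)%N -> coef k \in pint.
Proof. by move=> kp; apply: rpred_prod => i _; apply: pint_pcoef. Qed.

Lemma ppoly_over i : ppoly (a i) (b i) \is a polyOver pint.
Proof. by apply: pair_poly_over => //; apply: b_lt. Qed.

Lemma datum_poly_over : P \is a polyOver pint.
Proof. by apply: rpred_prod => i _; apply: ppoly_over. Qed.

Lemma pint_horner (f : {poly K}) m : f \is a polyOver pint -> f.[m%:R] \in pint.
Proof. by move=> hf; apply: rpred_horner => //; apply: rpred_nat. Qed.

(** The product rule to first order. The induction also carries the congruence of the coefficients
    with the polynomial values, because the cross terms multiply a coefficient by a derivative. *)
Lemma prod_cong_deriv k y (v : 'I_n -> K) : (k <= a i1)%N -> y \in pint ->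
  (forall i, cong 2 (v i)
     (pcoef (a i) (b i) k + pK * (y * ((ppoly (a i) (b i))^`()).[k%:R]))) ->
  cong 2 (\prod_i v i) (coef k + pK * (y * (P^`()).[k%:R])).
Proof.
move=> hk hy hv.
have kp : (k <= p)%N by have := a_lt i1; lia.
suff [] : [/\ P \is a polyOver pint, cong 1 (coef k) P.[k%:R] &
  cong 2 (\prod_i v i) (coef k + pK * (y * (P^`()).[k%:R]))] by [].
rewrite /P /datum_poly /coef.
apply: (big_ind3 (fun (w u : K) (Q : {poly K}) => [/\ Q \is a polyOver pint, cong 1 u Q.[k%:R] &
  cong 2 w (u + pK * (y * (Q^`()).[k%:R]))])).
- split; rewrite ?rpred1 // ?hornerC; first exact: cong_refl.
  by rewrite derivC hornerC !mulr0 addr0; apply: cong_refl.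
- move=> w1 u1 Q1 w2 u2 Q2 [h1 h2 h3] [h4 h5 h6].
  have i1' := pint_horner k h1; have i2 := pint_horner k h4.
  have d1 : (Q1^`()).[k%:R] \in pint by apply: pint_horner; apply: polyOver_deriv.
  have d2 : (Q2^`()).[k%:R] \in pint by apply: pint_horner; apply: polyOver_deriv.
  have p1 := cong_pint h2 i1'; have p2 := cong_pint h5 i2.
  split; first by rewrite rpredM.
    by rewrite hornerM; apply: congM.
  apply: cong_trans (congM _ _ h3 h6) _; try by inpint.
  rewrite derivM hornerD !hornerM.
  case: h2 h5 => z1 hz1 -> [z2 hz2 ->]; rewrite expr1.
  exists (y * (Q1^`()).[k%:R] * z2 + y * (Q2^`()).[k%:R] * z1
          + y ^+ 2 * ((Q1^`()).[k%:R] * (Q2^`()).[k%:R])); first by inpint.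
  ring.
- move=> i _; split; [exact: ppoly_over| |exact: hv].
  by apply: pair_coef_poly; rewrite ?a_lt_b ?b_lt // ltnW ?lt_b_low.
Qed.

Lemma prod_cong0 (v : 'I_n -> K) i j : i != j -> (forall l, v l \in pint) ->
  cong 1 (v i) 0 -> cong 1 (v j) 0 -> cong 2 (\prod_l v l) 0.
Proof.
move=> ij hv [x hx ex] [z hz ez].
rewrite (bigD1 i) //= (bigD1 j) 1?eq_sym //= ex ez !add0r expr1.
exists (x * z * \prod_(l | (l != i) && (l != j)) v l); first by inpint.
by rewrite add0r; ring.
Qed.

Lemma datum_poly_high k : (a i1 < k)%N -> (k < p)%N ->
  P.[k%:R] = 0 /\ (P^`()).[k%:R] = 0.
Proof.
move=> hk kp; have [i [j [ij hi hj [/andP[bi bj] _] ] ] ] := two_pairs hk kp.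
have z1 := (pair_poly_high (K := K) p_pr hi bi).1.
have z2 := (pair_poly_high (K := K) p_pr hj bj).1.
rewrite /P /datum_poly (bigD1 i) //= (bigD1 j) 1?eq_sym //=.
rewrite !derivM !(hornerM, hornerD) z1 z2; split; ring.
Qed.

Lemma coef_high k : (a i1 < k)%N -> (k < p)%N -> cong 2 (coef k) 0.
Proof.
move=> hk kp; have [i [j [ij hi hj [/andP[bi bj] _] ] ] ] := two_pairs hk kp.
apply: (prod_cong0 ij) => [l||]; first by apply: pint_pcoef; apply: ltnW.
  rewrite -(pair_poly_high (K := K) p_pr hi bi).1.
  by apply: pair_coef_poly => //; rewrite ?a_lt_b ?b_lt.
rewrite -(pair_poly_high (K := K) p_pr hj bj).1.
by apply: pair_coef_poly => //; rewrite ?a_lt_b ?b_lt.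
Qed.

Lemma coef_poly k : (k < p)%N -> cong 1 (coef k) P.[k%:R].
Proof.
move=> kp; case: (leqP k (a i1)) => hk.
  rewrite /P /datum_poly horner_prod; apply: cong_prod => i _.
    by apply: pint_horner; apply: ppoly_over.
  by apply: pair_coef_poly; rewrite ?a_lt_b ?b_lt // ltnW ?lt_b_low.
by rewrite (datum_poly_high hk kp).1; apply: cong_le (coef_high hk kp).
Qed.

(** The sign is the value of the character at (-1)^n, distributed over the n factors. *)
Definition jac_term k : K :=
  \prod_i ((-1) ^+ k * (jac_pair (a i) (b i) k / jac_pair (a i) (b i) 0)).

Lemma jac_term_cong k : (k < p.-1)%N ->
  cong 2 (jac_term k) (coef k + pK * (k%:R * (P^`()).[k%:R])).
Proof.
move=> kp; case: (leqP k (a i1)) => hk.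
  apply: prod_cong_deriv => //; first exact: rpred_nat.
  by move=> i; apply: jac_pair_cong; rewrite ?a_lt_b ?b_lt ?lt_b_low.
have kp' : (k < p)%N by lia.
have [i [j [ij hi hj [_ /(_ kp) /andP[bi bj] ] ] ] ] := two_pairs hk kp'.
rewrite (datum_poly_high hk kp').2 !mulr0 addr0.
apply: cong_trans _ (cong_sym (coef_high hk kp')).
apply: (prod_cong0 ij) => [l||].
- rewrite rpredM ?rpredX ?rpredN ?rpred1 //.
  by apply: pint_jac_pair; rewrite ?a_lt_b ?b_lt.
- rewrite -[X in cong _ _ X](mulr0 ((-1) ^+ k)); apply: congMl.
    by rewrite rpredX ?rpredN ?rpred1.
  by apply: jac_pair_cong0; rewrite ?a_lt_b ?b_lt.
- rewrite -[X in cong _ _ X](mulr0 ((-1) ^+ k)); apply: congMl.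
    by rewrite rpredX ?rpredN ?rpred1.
  by apply: jac_pair_cong0; rewrite ?a_lt_b ?b_lt.
Qed.

Lemma coef_dwork k c : (k < p)%N -> (c < p)%N ->
  cong 2 (coef (p * k + c)) (coef k * (coef c + pK * (k%:R * (P^`()).[c%:R]))).
Proof.
move=> kp cp; have hk := pint_coef (ltnW kp).
have over := datum_poly_over.
case: (leqP c (a i1)) => hc.
  pose v i : K := pcoef (a i) (b i) c + pK * (k%:R * ((ppoly (a i) (b i))^`()).[c%:R]).
  apply: (@cong_trans _ _ _ _ (coef k * \prod_i v i)).
    rewrite -big_split /=; apply: cong_prod => i _.
      rewrite rpredM ?pint_pcoef ?(ltnW kp) // /v.
      have h1 := pint_pcoef i (ltnW cp).
      have h2 : ((ppoly (a i) (b i))^`()).[c%:R] \in pint.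
        by apply: pint_horner; apply: polyOver_deriv; apply: ppoly_over.
      by inpint.
    by apply: pair_coefD_cong; rewrite ?a_lt_b ?b_lt ?(ltnW kp) // ltnW ?lt_b_low.
  by apply: congMl => //; apply: prod_cong_deriv => //; exact: rpred_nat.
rewrite (datum_poly_high hc cp).2 !mulr0 addr0.
apply: (@cong_trans _ _ _ _ 0); last first.
  by rewrite -(mulr0 (coef k)); apply: congMl => //; apply: cong_sym; apply: coef_high.
have [i [j [ij hi hj [/andP[bi bj] _] ] ] ] := two_pairs hc cp.
apply: (prod_cong0 ij) => [l||].
- by apply: pint_pair_coefD; rewrite ?a_lt_b ?b_lt.
- by apply: pair_coefD_cong0; rewrite ?a_lt_b ?b_lt ?(ltnW kp).
- by apply: pair_coefD_cong0; rewrite ?a_lt_b ?b_lt ?(ltnW kp).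
Qed.

Definition datum_const : K := \prod_i pair_const (a i) (b i).

Definition datum_deg : nat := \sum_i (b i - a i)%N.

Lemma pair_poly_monic (c d : nat) : (c <= d)%N ->
  exists2 M : {poly K}, M \is monic /\ size M = (d - c).+1 &
  ppoly c d = (pair_const c d * (-1) ^+ (d - c)) *: M.
Proof.
move=> cd; exists (\prod_(c.+1 <= m < d.+1) ('X - (m%:R)%:P)).
  split; first by apply: monic_prod => i _; apply: monicXsubC.
  by rewrite size_prod_XsubC size_iota subSS.
rewrite /pair_poly -scalerA; congr (_ *: _).
have -> : (d - c = d.+1 - c.+1)%N by rewrite subSS.
have e : \prod_(c.+1 <= m < d.+1) ((-1 : K) *: ('X - (m%:R)%:P)) =
   (-1) ^+ (d.+1 - c.+1) *: \prod_(c.+1 <= m < d.+1) ('X - (m%:R)%:P).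
  by rewrite scaler_prod prodr_const_nat.
by rewrite -e; apply: eq_bigr => m _; rewrite scaleN1r opprB.
Qed.

Lemma datum_poly_monic : exists2 M : {poly K}, M \is monic /\ size M = datum_deg.+1 &
  P = (datum_const * (-1) ^+ datum_deg) *: M.
Proof.
rewrite /P /datum_poly /datum_const /datum_deg.
apply: (big_ind3 (fun (Q : {poly K}) (c : K) (d : nat) => exists2 M : {poly K},
   M \is monic /\ size M = d.+1 & Q = (c * (-1) ^+ d) *: M)).
- exists 1; first by rewrite monic1 size_poly1.
  by rewrite expr0 mulr1 scale1r.
- move=> Q1 c1 d1 Q2 c2 d2 [M1 [h1 h2] ->] [M2 [h3 h4] ->].
  exists (M1 * M2).
    split; first by rewrite monicMl.
    by rewrite size_monicM ?monic_neq0 // h2 h4 addnS.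
  by rewrite -scalerAl -scalerAr scalerA exprD; congr (_ *: _); ring.
- by move=> i _; apply: pair_poly_monic; apply: ltnW; apply: a_lt_b.
Qed.

Hypothesis deg_le : (datum_deg <= 2 * p.-1)%N.

Lemma size_datum_poly : (size P <= (p + p).-1)%N.
Proof.
have [M [_ sM] ->] := datum_poly_monic.
by apply: leq_trans (size_scale_leq _ _) _; rewrite sM; lia.
Qed.

Lemma datum_poly_top : P`_(p + p).-2 = (datum_deg == 2 * p.-1)%N%:R * datum_const.
Proof.
have [M [monM sM] ->] := datum_poly_monic.
rewrite coefZ; have -> : (p + p).-2 = (2 * p.-1)%N by lia.
case: eqP => [e|ne].
  have -> : M`_(2 * p.-1) = 1 by rewrite -e -[datum_deg]/(datum_deg.+1.-1) -sM -lead_coefE (monicP monM).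
  by rewrite e exprM sqrrN !expr1n !mulr1 mul1r.
by rewrite nth_default ?mulr0 ?mul0r // sM; lia.
Qed.

Definition trunc_sum m : K := \sum_(k < m) coef k.

Lemma pint_trunc_sum : trunc_sum p \in pint.
Proof. by apply: rpred_sum => k _; apply: pint_coef; apply: ltnW. Qed.

Lemma trunc_sum_dwork : cong 2 (trunc_sum (p * p)) (trunc_sum p * trunc_sum p).
Proof.
rewrite {1}/trunc_sum big_ord_block.
have hd : cong 1 (\sum_(c < p) (P^`()).[c%:R]) 0.
  have hs := size_datum_poly.
  apply: cong_trans (deriv_sum_cong p_pr p_odd datum_poly_over _) _; first by lia.
  (* P has degree at most 2(p-1), one less than the degree of the extracted coefficient. *)
  by rewrite nth_default ?cong_refl //; apply: cong_refl.
apply: (@cong_trans _ _ _ _ (\sum_(k < p) coef k * (trunc_sum p +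
    pK * (k%:R * (\sum_(c < p) (P^`()).[c%:R]))))).
  apply: cong_sum => k _; rewrite /trunc_sum !mulr_sumr -big_split /= mulr_sumr.
  by apply: cong_sum => c _; rewrite mulnC addnC; apply: coef_dwork.
rewrite {2}/trunc_sum mulr_suml; apply: cong_sum => k _; apply: congMl.
  by apply: pint_coef; apply: ltnW.
rewrite -[X in cong _ _ X]addr0; apply: congD; first exact: cong_refl.
have hk : k%:R \in (pint : {pred K}) by apply: rpred_nat.
by have := cong1_pM (congMl hk hd); rewrite !mulr0.
Qed.

Lemma jac_sum_cong :
  cong 2 ((1 - pK)^-1 * \sum_(k < p.-1) jac_term k) (trunc_sum p + pK * P`_(p + p).-2).
Proof.
have over := datum_poly_over; have hF := pint_trunc_sum.
have hL : P`_(p + p).-2 \in pint by move/polyOverP: over.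
rewrite mulrC; apply: cong_divl => //.
- apply: (cong_abs_unit p_pr (y := 1)); rewrite ?pabs1 // -mulrN1.
  by apply: cong_p; rewrite rpredN rpred1.
- by inpint.
have hd k : (P^`()).[k%:R] \in pint by apply: pint_horner; apply: polyOver_deriv.
have p1 : p.-1.+1 = p by rewrite prednK ?prime_gt0.
(* There are p - 1 characters but p terms in the truncation; the term k = p - 1 is 0 modulo p^2 and
   can be added. *)
have last0 : cong 2 (coef p.-1 + pK * (p.-1%:R * (P^`()).[p.-1%:R])) 0.
  have h1 := a_lt i1; have h2 : (p.-1 < p)%N by lia.
  by rewrite (datum_poly_high h1 h2).2 !mulr0 addr0; apply: coef_high.
have e1 : cong 2 (\sum_(k < p.-1) jac_term k)
    (trunc_sum p + pK * \sum_(k < p) (k%:R * (P^`()).[k%:R])).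
  rewrite /trunc_sum mulr_sumr -big_split /=.
  pose F k := coef k + pK * (k%:R * (P^`()).[k%:R]).
  have -> : \sum_(k < p) F k = \sum_(k < p.-1) F k + F p.-1.
    transitivity (\sum_(k < p.-1.+1) F k); first by rewrite p1.
    by rewrite big_ord_recr.
  rewrite -[X in cong _ X _]addr0.
  apply: congD; last exact: cong_sym.
  by apply: cong_sum => k _; apply: jac_term_cong.
apply: cong_trans e1 _.
have hXP : P * 'X \is a polyOver pint by rewrite rpredM ?polyOverX.
have sXP : (size (P * 'X)%R <= p + p)%N.
  have [->|P0] := eqVneq P 0; first by rewrite mul0r size_poly0.
  by rewrite size_mulX //; have := size_datum_poly; lia.
have h := deriv_sum_cong p_pr p_odd hXP sXP.
rewrite coefMX in h.
have pp : (p + p).-1 == 0%N = false by lia.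
rewrite pp in h.
have hs : \sum_(k < p) ((P * 'X)^`()).[k%:R] =
   \sum_(k < p) P.[k%:R] + \sum_(k < p) (k%:R * (P^`()).[k%:R]).
  rewrite -big_split /=; apply: eq_bigr => k _.
  rewrite derivM derivX !(hornerM, hornerD, hornerX, hornerC); ring.
rewrite hs in h.
(* By (X P)' = P + X P', the sum of k P'(k) is the coefficient of degree 2(p-1) minus the sum of
   P(k), and the latter is the truncation modulo p. *)
have hFP : cong 1 (trunc_sum p) (\sum_(k < p) P.[k%:R]).
  by apply: cong_sum => k _; apply: coef_poly.
have h2 := congB h (cong_sym hFP); rewrite addrAC subrr add0r in h2.
apply: cong_trans (congD (cong_refl 2 _) (cong1_pM h2)) _.
(* With L this coefficient and F the truncation, F + p (L - F) and (1 - p)(F + p L) differ by p^2 L;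
   the prefactor 1/(1-p) of H_p is thus compensated. *)
exists (P`_(p + p).-2); first by [].
ring.
Qed.

End Datum.

(** * Translating the hypergeometric sums into the integers a_i and b_i *)

Section CharacterDictionary.
Context {R : realType} {p : nat} {K : padicComplexType R p}.
Hypothesis (p_pr : prime p) (p_odd : (2 < p)%N).
Implicit Types (a b k : nat).

Local Notation om := (teichmuller : 'F_p -> K).
Local Notation ch := (@ch R p K).
Local Notation rho := (@rho R p K).

Lemma mulc_ch i j : mulc (ch i) (ch j) = ch (i + j).
Proof. by apply/funext => x; rewrite /mulc chD. Qed.

Lemma om_expV m x : (m <= p.-1)%N -> x != 0 -> (om x ^+ m)^-1 = om x ^+ (p.-1 - m).
Proof.
move=> mp x0; have n0 : om x ^+ m != 0 by rewrite expf_neq0 // om_neq0.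
by apply: (mulfI n0); rewrite mulfV // -exprD subnKC // om_exp.
Qed.

Lemma conj_ch m : (m <= p.-1)%N -> conj_character (ch m) = ch (p.-1 - m).
Proof.
move=> mp; apply/funext => x; rewrite /conj_character !chE.
by case: eqP => [_|/eqP x0]; rewrite ?invr0 // om_expV.
Qed.

Lemma omega_bar_powE (x : rat) a : p.-1%:R * x = a%:R -> (0 < a <= p.-1)%N ->
  omega_bar_pow x = ch (p.-1 - a).
Proof.
move=> e /andP[a0 ap]; apply/funext => y.
rewrite /omega_bar_pow e natrK /conj_character !chE.
case: eqP => [->|/eqP y0]; last by rewrite exprVn om_expV.
by rewrite om0 invr0 expr0n gtn_eqF.
Qed.

(** For every k the two exponents add up to 2(p-1) + b - a, so numerator and denominator split off
    the same Gauss sum. It is nonzero because 0 < b - a < p - 1, and cancels. *)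
Lemma gauss_ratio zeta a b k (x y : rat) : p.-primitive_root zeta ->
  p.-1%:R * x = a%:R -> p.-1%:R * y = b%:R ->
  (0 < a)%N -> (a < b)%N -> (b <= p.-1)%N -> (k < p.-1)%N ->
  (gauss_sum zeta (mulc (omega_bar_pow x) (ch k)) *
   gauss_sum zeta (mulc (conj_character (omega_bar_pow y)) (conj_character (ch k)))) /
  (gauss_sum zeta (omega_bar_pow x) * gauss_sum zeta (conj_character (omega_bar_pow y))) =
  jac_pair a b k / jac_pair a b 0 :> K.
Proof.
move=> hz ex ey a0 ab bp kp.
rewrite (omega_bar_powE ex) ?(omega_bar_powE ey); try lia.
rewrite !conj_ch ?leq_subr ?(ltnW kp) // !mulc_ch subKn //.
have eb : (b + (p.-1 - k) = p.-1 + b - k)%N by lia.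
rewrite eb.
have -> : gauss_sum zeta (ch b) = gauss_sum zeta (ch (p.-1 + b - 0)).
  by congr gauss_sum; apply/funext => z; rewrite subn0 ch_period.
rewrite -{2}[(p.-1 - a)%N]addn0.
have hd l : (l <= p.-1)%N -> ((p.-1 - a + l) + (p.-1 + b - l) = 2 * p.-1 + (b - a))%N by lia.
have hnd : ~~ (p.-1 %| 2 * p.-1 + (b - a))%N.
  by rewrite dvdn_addr ?dvdn_mull // gtnNdvd //; lia.
rewrite !(gauss_mul p_pr hz) ?hd //; try lia.
rewrite -!/(jac_pair a b _).
have g0 := gauss_neq0 p_pr hz hnd.
by rewrite -mulf_div divff // mulr1.
Qed.

Lemma residueE (x : K) (z : 'F_p) : Qp x -> cong 1 x (z : nat)%:R -> residue x = z.
Proof.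
move=> hQ h; rewrite /residue; case: xgetP => [y _ /= /(padic_eqmodE p_pr)[_ hy]|hn]; last first.
  by case: (hn z); apply/(padic_eqmodE p_pr); split=> //; apply: QpB => //; apply: Qp_nat.
have := cong_nat_mod p_pr (cong_trans (cong_sym hy) h).
by rewrite expn1 !modn_small ?Fp_ltn // => /val_inj.
Qed.

Lemma residue_sign m : residue ((-1) ^+ m * 1 : K) = (-1) ^+ m.
Proof.
have e : (-1) ^+ m * 1 = om ((-1) ^+ m) by rewrite omX // omN1 // mulr1.
by apply: residueE; rewrite e; [apply: Qp_om|apply: om_cong].
Qed.

Lemma Hp_jac_sum zeta (n : nat) (r q : 'I_n -> rat) (a b : 'I_n -> nat) :
  p.-primitive_root zeta ->
  (forall i, p.-1%:R * r i = (a i)%:R) -> (forall i, p.-1%:R * q i = (b i)%:R) ->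
  (forall i, 0 < a i)%N -> (forall i, a i < b i)%N -> (forall i, b i <= p.-1)%N ->
  Hp zeta r q 1 = (1 - p%:R)^-1 * \sum_(k < p.-1) jac_term a b k :> K.
Proof.
move=> hz er eq a0 ab bp; rewrite /Hp; congr (_ * _).
rewrite sum_mul_character //; apply: eq_bigr => k _.
rewrite residue_sign ch_neq0 ?signr_eq0 // omX // omN1 // -exprM.
have -> : jac_term a b k =
    (-1) ^+ (n * k) * \prod_j (jac_pair (a j) (b j) k / jac_pair (a j) (b j) 0) :> K.
  by rewrite /jac_term [LHS]big_split /= prodr_const card_ord -exprM mulnC.
congr (_ * _).
by apply: eq_bigr => i _; apply: gauss_ratio.
Qed.

Lemma ratr_rho (x : rat) a : p.-1%:R * x = a%:R -> ratr x = rho a.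
Proof.
move=> e; have n0 : p.-1%:R != 0 :> K by rewrite (natK_neq0 p_pr) //; lia.
rewrite /rho; apply: canRL (mulfK n0) _.
by rewrite mulrC -(ratr_nat K p.-1) -ratrM // e ratr_nat.
Qed.

Lemma ratr_hg_trunc (n : nat) (r q : 'I_n -> rat) (a b : 'I_n -> nat) m :
  (forall i, p.-1%:R * r i = (a i)%:R) -> (forall i, p.-1%:R * q i = (b i)%:R) ->
  ratr (hg_trunc r q 1 m) = trunc_sum a b m :> K.
Proof.
move=> er eq; rewrite /hg_trunc ratr_sum //; apply: eq_bigr => k _.
rewrite expr1n mulr1 ratr_prod //; apply: eq_bigr => i _.
rewrite ratrM // ratrV // /pochhammer !ratr_prod // /pair_coef !spoch_rho //.
congr (_ / _); apply: eq_bigr => j _; rewrite ratrD // ratr_nat; congr (_ + _); exact: ratr_rho.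
Qed.

(** In K an absolute value may lie strictly between 1/p and 1; a reduced fraction excludes this, as
    p divides at most one of its two terms. *)
Lemma ratr_unit (x : rat) : ratr x \in (pint : {pred K}) -> ~ cong 1 (ratr x : K) 0 ->
  pabs (ratr x : K) = 1.
Proof.
move=> hx hn; set d := `|denq x|%N; set m := `|numq x|%N.
have ad : pabs ((denq x)%:~R : K) = pabs (d%:R : K).
  by rewrite /d -[in LHS](gtz0_abs (denq_gt0 x)) -pmulrn.
have am : pabs ((numq x)%:~R : K) = pabs (m%:R : K).
  rewrite /m; case: (numq x) => k; first by rewrite -pmulrn.
  by rewrite NegzE mulrNz -pmulrn pabsN abszN.
have cop : coprime m d by have := coprime_num_den x.
have ex : pabs (ratr x : K) = pabs (m%:R : K) / pabs (d%:R : K).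
  by rewrite /ratr pabsM pabsV ad am.
have nd0 : (0 < d)%N by rewrite absz_gt0 denq_neq0.
have ld : pabs (d%:R : K) <= 1 by have := rpred_nat (@pint R p K) d; rewrite inE.
have d0 : 0 < pabs (d%:R : K) by rewrite lt_def pabs_ge0 pabs_eq0 (natK_neq0 p_pr).
have [hm|hm] := boolP (p %| m)%N.
  have cd : coprime p d by apply: coprime_dvdl cop.
  case: hn; apply/(cong_pabs p_pr); rewrite subr0 ex (pabs_nat_unit p_pr cd) divr1 expr1.
  case/dvdnP: hm => l ->; rewrite natrM mulrC.
  by have /(cong_pabs p_pr) := cong0_pM (rpred_nat (@pint R p K) l); rewrite subr0 expr1.
have m1 : pabs (m%:R : K) = 1 by rewrite pabs_nat_unit // prime_coprime.
apply/eqP; rewrite eq_le; apply/andP; split; first by rewrite inE in hx.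
by rewrite ex m1 div1r invf_ge1.
Qed.

Lemma gamma_quotient_cong (n : nat) (r q : 'I_n -> rat) (a b : 'I_n -> nat) :
  (forall i, p.-1%:R * r i = (a i)%:R) -> (forall i, p.-1%:R * q i = (b i)%:R) ->
  (forall i, 0 < a i)%N -> (forall i, a i < p)%N ->
  (forall i, 0 < b i)%N -> (forall i, b i < p)%N ->
  Qp (gamma_quotient r q : K) /\ cong 1 (gamma_quotient r q : K) (datum_const a b).
Proof.
move=> er eq a0 ap b0 bp; rewrite /gamma_quotient /datum_const.
have hg (x : rat) c : p.-1%:R * x = c%:R -> (0 < c)%N -> (c < p)%N ->
    Qp (morita_gamma (ratr x : K)) /\ cong 1 (morita_gamma (ratr x : K)) (c`!%:R)^-1.
  by move=> ex c0 cp; rewrite (ratr_rho ex); apply: morita_gamma_rho; rewrite ?c0.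
split.
  apply: Qp_prod => // i _; apply: QpM => //; first by have [] := hg _ _ (eq i) (b0 i) (bp i).
  by apply: QpV => //; have [] := hg _ _ (er i) (a0 i) (ap i).
apply: cong_prod => i _; first exact: pint_pair_const.
rewrite /pair_const mulrC -[X in cong _ _ (X * _)]invrK; apply: congM.
- by rewrite invrK rpred_nat.
- exact: pint_factV.
- apply: congV => //; first by rewrite pabsV (pabs_fact p_pr) ?invr1.
  by have [] := hg _ _ (er i) (a0 i) (ap i).
- by have [] := hg _ _ (eq i) (b0 i) (bp i).
Qed.

End CharacterDictionary.

(** The congruence says that every denominator divides p - 1; positivity makes the resulting
    integers natural numbers. *)
Lemma hd_lcd_nat (n : nat) (r q : 'I_n -> rat) (p : nat) : (0 < p)%N ->
  p = 1 %[mod hd_lcd r q] ->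
  (forall i, 0 < r i -> exists a : nat, p.-1%:R * r i = a%:R) /\
  (forall i, 0 < q i -> exists a : nat, p.-1%:R * q i = a%:R).
Proof.
move=> p0 /eqP; rewrite eqn_mod_dvd // subn1 /hd_lcd dvdn_lcm => /andP[h1 h2].
have aux (x : rat) : 0 < x -> (`|denq x| %| p.-1)%N -> exists a : nat, p.-1%:R * x = a%:R.
  move=> x0 /dvdnP[d ->]; exists (d * `|numq x|)%N.
  have dn0 : (denq x)%:~R != 0 :> rat by rewrite intr_eq0 denq_eq0.
  rewrite -[X in _ * X](divq_num_den x) !natrM !pmulrn.
  have -> : `|denq x|%N%:Z = denq x by rewrite gtz0_abs ?denq_gt0.
  have -> : `|numq x|%N%:Z = numq x by rewrite gez0_abs // numq_ge0 ltW.
  by field.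
split=> i x0; apply: aux => //.
  by apply: dvdn_trans h1; apply: (@biglcmn_sup _ i).
by apply: dvdn_trans h2; apply: (@biglcmn_sup _ i).
Qed.

Theorem theorem2p4 (R : realType) (n : nat) (r q : 'I_n -> rat)
  (n_ge2 : (2 <= n)%N)
  (r_range : forall i, 0 < r i < 1)
  (r_sorted : forall i j : 'I_n, (i <= j)%N -> r i <= r j)
  (q_range : forall i, 0 < q i <= 1)
  (q_sorted : forall i j : 'I_n, (i <= j)%N -> q i <= q j)
  (q_last : forall i : 'I_n, (n.-2 <= i)%N -> q i = 1)
  (q_gt_r : forall i j : 'I_n, j = i.+2 :> nat -> q i > r j)
  (gamma_le1 : hd_gamma r q <= 1)
  (p : nat) (K : padicComplexType R p) (zeta : K)
  (p_prime : prime p)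
  (p_mod : p = 1 %[mod hd_lcd r q])
  (p_gt : (n.+1 < p)%N)
  (zeta_prim : p.-primitive_root zeta)
  (ordinary : ~ padic_eqmod 1 (ratr (hg_trunc r q 1 p) : K) 0) :
  padic_eqmod 2
    (Hp zeta r q 1 - (hd_gamma r q == 1)%:R * gamma_quotient r q * p%:R)
    (ratr (hg_trunc r q 1 p)) /\
  forall mu : K, dwork_unit_root r q mu ->
    padic_eqmod 2 (ratr (hg_trunc r q 1 p)) mu.
Proof.
have p_odd : (2 < p)%N by lia.
have [exr exq] := hd_lcd_nat (prime_gt0 p_prime) p_mod.
have [a ha] := choice (fun i => exr i (andP (r_range i)).1).
have [b hb] := choice (fun i => exq i (andP (q_range i)).1).
have P0 : 0 < p.-1%:R :> rat by rewrite ltr0n; lia.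
have cmp_lt (x y : rat) (c d : nat) : p.-1%:R * x = c%:R -> p.-1%:R * y = d%:R ->
  (c < d)%N = (x < y) by move=> ex ey; rewrite -(ltr_nat rat) -ex -ey ltr_pM2l.
have cmp_le (x y : rat) (c d : nat) : p.-1%:R * x = c%:R -> p.-1%:R * y = d%:R ->
  (c <= d)%N = (x <= y) by move=> ex ey; rewrite -(ler_nat rat) -ex -ey ler_pM2l.
have e0 : p.-1%:R * 0 = 0%N%:R :> rat by rewrite mulr0.
have e1 : p.-1%:R * 1 = p.-1%:R :> rat by rewrite mulr1.
have a_gt0 i : (0 < a i)%N by rewrite (cmp_lt _ _ _ _ e0 (ha i)); case/andP: (r_range i).
have a_lt i : (a i < p.-1)%N by rewrite (cmp_lt _ _ _ _ (ha i) e1); case/andP: (r_range i).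
have b_le i : (b i <= p.-1)%N by rewrite (cmp_le _ _ _ _ (hb i) e1); case/andP: (q_range i).
have a_mono (i j : 'I_n) : (i <= j)%N -> (a i <= a j)%N.
  by move=> ij; rewrite (cmp_le _ _ _ _ (ha i) (ha j)); apply: r_sorted.
have b_last (i : 'I_n) : (n.-2 <= i)%N -> b i = p.-1.
  by move=> hi; apply/eqP; rewrite -(eqr_nat rat) -hb q_last // mulr1.
have interlace (i j : 'I_n) : j = i.+2 :> nat -> (a j < b i)%N.
  by move=> hij; rewrite (cmp_lt _ _ _ _ (ha j) (hb i)); apply: q_gt_r.
have ab := a_lt_b p_prime p_odd n_ge2 a_lt a_mono b_last interlace.
have b_ltp i : (b i < p)%N by have := b_le i; lia.
have degE : (datum_deg a b)%:R = p.-1%:R * (hd_gamma r q + 1) :> rat.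
  rewrite /hd_gamma addrC addrA subrr add0r mulr_sumr /datum_deg natr_sum.
  by apply: eq_bigr => i _; rewrite natrB ?(ltnW (ab i)) // mulrBr ha hb.
have deg_le : (datum_deg a b <= 2 * p.-1)%N.
  rewrite -(ler_nat rat) degE natrM mulrC ler_pM2r //; lra.
have deg_eq : (datum_deg a b == 2 * p.-1)%N = (hd_gamma r q == 1).
  rewrite -(eqr_nat rat) degE natrM [2%:R * _]mulrC (inj_eq (mulfI (lt0r_neq0 P0))).
  by apply/eqP/eqP; lra.
have Fe m : ratr (hg_trunc r q 1 m) = trunc_sum a b m :> K by apply: ratr_hg_trunc.
have hF := pint_trunc_sum (K := K) p_prime p_odd n_ge2 a_gt0 a_lt a_mono b_le b_last interlace.
have QF m : Qp (trunc_sum a b m : K) by rewrite -Fe; apply: Qp_ratr.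
split.
- have hH := Hp_jac_sum p_prime p_odd zeta_prim ha hb a_gt0 ab b_le.
  have hJ := jac_sum_cong (K := K) p_prime p_odd n_ge2 a_gt0 a_lt a_mono b_le b_last interlace deg_le.
  have hT := datum_poly_top (K := K) p_prime p_odd n_ge2 a_lt a_mono b_last interlace deg_le.
  rewrite -hH hT deg_eq in hJ.
  have [QG hG] := gamma_quotient_cong (K := K) p_prime p_odd ha hb a_gt0 (fun i => ltn_trans (ab i) (b_ltp i))
    (fun i => ltn_trans (a_gt0 i) (ab i)) b_ltp.
  set d : K := (hd_gamma r q == 1)%:R in hJ *; set G := gamma_quotient r q in QG hG *.
  apply/(padic_eqmodE p_prime); rewrite Fe; split.
    apply: QpB => //; apply: QpB => //; last first.
      by apply: QpM => //; [apply: QpM => //; apply: Qp_nat|apply: Qp_nat].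
    rewrite hH; apply: QpM => //.
      by apply: QpV => //; apply: QpB => //; [apply: (Qp_nat 1)|apply: Qp_nat].
    apply: Qp_sum => // k _; apply: Qp_prod => // i _; apply: QpM => //.
      by apply: QpX => //; apply: QpN => //; apply: (Qp_nat 1).
    by apply: QpM => //; [apply: Qp_jac|apply: QpV => //; apply: Qp_jac].
  have hd : d \in pint by apply: rpred_nat.
  have h := congB hJ (cong1_pM (congMl hd hG)).
  rewrite addrK in h; apply: cong_trans _ h.
  by apply: cong_eq; rewrite mulrC.
(* At s = 1 the defining congruence has precision p^2 and concerns F_2/F_1. As F_2 = F_1^2 modulo
   p^2 and F_1 is a unit by ordinarity, this quotient is F_1. *)
- move=> mu [[Qmu _] mu1 hmu]; have := hmu 1%N.
  rewrite expn1 -mulnn ratrM // ratrV // !Fe => /(padic_eqmodE p_prime)[_ h].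
  have F1 : pabs (trunc_sum a b p : K) = 1.
    rewrite -Fe; apply: ratr_unit => //; first by rewrite Fe.
    by move=> h1; apply: ordinary; apply/(padic_eqmodE p_prime); rewrite subr0; split=> //; apply: Qp_ratr.
  apply/(padic_eqmodE p_prime); split; first exact: QpB.
  apply: cong_trans h; apply: cong_sym; apply: cong_divl => //.
  exact: (trunc_sum_dwork p_prime p_odd n_ge2 a_gt0 a_lt a_mono b_le b_last interlace deg_le).
Qed.
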